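(* The system $\mathsf{RCA}_0^\omega$ proves $\mathsf{HBC}_1\to\mathsf{NBI}$, while $\mathsf{Z}_2^\omega+\mathsf{HBC}_1$ does not prove $\mathsf{NIN}$. Here: $\mathsf{HBC}_1$: for every strongly countable $A\subset\mathbb{R}^2$ with $(\forall x\in[0,1])(\exists(a,b)\in A)(x\in(a,b))$, there are $(a_0,b_0),\dots,(a_k,b_k)\in A$ with $(\forall x\in[0,1])(\exists i\le k)(x\in(a_i,b_i))$. $\mathsf{NIN}$: for any $Y:[0,1]\to\mathbb{N}$ there are $x,y\in[0,1]$ with $x\neq_{\mathbb{R}}y$ and $Y(x)=Y(y)$. $\mathsf{NBI}$: for any $Y:[0,1]\to\mathbb{N}$, either there are $x,y\in[0,1]$ with $x\neq_{\mathbb{R}}y$ and $Y(x)=Y(y)$, or there is $N\in\mathbb{N}$ with $(\forall x\in[0,1])(Y(x)\neq N)$.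
   Context: Finite types: $0$ is a type (natural numbers), and if $\sigma,\tau$ are types then so is $\sigma\to\tau$; $1:=0\to 0$ and $n+1:=n\to 0$; superscripts indicate types. $\mathsf{L}_\omega$ is the many-sorted language with variables of every finite type, constants $0,1,<_0,+_0,\times_0,=_0$ (with usual meaning), typed combinators $\Pi,\Sigma$, and recursor constants $\mathbf{R}_\sigma$. For $\tau=(\tau_1\to\dots\to\tau_k\to 0)$, $x=_\tau y$ abbreviates $\forall z_1^{\tau_1}\dots z_k^{\tau_k}(xz_1\dots z_k=_0 yz_1\dots z_k)$. $\mathsf{QF\text{-}AC}^{\sigma,\tau}$ is the schema $(\forall x^\sigma)(\exists y^\tau)A(x,y)\to(\exists Y^{\sigma\to\tau})(\forall x^\sigma)A(x,Y(x))$ for quantifier-free $A$ of $\mathsf{L}_\omega$. $\mathsf{RCA}_0^\omega$ (Kohlenbach's base theory, classical logic) has the following axioms: ordered semi-ring axioms for $0,1,<_0,+_0,\times_0$; defining axioms of $\Pi,\Sigma$ (giving $\lambda$-abstraction); $\mathbf{R}_0(f,m,0)=m$ and $\mathbf{R}_0(f,m,n+1)=f(n,\mathbf{R}_0(f,m,n))$; extensionality $x=_\rho y\to\varphi(x)=_\tau\varphi(y)$ for all types $\rho,\tau$; induction for quantifier-free formulas of $\mathsf{L}_\omega$; and $\mathsf{QF\text{-}AC}^{1,0}$. Finite sequences are coded as usual. For $g^1$, $\overline{g}n$ is the (code of the) sequence $\langle g(0),\dots,g(n-1)\rangle$. $(\mathsf{S}_k^2)$ is the axiom stating the existence of a type 2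 functional $\mathsf{S}_k^2$ with values in $\{0,1\}$ deciding the truth of $\Sigma^1_k$-formulas of second-order arithmetic (function parameters allowed), e.g. for $k=1$: $(\forall f^1)[(\exists g^1)(\forall n^0)(f(\overline{g}n)=0)\leftrightarrow \mathsf{S}_1(f)=0]$, and for general $k$ the same with the normal form of $\Sigma^1_k$-formulas. $\mathsf{Z}_2^\omega:=\bigcup_k(\mathsf{RCA}_0^\omega+(\mathsf{S}_k^2))$. Inside these theories a real is a sequence of rationals $(q_n)$ with $|q_n-q_{n+i}|<2^{-n}$ for all $n,i$; reals $x,y$ represented by $(q_n),(r_n)$ satisfy $x=_{\mathbb{R}}y$ iff $|q_n-r_n|\le 2^{-n+1}$ for all $n$. Functions on $[0,1]$, $\mathbb{R}$ or $\mathbb{R}^2$ with values in $\mathbb{N}$ or $\mathbb{R}$ are objects of the corresponding finite type that map $=_{\mathbb{R}}$-equal arguments to equal values. Subsets of $\mathbb{R}$ or $\mathbb{R}^2$ are given by characteristic functions. A set $A\subseteq\mathbb{R}$ is strongly countable if there is $Y:\mathbb{R}\to\mathbb{N}$ with $(\forall x,y\in A)(Y(x)=Y(y)\to x=_{\mathbb{R}}y)\wedge(\forall n\in\mathbb{N})(\exists x\in A)(Y(x)=n)$, and similarly for $A\subseteq\mathbb{R}^2$ with $Y:\mathbb{R}^2\to\mathbb{N}$. *)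

(* Defs.v *)
From mathcomp Require Import all_boot.
Set Implicit Arguments.
Unset Strict Implicit.
Unset Printing Implicit Defensive.

Inductive ty : Type := tN | Arr (s t : ty).

Declare Scope ty_scope.
Delimit Scope ty_scope with ty.
Bind Scope ty_scope with ty.
Notation "s ⟶ t" := (Arr s t) (at level 62, right associativity) : ty_scope.
Open Scope ty_scope.

Definition t1 : ty := tN ⟶ tN.
Definition t2 : ty := t1 ⟶ tN.

(** Syntax is intrinsically typed: a context [G] lists the types of the free
    variables, which are de Bruijn indices. *)
Definition ctx := seq ty.

Inductive var : ctx -> ty -> Type :=
| Vz t G : var (t :: G) t
| Vs s t G : var G t -> var (s :: G) t.
Arguments Vz {t G}.
Arguments Vs {s t G} _.

Definition vcase (P : ty -> Type) s G (z : P s) (r : forall t, var G t -> P t)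
    t (v : var (s :: G) t) : P t :=
  match v in var D t
    return match D with
           | [::] => unit
           | s :: G => P s -> (forall t, var G t -> P t) -> P t
           end with
  | Vz _ _ => fun z _ => z
  | Vs _ _ _ v => fun _ r => r _ v
  end z r.

Inductive tm (G : ctx) : ty -> Type :=
| Var t : var G t -> tm G t
| App s t : tm G (s ⟶ t) -> tm G s -> tm G t
| Zero : tm G tN
| One : tm G tN
| Plus : tm G (tN ⟶ tN ⟶ tN)
| Times : tm G (tN ⟶ tN ⟶ tN)
| Pi s t : tm G (s ⟶ t ⟶ s)
| Sigma r s t : tm G ((r ⟶ s ⟶ t) ⟶ (r ⟶ s) ⟶ r ⟶ t)
| Rec s : tm G ((tN ⟶ s ⟶ s) ⟶ s ⟶ tN ⟶ s).
Arguments Var {G t} _.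
Arguments Zero {G}.
Arguments One {G}.
Arguments Plus {G}.
Arguments Times {G}.
Arguments Pi {G s t}.
Arguments Sigma {G r s t}.
Arguments Rec {G s}.

Inductive fm (G : ctx) : Type :=
| Eq0 (x y : tm G tN)
| Lt0 (x y : tm G tN)
| Bot
| And (A B : fm G)
| Or (A B : fm G)
| Imp (A B : fm G)
| All t (A : fm (t :: G))
| Ex t (A : fm (t :: G)).
Arguments Bot {G}.
Arguments All {G} t A.
Arguments Ex {G} t A.

Declare Scope fm_scope.
Delimit Scope fm_scope with fm.
Bind Scope fm_scope with fm tm.
Notation "f · x" := (App f x) (at level 25, left associativity) : fm_scope.
Notation "x ⊕ y" := (App (App Plus x) y)
  (at level 50, left associativity) : fm_scope.
Notation "x ⊗ y" := (App (App Times x) y)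
  (at level 40, left associativity) : fm_scope.
Notation "x ≐ y" := (Eq0 x y) (at level 70) : fm_scope.
Notation "x ≺ y" := (Lt0 x y) (at level 70) : fm_scope.
Notation "A ⊓ B" := (And A B) (at level 80, right associativity) : fm_scope.
Notation "A ⊔ B" := (Or A B) (at level 85, right associativity) : fm_scope.
Notation "A ⊃ B" := (Imp A B) (at level 90, right associativity) : fm_scope.
Notation "A ⇔ B" := (And (Imp A B) (Imp B A)) (at level 95) : fm_scope.
Notation "¬ A" := (Imp A Bot) (at level 75, right associativity) : fm_scope.
Open Scope fm_scope.

Fixpoint qf G (A : fm G) : bool :=
  match A with
  | Eq0 _ _ | Lt0 _ _ | Bot => true
  | And A B | Or A B | Imp A B => qf A && qf B
  | All _ _ | Ex _ _ => false
  end.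

Definition ren (G D : ctx) := forall t, var G t -> var D t.
Definition sub (G D : ctx) := forall t, var G t -> tm D t.

Fixpoint tsub G D (f : sub G D) t (x : tm G t) : tm D t :=
  match x with
  | Var _ v => f _ v
  | App _ _ x y => tsub f x · tsub f y
  | Zero => Zero
  | One => One
  | Plus => Plus
  | Times => Times
  | Pi _ _ => Pi
  | Sigma _ _ _ => Sigma
  | Rec _ => Rec
  end.

Definition tren G D (f : ren G D) : forall t, tm G t -> tm D t :=
  tsub (fun t v => Var (f t v)).

Definition shift s G : ren G (s :: G) := fun t v => Vs v.
Definition wk s G t (x : tm G t) : tm (s :: G) t := tren (@shift s G) x.
Arguments wk {s G t} x.

Definition scons s G D (x : tm D s) (f : sub G D) : sub (s :: G) D :=
  vcase (P := fun t => tm D t) x f.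
Definition up s G D (f : sub G D) : sub (s :: G) (s :: D) :=
  scons (Var Vz) (fun t v => wk (f t v)).

Fixpoint fsub G D (f : sub G D) (A : fm G) : fm D :=
  match A with
  | Eq0 x y => tsub f x ≐ tsub f y
  | Lt0 x y => tsub f x ≺ tsub f y
  | Bot => Bot
  | And A B => fsub f A ⊓ fsub f B
  | Or A B => fsub f A ⊔ fsub f B
  | Imp A B => fsub f A ⊃ fsub f B
  | All t A => All t (fsub (up f) A)
  | Ex t A => Ex t (fsub (up f) A)
  end.

Definition fren G D (f : ren G D) : fm G -> fm D :=
  fsub (fun t v => Var (f t v)).
Definition fwk s G (A : fm G) : fm (s :: G) := fren (@shift s G) A.
Arguments fwk {s G} A.

Definition inst s G (A : fm (s :: G)) (x : tm G s) : fm G :=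
  fsub (scons x (fun t v => Var v)) A.

Definition no_var G : ren [::] G :=
  fun t v => match v in var D _ return if D is [::] then var G t else unit with
             | Vz _ _ => tt
             | Vs _ _ _ _ => tt
             end.
Definition lift G (A : fm [::]) : fm G := fren (no_var G) A.

Fixpoint wks (D : ctx) G t (x : tm G t) : tm (D ++ G) t :=
  if D is s :: D' then wk (wks D' x) else x.
Fixpoint Alls (D : ctx) G : fm (D ++ G) -> fm G :=
  match D with
  | [::] => fun A => A
  | s :: D' => fun A => Alls (D := D') (All s A)
  end.
Fixpoint Exs (D : ctx) G : fm (D ++ G) -> fm G :=
  match D with
  | [::] => fun A => A
  | s :: D' => fun A => Exs (D := D') (Ex s A)
  end.
Arguments Alls D {G} A.
Arguments Exs D {G} A.

Definition v0 a G : tm (a :: G) a := Var Vz.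
Definition v1 a b G : tm (b :: a :: G) a := wk (v0 a G).
Definition v2 a b c G : tm (c :: b :: a :: G) a := wk (v1 a b G).
Definition v3 a b c d G : tm (d :: c :: b :: a :: G) a := wk (v2 a b c G).
Definition v4 a b c d e G : tm (e :: d :: c :: b :: a :: G) a :=
  wk (v3 a b c d G).
Definition v5 a b c d e f G : tm (f :: e :: d :: c :: b :: a :: G) a :=
  wk (v4 a b c d e G).
Arguments v0 {a G}.
Arguments v1 {a b G}.
Arguments v2 {a b c G}.
Arguments v3 {a b c d G}.
Arguments v4 {a b c d e G}.
Arguments v5 {a b c d e f G}.

(** Bracket abstraction; the term for a bound variable is [I = S K K]. *)
Fixpoint lam s G t (x : tm (s :: G) t) : tm G (s ⟶ t) :=
  match x with
  | Var _ v => vcase (P := fun t => tm G (s ⟶ t))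
                 (Sigma · Pi · (Pi (t := s))) (fun t v => Pi · Var v) v
  | App _ _ x y => Sigma · lam x · lam y
  | Zero => Pi · Zero
  | One => Pi · One
  | Plus => Pi · Plus
  | Times => Pi · Times
  | Pi _ _ => Pi · Pi
  | Sigma _ _ _ => Pi · Sigma
  | Rec _ => Pi · Rec
  end.

Fixpoint eqt t G : tm G t -> tm G t -> fm G :=
  match t with
  | tN => fun x y => x ≐ y
  | s ⟶ t => fun x y => All s (eqt (wk x · v0) (wk y · v0))
  end.

Definition Le0 G (x y : tm G tN) : fm G := x ≺ y ⊔ x ≐ y.
Notation "x ⪯ y" := (Le0 x y) (at level 70) : fm_scope.

(** A theory may contain open formulas; these are axioms in every context, so
    they have the force of their universal closures. *)
Definition theory := forall G, fm G -> Prop.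

(** Classical many-sorted natural deduction with equality at type [tN]. *)
Inductive prf (T : theory) : forall G, seq (fm G) -> fm G -> Prop :=
| prf_ax G (H : seq (fm G)) A : T G A -> prf T H A
| prf_hyp G (H1 H2 : seq (fm G)) A : prf T (H1 ++ A :: H2) A
| prf_andI G (H : seq (fm G)) A B : prf T H A -> prf T H B -> prf T H (A ⊓ B)
| prf_andEl G (H : seq (fm G)) A B : prf T H (A ⊓ B) -> prf T H A
| prf_andEr G (H : seq (fm G)) A B : prf T H (A ⊓ B) -> prf T H B
| prf_orIl G (H : seq (fm G)) A B : prf T H A -> prf T H (A ⊔ B)
| prf_orIr G (H : seq (fm G)) A B : prf T H B -> prf T H (A ⊔ B)
| prf_orE G (H : seq (fm G)) A B C :
    prf T H (A ⊔ B) -> prf T (A :: H) C -> prf T (B :: H) C -> prf T H C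
| prf_impI G (H : seq (fm G)) A B : prf T (A :: H) B -> prf T H (A ⊃ B)
| prf_impE G (H : seq (fm G)) A B : prf T H (A ⊃ B) -> prf T H A -> prf T H B
| prf_raa G (H : seq (fm G)) A : prf T ((¬ A) :: H) Bot -> prf T H A
| prf_allI G (H : seq (fm G)) t (A : fm (t :: G)) :
    prf T (map fwk H) A -> prf T H (All t A)
| prf_allE G (H : seq (fm G)) t (A : fm (t :: G)) x :
    prf T H (All t A) -> prf T H (inst A x)
| prf_exI G (H : seq (fm G)) t (A : fm (t :: G)) x :
    prf T H (inst A x) -> prf T H (Ex t A)
| prf_exE G (H : seq (fm G)) t (A : fm (t :: G)) B :
    prf T H (Ex t A) -> prf T (A :: map fwk H) (fwk B) -> prf T H B
| prf_refl G (H : seq (fm G)) (x : tm G tN) : prf T H (x ≐ x)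
| prf_subst G (H : seq (fm G)) (A : fm (tN :: G)) x y :
    prf T H (x ≐ y) -> prf T H (inst A x) -> prf T H (inst A y).

Definition proves (T : theory) (A : fm [::]) : Prop := prf T [::] A.

Definition add_axiom (T : theory) (S : fm [::]) : theory :=
  fun G A => T G A \/ A = lift G S.

(** [A(n+1)], where [n] is the variable 0 of [A]. *)
Definition at_succ G (A : fm (tN :: G)) : fm (tN :: G) :=
  fsub (scons (v0 ⊕ One) (fun t v => Var (Vs v))) A.

(** [A(x, Y(x))], where [y] and [x] are the variables 0 and 1 of [A], and [x]
    and [Y] are the variables 0 and 1 of the result. *)
Definition at_choice G (A : fm (tN :: t1 :: G)) : fm (t1 :: t2 :: G) :=
  fsub (scons (v1 · v0) (scons v0 (fun t v => Var (Vs (Vs v))))) A.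

(** That numbers are nonnegative and that the order is discrete is not listed:
    both follow from the ordered semi-ring axioms with induction and [Rec]. *)
Inductive RCA0w : theory :=
| ax_addA G (x y z : tm G tN) : RCA0w (x ⊕ (y ⊕ z) ≐ x ⊕ y ⊕ z)
| ax_addC G (x y : tm G tN) : RCA0w (x ⊕ y ≐ y ⊕ x)
| ax_add0 G (x : tm G tN) : RCA0w (x ⊕ Zero ≐ x)
| ax_mulA G (x y z : tm G tN) : RCA0w (x ⊗ (y ⊗ z) ≐ x ⊗ y ⊗ z)
| ax_mulC G (x y : tm G tN) : RCA0w (x ⊗ y ≐ y ⊗ x)
| ax_mul1 G (x : tm G tN) : RCA0w (x ⊗ One ≐ x)
| ax_mul0 G (x : tm G tN) : RCA0w (x ⊗ Zero ≐ Zero)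
| ax_mulD G (x y z : tm G tN) : RCA0w (x ⊗ (y ⊕ z) ≐ x ⊗ y ⊕ x ⊗ z)
| ax_ltI G (x : tm G tN) : RCA0w (¬ (x ≺ x))
| ax_ltT G (x y z : tm G tN) : RCA0w (x ≺ y ⊃ y ≺ z ⊃ x ≺ z)
| ax_lt_total G (x y : tm G tN) : RCA0w (x ≺ y ⊔ x ≐ y ⊔ y ≺ x)
| ax_lt01 G : @RCA0w G (Zero ≺ One)
| ax_lt_add G (x y z : tm G tN) : RCA0w (x ≺ y ⊃ x ⊕ z ≺ y ⊕ z)
| ax_lt_mul G (x y z : tm G tN) : RCA0w (Zero ≺ z ⊃ x ≺ y ⊃ x ⊗ z ≺ y ⊗ z)
| ax_Pi G s t (x : tm G s) (y : tm G t) : RCA0w (eqt (Pi · x · y) x)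
| ax_Sigma G r s t (x : tm G (r ⟶ s ⟶ t)) (y : tm G (r ⟶ s)) (z : tm G r) :
    RCA0w (eqt (Sigma · x · y · z) (x · z · (y · z)))
| ax_rec0 G (f : tm G (tN ⟶ tN ⟶ tN)) m : RCA0w (Rec · f · m · Zero ≐ m)
| ax_recS G (f : tm G (tN ⟶ tN ⟶ tN)) m n :
    RCA0w (Rec · f · m · (n ⊕ One) ≐ f · n · (Rec · f · m · n))
| ax_ext G s t (f : tm G (s ⟶ t)) x y : RCA0w (eqt x y ⊃ eqt (f · x) (f · y))
| ax_ind G (A : fm (tN :: G)) :
    qf A -> RCA0w (inst A Zero ⊓ All tN (A ⊃ at_succ A) ⊃ All tN A)
| ax_qfac G (A : fm (tN :: t1 :: G)) :
    qf A -> RCA0w (All t1 (Ex tN A) ⊃ Ex t2 (All t1 (at_choice A))).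

Definition tri G (n : tm G tN) : tm G tN :=
  Rec · lam (lam (v0 ⊕ (v1 ⊕ One))) · Zero · n.
(** Cantor pairing [(x+y)(x+y+1)/2 + y]. *)
Definition cpair G (x y : tm G tN) : tm G tN := tri (x ⊕ y) ⊕ y.
Definition exp2 G (n : tm G tN) : tm G tN := Rec · lam (lam (v0 ⊕ v0)) · One · n.

(** The empty sequence is coded by 0, and [s] followed by [x] by
    [cpair s x + 1]; this is a bijection between finite sequences and numbers. *)
Definition bar G (g : tm G t1) (n : tm G tN) : tm G tN :=
  Rec · lam (lam (cpair v0 (wk (wk g) · v1) ⊕ One)) · Zero · n.

Definition tuple_code G (xs : seq (tm G tN)) : tm G tN :=
  if xs is x :: xs' then foldl (@cpair G) x xs' else Zero.

(** With [b = true] and [gs = [::]], this is the normal form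
    [exists g_1, forall g_2, ..., Q g_k, Q' n,
       f (tuple_code (bar g_1 n, ..., bar g_k n)) = 0]
    with alternating quantifiers; at each stage [b] says whether the next
    quantifier is existential, and [gs] lists the functions bound so far. *)
Fixpoint normal_form (k : nat) (b : bool) G (f : tm G t1) (gs : seq (tm G t1)) :
    fm G :=
  match k with
  | 0 => (if b then Ex tN else All tN)
           (wk f · tuple_code [seq bar (wk g) v0 | g <- gs] ≐ Zero)
  | k.+1 => (if b then Ex t1 else All t1)
              (normal_form k (~~ b) (wk f) (rcons (map wk gs) v0))
  end.

Definition Sigma1 (k : nat) G (f : tm G t1) : fm G := normal_form k true f [::].

Definition S_axiom (k : nat) : fm [::] :=
  Ex t2 (All t1 ((v1 · v0 ≐ Zero ⊔ v1 · v0 ≐ One)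
                 ⊓ (Sigma1 k v0 ⇔ v1 · v0 ≐ Zero))).

Inductive Z2w : theory :=
| Z2w_RCA0w G (A : fm G) : RCA0w A -> Z2w A
| Z2w_S k G : 0 < k -> Z2w (lift G (S_axiom k)).

(** A number [q = cpair (cpair p m) d] codes the rational [(p - m) / (d + 1)]. *)
Definition codeQ G (p m d : tm G tN) : tm G tN := cpair (cpair p m) d.

(** The relation [P] between the rationals [q - r] and [c * 2^-n], where [P] is
    [<] or [<=], after multiplication by [2^n] and the denominators. *)
Definition diffQ (P : forall G, tm G tN -> tm G tN -> fm G) G (q r c n : tm G tN) :
    fm G :=
  let D := [:: tN; tN; tN; tN; tN; tN] in
  let q := wks D q in let r := wks D r in
  let c := wks D c in let n := wks D n in
  let p1 := v0 in let m1 := v1 in let d1 := v2 in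
  let p2 := v3 in let m2 := v4 in let d2 := v5 in
  Exs D (q ≐ codeQ p1 m1 d1 ⊓ r ≐ codeQ p2 m2 d2
         ⊓ P _ (exp2 n ⊗ (p1 ⊗ (d2 ⊕ One) ⊕ m2 ⊗ (d1 ⊕ One)))
               (exp2 n ⊗ (m1 ⊗ (d2 ⊕ One) ⊕ p2 ⊗ (d1 ⊕ One))
                ⊕ c ⊗ ((d1 ⊕ One) ⊗ (d2 ⊕ One)))).

Definition distQ P G (q r c n : tm G tN) : fm G :=
  diffQ P q r c n ⊓ diffQ P r q c n.

Definition two G : tm G tN := One ⊕ One.
Arguments two {G}.

Definition real G (x : tm G t1) : fm G :=
  All tN (All tN (distQ Lt0 (wks [:: tN; tN] x · v1) (wks [:: tN; tN] x · (v1 ⊕ v0))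
                  One v1)).

Definition eqR G (x y : tm G t1) : fm G :=
  All tN (distQ Le0 (wk x · v0) (wk y · v0) two v0).
Definition leR G (x y : tm G t1) : fm G :=
  All tN (diffQ Le0 (wk x · v0) (wk y · v0) two v0).
(** Equivalently [y_n - x_n > 2^(-n+1)] for some [n]. *)
Definition ltR G (x y : tm G t1) : fm G := ¬ leR y x.

Definition zeroR G : tm G t1 := Pi · codeQ Zero Zero Zero.
Definition oneR G : tm G t1 := Pi · codeQ One Zero Zero.

Definition in01 G (x : tm G t1) : fm G :=
  real x ⊓ leR (zeroR G) x ⊓ leR x (oneR G).
Definition in_interval G (a b x : tm G t1) : fm G := ltR a x ⊓ ltR x b.

Definition All01 G (A : fm (t1 :: G)) : fm G := All t1 (in01 v0 ⊃ A).
Definition Ex01 G (A : fm (t1 :: G)) : fm G := Ex t1 (in01 v0 ⊓ A).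

Definition tR2 : ty := t1 ⟶ t1 ⟶ tN.

(** [Y : [0,1] -> N] *)
Definition fun01N G (Y : tm G t2) : fm G :=
  let Y := wks [:: t1; t1] Y in
  All01 (All01 (eqR v1 v0 ⊃ Y · v1 ≐ Y · v0)).

(** [Y : R^2 -> N] *)
Definition funR2N G (Y : tm G tR2) : fm G :=
  let D := [:: t1; t1; t1; t1] in
  let Y := wks D Y in
  let x := v0 in let y := v1 in let x' := v2 in let y' := v3 in
  Alls D (real x ⊓ real y ⊓ real x' ⊓ real y' ⊃ eqR x x' ⊓ eqR y y'
          ⊃ Y · x · y ≐ Y · x' · y').

Definition subsetR2 G (F : tm G tR2) : fm G :=
  funR2N F
  ⊓ Alls [:: t1; t1] (real v0 ⊓ real v1
      ⊃ let Fxy := wks [:: t1; t1] F · v0 · v1 in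
        Fxy ≐ Zero ⊔ Fxy ≐ One).

Definition memR2 G (F : tm G tR2) (a b : tm G t1) : fm G :=
  real a ⊓ real b ⊓ F · a · b ≐ One.

Definition strongly_countableR2 G (F : tm G tR2) : fm G :=
  Ex tR2
    (let F := wk F in
     funR2N v0
     ⊓ (let D := [:: t1; t1; t1; t1] in
        let F := wks D F in let Y := v4 in
        let a := v0 in let b := v1 in let a' := v2 in let b' := v3 in
        Alls D (memR2 F a b ⊓ memR2 F a' b' ⊃ Y · a · b ≐ Y · a' · b'
                ⊃ eqR a a' ⊓ eqR b b'))
     ⊓ (let D := [:: t1; t1; tN] in
        let F := wks D F in let Y := v3 in
        let a := v0 in let b := v1 in let n := v2 in
        All tN (Exs [:: t1; t1] (memR2 F a b ⊓ Y · a · b ≐ n)))).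

(** A finite sequence of pairs of reals is given by [k] and two sequences of
    type [tN ⟶ t1], of which only the entries [i <= k] matter. *)
Definition HBC1 : fm [::] :=
  All tR2
    (subsetR2 v0 ⊓ strongly_countableR2 v0
     ⊓ All01 (Exs [:: t1; t1]
         (let a := v0 in let b := v1 in let x := v2 in let F := v3 in
          memR2 F a b ⊓ in_interval a b x))
     ⊃ Exs [:: tN ⟶ t1; tN ⟶ t1; tN]
         (All tN
            (let i := v0 in let a := v1 in let b := v2 in
             let k := v3 in let F := v4 in
             i ⪯ k ⊃ memR2 F (a · i) (b · i))
          ⊓ All01 (Ex tN
              (let i := v0 in let x := v1 in
               let a := v2 in let b := v3 in let k := v4 in
               i ⪯ k ⊓ in_interval (a · i) (b · i) x)))).

Definition collision G (Y : tm G t2) : fm G :=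
  Ex01 (Ex01 (let Y := wks [:: t1; t1] Y in
              ¬ eqR v1 v0 ⊓ Y · v1 ≐ Y · v0)).

Definition NIN : fm [::] := All t2 (fun01N v0 ⊃ collision v0).

Definition NBI : fm [::] :=
  All t2 (fun01N v0
          ⊃ collision v0 ⊔ Ex tN (All01 (¬ (v2 · v0 ≐ v1)))).

(* Main.v *)
(** For the implication, work in an arbitrary model of [RCA0w], which suffices
    by the completeness theorem. Suppose that [Y] is a bijection from [[0,1]] to
    the numbers. The intervals of radius [2^-(2 Y(x) + 3)] around the points [x]
    form a strongly countable cover, indexed by [Y] applied to the midpoint.
    Nested intervals of length [4^-n], where step [n] avoids the interval of
    index [n], converge to a point outside any given finite subfamily.

    For the unprovability, force a generic injection from the classes of equal
    reals to the numbers by partial injections that leave infinitely many values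
    unused. Objects of higher type are named by arbitrary functionals of the
    partial injections. A fusion argument shows that no new function on the
    numbers is added, so second-order arithmetic is absolute and the functionals
    [S_k] exist. A strongly countable set of pairs of reals is enumerated by a
    sequence of the ground model, so [HBC1] reduces to the Heine-Borel theorem
    there, while the generic injection refutes [NIN]. *)
From HB Require Import structures.
From mathcomp Require Import all_boot all_order all_algebra.
From mathcomp Require Import boolp.
From Stdlib Require Import Classical Eqdep Ring.
Require Import Defs.
(* MathComp's [ring] shadows this one, which handles semirings. *)
Ltac semiring := ring.
From mathcomp Require Import ring lra.
Set Implicit Arguments.
Unset Strict Implicit.
Unset Printing Implicit Defensive.
Import GRing.Theory Num.Theory Order.TTheory.

(** * Substitution *)

(** A set needs a characteristic functional, yet equality of reals is undecidable in [RCA0w]. A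
    collision-free [Y] supplies the test: [x] equals 0 exactly if the numbers [Y x] and [Y 0] agree.
    Strong countability also asks for an index onto all numbers, so injectivity and surjectivity of
    [Y] are both used. The interval of index [n] has length [4^-n / 4]; the total is 1/3, which
    leaves room to avoid any finite subfamily. By this implication the generic injection cannot be
    onto. With finite conditions its values along a ground sequence of reals would form a new
    function; so parts may be infinite, and the infinite stock of free values lets infinitely many
    decisions be made in succession. In an ordinary extension the range would still be a new set.
    Here a value of a name is determined by the part of a condition alone, over all worlds above it,
    and leaving a number out of the range determines nothing. The ground model is the full type
    structure of the metatheory. No generic object exists, only a sound forcing relation. As no real
    is added, the classes of ground reals suffice as arguments of the injection. *)

Notation funext := functional_extensionality_dep.

(** The return predicate of the match is computed from the context, which makes dependent case
    analysis possible without an axiom on equality of types. *)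
Lemma varP s G (P : forall t, var (s :: G) t -> Prop) :
  P s Vz -> (forall t v, P t (Vs v)) -> forall t v, P t v.
Proof.
move=> hz hs t v.
by refine (match v as v' in var D t
  return match D return var D t -> Prop with
         | [::] => fun _ => True
         | s :: G => fun v => forall P : forall t, var (s :: G) t -> Prop,
             P s Vz -> (forall t v, P t (Vs v)) -> P t v
         end v' with
  | Vz _ _ => fun P hz _ => hz
  | Vs _ _ _ v => fun P _ hs => hs _ v
  end P hz hs).
Qed.

Lemma var_nil t (v : var [::] t) : False.
Proof. exact: (match v in var D _ return if D is [::] then False else True with
  | Vz _ _ => I | Vs _ _ _ _ => I end). Qed.

Lemma subP s G (P : ty -> Type) (f g : forall t, var (s :: G) t -> P t) :
  f s Vz = g s Vz -> (forall t v, f t (Vs v) = g t (Vs v)) -> f = g.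
Proof. by move=> hz hs; apply: funext => t; apply: funext => v; move: t v; exact: varP. Qed.

Definition idsub G : sub G G := fun t v => Var v.
Definition sub_then G D E (f : sub G D) (g : sub D E) : sub G E :=
  fun t v => tsub g (f t v).

Lemma tsub_comp G D E (f : sub G D) (g : sub D E) t (x : tm G t) :
  tsub g (tsub f x) = tsub (sub_then f g) x.
Proof. by elim: x => //= ? ? ? -> ? ->. Qed.

Lemma tsub_id G t (x : tm G t) : tsub (@idsub G) x = x.
Proof. by elim: x => //= ? ? ? -> ? ->. Qed.

Lemma wk_tsub s G D (g : sub (s :: G) D) t (x : tm G t) :
  tsub g (wk x) = tsub (fun t v => g t (Vs v)) x.
Proof. by rewrite /wk /tren tsub_comp. Qed.

Lemma up_wk s G D (f : sub G D) t (x : tm G t) :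
  tsub (up (s := s) f) (wk x) = wk (tsub f x).
Proof. by rewrite wk_tsub /wk /tren tsub_comp. Qed.

Lemma up_comp s G D E (f : sub G D) (g : sub D E) :
  sub_then (up (s := s) f) (up g) = up (sub_then f g).
Proof. by apply: subP => //= t v; rewrite /sub_then /= up_wk. Qed.

Lemma up_id s G : up (s := s) (@idsub G) = @idsub (s :: G).
Proof. by apply: subP. Qed.

Lemma fsub_comp G (A : fm G) D E (f : sub G D) (g : sub D E) :
  fsub g (fsub f A) = fsub (sub_then f g) A.
Proof.
elim: A D E f g => {G} //=.
- by move=> *; rewrite !tsub_comp.
- by move=> *; rewrite !tsub_comp.
- by move=> G A IHA B IHB *; rewrite IHA IHB.
- by move=> G A IHA B IHB *; rewrite IHA IHB.
- by move=> G A IHA B IHB *; rewrite IHA IHB.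
- by move=> G t A IHA *; rewrite IHA up_comp.
- by move=> G t A IHA *; rewrite IHA up_comp.
Qed.

Lemma fsub_id G (A : fm G) : fsub (@idsub G) A = A.
Proof.
elim: A => {G} //=.
- by move=> *; rewrite !tsub_id.
- by move=> *; rewrite !tsub_id.
- by move=> G A -> B ->.
- by move=> G A -> B ->.
- by move=> G A -> B ->.
- by move=> G t A; rewrite up_id => ->.
- by move=> G t A; rewrite up_id => ->.
Qed.

Lemma fsub_inst s G D (f : sub G D) (A : fm (s :: G)) x :
  fsub f (inst A x) = inst (fsub (up f) A) (tsub f x).
Proof.
rewrite /inst !fsub_comp; congr fsub; apply: subP => //= t v.
by rewrite /sub_then /= wk_tsub /= tsub_id.
Qed.

Lemma inst_up s G D (f : sub G D) (A : fm (s :: G)) x :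
  inst (fsub (up f) A) x = fsub (scons x f) A.
Proof.
rewrite /inst !fsub_comp; congr fsub; apply: subP => //= t v.
by rewrite /sub_then /= wk_tsub /= tsub_id.
Qed.

Lemma fsub_eqt t G D (f : sub G D) (x y : tm G t) :
  fsub f (eqt x y) = eqt (tsub f x) (tsub f y).
Proof.
elim: t G D f x y => //= s _ t IH G D f x y.
by rewrite IH /= !up_wk.
Qed.

Lemma qf_fsub G (A : fm G) D (f : sub G D) : qf (fsub f A) = qf A.
Proof. by elim: A D f => {G} //= G A IHA B IHB D f; rewrite IHA IHB. Qed.

Definition sub_closed (T : theory) :=
  forall G D (f : sub G D) (A : fm G), T G A -> T D (fsub f A).

(** The Henkin construction reads every axiom over its own growing contexts. Only induction and
    choice need work: there the substitution is moved past [at_succ] and [at_choice]. *)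
Lemma RCA0w_sub : sub_closed RCA0w.
Proof.
move=> G D f A H; case: H f => {G A} /=; try by constructor.
- by move=> *; rewrite fsub_eqt; constructor.
- by move=> *; rewrite fsub_eqt; constructor.
- by move=> *; rewrite !fsub_eqt; constructor.
- move=> G A qA f; rewrite fsub_inst /=.
  have -> : fsub (up f) (at_succ A) = at_succ (fsub (up f) A).
    rewrite /at_succ !fsub_comp; congr fsub; apply: subP => //= t v.
    by rewrite /sub_then /= wk_tsub.
  by apply: ax_ind; rewrite qf_fsub.
- move=> G A qA f.
  have -> : fsub (up (up f)) (at_choice A) = at_choice (fsub (up (up f)) A).
    rewrite /at_choice !fsub_comp; congr fsub; apply: subP => //=.
    apply: varP => //= t v.
    by rewrite /sub_then /= !wk_tsub /= /wk /tren !tsub_comp.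
  by apply: ax_qfac; rewrite qf_fsub.
Qed.

(** * Structures *)

(** No laws are imposed and [=] and [<] are left uninterpreted: the same record serves for term
    models, for the ground model, and for forcing names, which satisfy the axioms only in the forced
    sense. *)
Record structure := Structure {
  car :> ty -> Type;
  app : forall s t, car (s ⟶ t) -> car s -> car t;
  czero : car tN;
  cone : car tN;
  cplus : car (tN ⟶ tN ⟶ tN);
  ctimes : car (tN ⟶ tN ⟶ tN);
  cpi : forall s t, car (s ⟶ t ⟶ s);
  csigma : forall r s t, car ((r ⟶ s ⟶ t) ⟶ (r ⟶ s) ⟶ r ⟶ t);
  crec : forall s, car ((tN ⟶ s ⟶ s) ⟶ s ⟶ tN ⟶ s) }.
Arguments app {s0 s t} _ _ : rename.

Definition env (M : structure) (G : ctx) := forall t, var G t -> M t.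
Definition enil (M : structure) : env M [::] := fun t v => False_rect _ (var_nil v).
Arguments enil {M}.
Definition econs (M : structure) s G (d : M s) (r : env M G) : env M (s :: G) :=
  vcase (P := M) d r.

Fixpoint eval (M : structure) G (r : env M G) t (x : tm G t) : M t :=
  match x with
  | Var _ v => r _ v
  | App _ _ x y => app (eval r x) (eval r y)
  | Zero => czero M
  | One => cone M
  | Plus => cplus M
  | Times => ctimes M
  | Pi s t => cpi M s t
  | Sigma a s t => csigma M a s t
  | Rec s => crec M s
  end.

Lemma eval_tsub (M : structure) G D (f : sub G D) (r : env M D) t (x : tm G t) :
  eval r (tsub f x) = eval (fun t v => eval r (f t v)) x.
Proof. by elim: x => //= ? ? ? -> ? ->. Qed.

Lemma eval_wk (M : structure) s G (d : M s) (r : env M G) t (x : tm G t) :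
  eval (econs d r) (wk x) = eval r x.
Proof. by rewrite /wk /tren eval_tsub. Qed.

Lemma eval_up (M : structure) s G D (f : sub G D) (d : M s) (r : env M D) :
  (fun t v => eval (econs d r) (up f v)) = econs d (fun t v => eval r (f t v)).
Proof. by apply: subP => //= t v; rewrite /up /= eval_wk. Qed.

Lemma eval_scons (M : structure) s G D (x : tm D s) (f : sub G D) (r : env M D) :
  (fun t v => eval r (scons x f v)) = econs (eval r x) (fun t v => eval r (f t v)).
Proof. exact: subP. Qed.

Section Sat.
Variables (M : structure) (meq mlt : M tN -> M tN -> Prop).

Fixpoint sat G (r : env M G) (A : fm G) : Prop :=
  match A return env M _ -> Prop with
  | Eq0 x y => fun r => meq (eval r x) (eval r y)
  | Lt0 x y => fun r => mlt (eval r x) (eval r y)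
  | Bot => fun r => False
  | And A B => fun r => sat r A /\ sat r B
  | Or A B => fun r => sat r A \/ sat r B
  | Imp A B => fun r => sat r A -> sat r B
  | All t A => fun r => forall d : M t, sat (econs d r) A
  | Ex t A => fun r => exists d : M t, sat (econs d r) A
  end r.

Lemma sat_fsub G (A : fm G) D (f : sub G D) (r : env M D) :
  sat r (fsub f A) = sat (fun t v => eval r (f t v)) A.
Proof.
elim: A D f r => {G} //=.
- by move=> *; rewrite !eval_tsub.
- by move=> *; rewrite !eval_tsub.
- by move=> G A IHA B IHB *; rewrite IHA IHB.
- by move=> G A IHA B IHB *; rewrite IHA IHB.
- by move=> G A IHA B IHB *; rewrite IHA IHB.
- move=> G t A IH D f r; apply: propext.
  by split=> h d; move: (h d); rewrite IH eval_up.
- move=> G t A IH D f r; apply: propext.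
  by split=> -[d h]; exists d; move: h; rewrite IH eval_up.
Qed.

Lemma sat_inst s G (A : fm (s :: G)) x (r : env M G) :
  sat r (inst A x) = sat (econs (eval r x) r) A.
Proof. by rewrite /inst sat_fsub eval_scons. Qed.

Fixpoint ext_eq t : M t -> M t -> Prop :=
  match t return M t -> M t -> Prop with
  | tN => meq
  | Arr s t => fun f g => forall z, ext_eq (app f z) (app g z)
  end.

Lemma sat_eqt t G (r : env M G) (x y : tm G t) :
  sat r (eqt x y) <-> ext_eq (eval r x) (eval r y).
Proof.
elim: t G r x y => //= s _ t IH G r x y.
by split=> h d; move: (h d); rewrite IH /= !eval_wk.
Qed.

Definition is_model (T : theory) := forall G (A : fm G) (r : env M G), T G A -> sat r A.
End Sat.

(** * Quotient of a structure by extensional equality *)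

Section Classes.
Variables (X : Type) (E : X -> X -> Prop).
Hypothesis E_refl : forall x, E x x.
Hypothesis E_sym : forall x y, E x y -> E y x.
Hypothesis E_trans : forall x y z, E x y -> E y z -> E x z.

Definition classes : Type := {C : X -> Prop | exists x, C = E x}.
Definition cls (x : X) : classes := exist _ (E x) (ex_intro _ x erefl).
Definition rep (c : classes) : X :=
  proj1_sig (cid (proj2_sig c)).

Lemma cls_eq x y : cls x = cls y <-> E x y.
Proof.
split=> [[->]|h]; first exact: E_refl.
have e : E x = E y.
  apply: funext => z; apply: propext; split => h'.
    exact: E_trans (E_sym h) h'.
  exact: E_trans h h'.
rewrite /cls; move: (ex_intro _ y _) => p; move: p; rewrite -e => p.
by congr exist; apply: proof_irrelevance.
Qed.

Lemma repK c : cls (rep c) = c.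
Proof.
rewrite /cls /rep; case: cid => x /= e.
case: c e => C h /= e; move: h; rewrite e => h.
by congr exist; apply: proof_irrelevance.
Qed.

End Classes.

Section Quotient.
Variables (M : structure) (meq mlt : M tN -> M tN -> Prop).
Hypothesis meq_refl : forall x, meq x x.
Hypothesis meq_sym : forall x y, meq x y -> meq y x.
Hypothesis meq_trans : forall x y z, meq x y -> meq y z -> meq x z.
Hypothesis mlt_congr : forall x x' y y', meq x x' -> meq y y' -> mlt x y -> mlt x' y'.
Local Notation E := (ext_eq meq).
(** Congruence in the function is built into [ext_eq]; congruence in the argument is what the
    extensionality axioms of a theory provide. *)
Hypothesis app_congr : forall s t (f : M (s ⟶ t)) x y, E x y -> E (app f x) (app f y).

Lemma ext_refl t (x : M t) : E x x.
Proof. by elim: t x => //= s _ t IH x z. Qed.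
Lemma ext_sym t (x y : M t) : E x y -> E y x.
Proof. by elim: t x y => //= s _ t IH x y h z; apply: IH. Qed.
Lemma ext_trans t (x y z : M t) : E x y -> E y z -> E x z.
Proof. by elim: t x y z => //= s _ t IH x y z h h' u; apply: IH (h u) (h' u). Qed.

Definition qcar t : Type := classes (@ext_eq M meq t).
Definition qpi t (x : M t) : qcar t := cls (@ext_eq M meq t) x.
Definition qrepr t (c : qcar t) : M t := rep c.

Lemma qpi_eq t (x y : M t) : qpi x = qpi y <-> E x y.
Proof. by apply: cls_eq; [exact: ext_refl|exact: ext_sym|exact: ext_trans]. Qed.

Lemma qreprK t (c : qcar t) : qpi (qrepr c) = c.
Proof. exact: repK. Qed.

Definition quot : structure := @Structure qcar
  (fun s t f x => qpi (app (qrepr f) (qrepr x)))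
  (qpi (czero M)) (qpi (cone M)) (qpi (cplus M)) (qpi (ctimes M))
  (fun s t => qpi (cpi M s t)) (fun r s t => qpi (csigma M r s t))
  (fun s => qpi (crec M s)).
Definition qlt (x y : quot tN) := mlt (qrepr x) (qrepr y).

Lemma qrepr_pi t (x : M t) : E (qrepr (qpi x)) x.
Proof. by apply/qpi_eq; rewrite qreprK. Qed.

Lemma qapp s t (f : M (s ⟶ t)) (x : M s) :
  @app quot _ _ (qpi f) (qpi x) = qpi (app f x).
Proof.
apply/qpi_eq; apply: ext_trans (app_congr _ (qrepr_pi x)).
exact: (qrepr_pi f).
Qed.

Lemma qext s t (f g : quot (s ⟶ t)) : (forall z, app f z = app g z) -> f = g.
Proof.
move=> h; rewrite -(qreprK f) -(qreprK g); apply/qpi_eq => z.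
by apply/qpi_eq; rewrite -!qapp !qreprK.
Qed.

Definition qenv G (r : env M G) : env quot G := fun t v => qpi (r t v).

Lemma qeval G (r : env M G) t (x : tm G t) : eval (qenv r) x = qpi (eval r x).
Proof. by elim: x => // s u x IHx y IHy; rewrite [RHS]/= -qapp -IHx -IHy. Qed.

Lemma qenv_cons G (r : env M G) s (d : M s) : econs (M := quot) (qpi d) (qenv r) = qenv (econs d r).
Proof. exact: subP. Qed.

Lemma qsat G (A : fm G) (r : env M G) : sat eq qlt (qenv r) A <-> sat meq mlt r A.
Proof.
elim: A r => {G} //=.
- by move=> G x y r; rewrite !qeval qpi_eq.
- move=> G x y r; rewrite !qeval /qlt.
  have h z : meq (qrepr (qpi z)) z := @qrepr_pi tN z.
  by split; apply: mlt_congr => //; apply: meq_sym.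
- by move=> G A IHA B IHB r; rewrite IHA IHB.
- by move=> G A IHA B IHB r; rewrite IHA IHB.
- by move=> G A IHA B IHB r; rewrite IHA IHB.
- move=> G t A IH r; split=> h d; first by rewrite -IH -qenv_cons.
  by rewrite -(qreprK d) qenv_cons IH.
- move=> G t A IH r; split=> -[d h]; last by exists (qpi d); rewrite qenv_cons IH.
  by exists (qrepr d); rewrite -IH -qenv_cons qreprK.
Qed.

Lemma quot_model T : is_model meq mlt T -> is_model (M := quot) eq qlt T.
Proof.
move=> h G A r /h hA.
have -> : r = qenv (fun t v => qrepr (r t v)).
  by apply: funext => t; apply: funext => v; rewrite /qenv qreprK.
by rewrite qsat.
Qed.
End Quotient.

(** * Completeness *)

Local Notation tree := (GenTree.tree nat).
Local Notation Node := GenTree.Node.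

Fixpoint ty_code (t : ty) : tree :=
  match t with
  | tN => Node 0 [::]
  | Arr s t => Node 1 [:: ty_code s; ty_code t]
  end.

Fixpoint var_code G t (v : var G t) : nat :=
  match v with Vz _ _ => 0 | Vs _ _ _ v => (var_code v).+1 end.

Fixpoint tm_code G t (x : tm G t) : tree :=
  match x with
  | Var _ v => Node 0 [:: GenTree.Leaf (var_code v)]
  | App _ _ x y => Node 1 [:: tm_code x; tm_code y]
  | Zero => Node 2 [::]
  | One => Node 3 [::]
  | Plus => Node 4 [::]
  | Times => Node 5 [::]
  | Pi s t => Node 6 [:: ty_code s; ty_code t]
  | Sigma r s t => Node 7 [:: ty_code r; ty_code s; ty_code t]
  | Rec s => Node 8 [:: ty_code s]
  end.

Fixpoint fm_code G (A : fm G) : tree :=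
  match A with
  | Eq0 x y => Node 0 [:: tm_code x; tm_code y]
  | Lt0 x y => Node 1 [:: tm_code x; tm_code y]
  | Bot => Node 2 [::]
  | And A B => Node 3 [:: fm_code A; fm_code B]
  | Or A B => Node 4 [:: fm_code A; fm_code B]
  | Imp A B => Node 5 [:: fm_code A; fm_code B]
  | All t A => Node 6 [:: ty_code t; fm_code A]
  | Ex t A => Node 7 [:: ty_code t; fm_code A]
  end.

Lemma ty_code_inj : injective ty_code.
Proof. by elim=> [|s IHs t IHt] [|s' t'] //= [/IHs -> /IHt ->]. Qed.

(** A position in the context determines the type found there, so codes may forget types; each
    variable is paired with its type to make the conclusion well typed. *)
Lemma var_code_inj G t (v : var G t) t' (w : var G t') :
  var_code v = var_code w -> existT (var G) t v = existT (var G) t' w.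
Proof.
elim: v t' w => {G t} [t G|s t G v IH] t' w.
  move: t' w; exact: varP.
move: t' w; apply: (varP (P := fun t' w => var_code (Vs v) = var_code w ->
  existT (var (s :: G)) t (Vs v) = existT (var (s :: G)) t' w)) => //= t' w [] /IH e.
exact: (f_equal (fun p : {t & var G t} => existT (var (s :: G)) (projT1 p) (Vs (projT2 p))) e).
Qed.

Lemma tm_code_inj' G t (x : tm G t) t' (y : tm G t') :
  tm_code x = tm_code y -> existT (tm G) t x = existT (tm G) t' y.
Proof.
elim: x t' y => {t} [t v|s t f IHf x IHx| | | | |s t|r s t|s] t'.
- case=> //= t'' w [] /var_code_inj e.
  exact: (f_equal (fun p : {t & var G t} => existT (tm G) (projT1 p) (Var (projT2 p))) e).
- case=> //= s' t'' f' x' [] /IHf e /IHx e'.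
  case: (projT1_eq e) => es et; subst.
  by rewrite (inj_pair2 _ _ _ _ _ e) (inj_pair2 _ _ _ _ _ e').
- by case.
- by case.
- by case.
- by case.
- by case=> //= ? ? [] /ty_code_inj -> /ty_code_inj ->.
- by case=> //= ? ? ? [] /ty_code_inj -> /ty_code_inj -> /ty_code_inj ->.
- by case=> //= ? [] /ty_code_inj ->.
Qed.

Lemma tm_code_inj G t : injective (@tm_code G t).
Proof. by move=> x y /tm_code_inj'; apply: inj_pair2. Qed.

Lemma fm_code_inj G : injective (@fm_code G).
Proof.
move=> A; elim: A => {G} [G x y|G x y|G|G A IHA B IHB|G A IHA B IHB|G A IHA B IHB|G t A IH|G t A IH] [] //=.
- by move=> ? ? [] /tm_code_inj -> /tm_code_inj ->.
- by move=> ? ? [] /tm_code_inj -> /tm_code_inj ->.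
- by move=> ? ? [] /IHA -> /IHB ->.
- by move=> ? ? [] /IHA -> /IHB ->.
- by move=> ? ? [] /IHA -> /IHB ->.
- by move=> t' B [] /ty_code_inj e; subst => /IH ->.
- by move=> t' B [] /ty_code_inj e; subst => /IH ->.
Qed.

Lemma fm_enum G : {e : nat -> fm G | forall A, exists n, e n = A}.
Proof.
apply: cid.
have h n : exists B : fm G, forall A, pickle (fm_code A) = n -> B = A.
  case: (classic (exists A : fm G, pickle (fm_code A) = n)) => [[A e]|no].
    by exists A => B e'; apply: fm_code_inj; apply: (pcan_inj pickleK); rewrite e e'.
  by exists Bot => A e; case: no; exists A.
(* A number that codes no formula over [G] was sent to [Bot]. *)
exists (fun n => proj1_sig (cid (h n))) => A.
exists (pickle (fm_code A)); case: cid => B /=.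
exact.
Qed.

Lemma prf_In T G (H : seq (fm G)) A : List.In A H -> prf T H A.
Proof. by move/(@List.in_split _ _ _) => [H1 [H2 ->]]; apply: prf_hyp. Qed.

(** The pairing [n = 2^i (2j + 1)]. It satisfies [i <= n], so the [j]-th formula of stage [i] is
    never called before that stage exists. *)
Definition sched (n : nat) := (logn 2 n, (n %/ 2 ^ logn 2 n)./2).

Lemma schedP i j : exists2 n, i <= n & sched n = (i, j).
Proof.
exists (2 ^ i * j.*2.+1).
  apply: leq_trans (ltnW (ltn_expl i (isT : 1 < 2))) _.
  by rewrite leq_pmulr.
have e : logn 2 (2 ^ i * j.*2.+1) = i.
  rewrite lognM ?expn_gt0 // pfactorK // (@logn_coprime 2 j.*2.+1) ?addn0 //.
  by rewrite coprime2n /= odd_double.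
by rewrite /sched e mulKn ?expn_gt0 //= uphalf_double.
Qed.

(** Henkin construction; the contexts grow by one variable at every stage, so
    that the maximal theory lives over the limit of the contexts. *)
Section Henkin.
Variable T : theory.
Hypothesis T_sub : sub_closed T.
Variable A0 : fm [::].
Hypothesis A0_unprovable : ~ proves T A0.

Definition consistent G (H : seq (fm G)) := ~ prf T H Bot.

(** The new variable is a Henkin witness if [B] is existential and otherwise a dummy of type [tN],
    which keeps all stages uniform. *)
Definition addw G (H : seq (fm G)) (B : fm G) : {t & seq (fm (t :: G))} :=
  match B with
  | Ex t C => existT _ t (C :: map fwk (Ex t C :: H))
  | B => existT (fun t => seq (fm (t :: G))) tN (map fwk (B :: H))
  end.

Lemma addw_consistent G (H : seq (fm G)) B :
  consistent (B :: H) -> consistent (projT2 (addw H B)).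
Proof.
case: B => [x y|x y||A B|A B|A B|t A|t A] /= c p; apply: c;
  (* A contradiction over the dummy variable descends to the old context: generalise over it, then
     instantiate at [Zero]. *)
  try exact: (@prf_allE T G (_ :: H) tN Bot Zero (@prf_allI T G (_ :: H) tN Bot p)).
by apply: (@prf_exE T G (Ex t A :: H) t A Bot _ p); apply: prf_In; left.
Qed.

Lemma addw_in G (H : seq (fm G)) B A :
  List.In A (B :: H) -> List.In (fwk A) (projT2 (addw H B)).
Proof.
by move=> h; have := List.in_map fwk _ _ h; case: B {h} => [x y|x y||C B|C B|C B|t C|t C] //=; right.
Qed.

Lemma addw_wit G (H : seq (fm G)) B t C : B = Ex t C ->
  exists y : tm (projT1 (addw H B) :: G) t,
    List.In (fsub (scons y (fun t v => Var (Vs v))) C) (projT2 (addw H B)).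
Proof.
move=> -> /=; exists v0; left; rewrite -[LHS]fsub_id; congr fsub.
exact: subP.
Qed.

Definition next G (H : seq (fm G)) (B : fm G) :=
  if pselect (consistent (B :: H)) then addw H B
  else addw H (¬ B).

Lemma next_consistent G (H : seq (fm G)) B :
  consistent H -> consistent (projT2 (next H B)).
Proof.
rewrite /next => c; case: pselect => h; apply: addw_consistent => //.
move=> p; apply: c; apply: prf_impE (prf_impI p) _.
by apply: prf_impI; apply: NNPP.
Qed.

Lemma next_in G (H : seq (fm G)) B A :
  List.In A H -> List.In (fwk A) (projT2 (next H B)).
Proof.
by rewrite /next => h; case: pselect => ?; apply: addw_in; right.
Qed.

Lemma next_dec G (H : seq (fm G)) B :
  List.In (fwk B) (projT2 (next H B)) \/ List.In (fwk (¬ B)) (projT2 (next H B)).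
Proof.
rewrite /next; case: pselect => h; [left|right];
  by apply: addw_in; left.
Qed.

Lemma next_wit G (H : seq (fm G)) B t C : B = Ex t C -> consistent (B :: H) ->
  exists y : tm (projT1 (next H B) :: G) t,
    List.In (fsub (scons y (fun t v => Var (Vs v))) C) (projT2 (next H B)).
Proof.
move=> e c; rewrite /next; case: pselect => [h|/(_ c) //].
exact: addw_wit.
Qed.

(** [tk i j] is the [j]-th formula over the context of stage [i], weakened to
    the present stage. *)
Record stage := Stage { cx : ctx; hy : seq (fm cx); tk : nat -> nat -> fm cx }.

Definition enum_fm G := proj1_sig (fm_enum G).

Definition task n (s : stage) : fm (cx s) := tk s (sched n).1 (sched n).2.

Definition step n (s : stage) : stage :=
  Stage (projT2 (next (hy s) (task n s)))
    (fun i j => if i == n.+1 then enum_fm (projT1 (next (hy s) (task n s)) :: cx s) j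
                else fwk (tk s i j)).

Fixpoint S (n : nat) : stage :=
  match n with
  | 0 => Stage [:: ¬ A0] (fun _ => @enum_fm [::])
  | n.+1 => step n (S n)
  end.

Lemma S_consistent n : consistent (hy (S n)).
Proof.
elim: n => [p|n IH]; last exact: next_consistent.
by apply: A0_unprovable; apply: prf_raa.
Qed.

Lemma S_in n A : List.In A (hy (S n)) -> List.In (fwk A) (hy (S n.+1)).
Proof. exact: next_in. Qed.

(** A formula over the limit of the contexts, given by its versions at all stages; only the tail,
    where each version is the weakening of the one before, is significant. *)
Definition limf := forall n, fm (cx (S n)).
Definition stablef N (B : limf) := forall n, N <= n -> B n.+1 = fwk (B n).

Lemma task_hit N (B : limf) : stablef N B -> exists2 n, N <= n & task n (S n) = B n.
Proof.
move=> sB; have [j ej] := proj2_sig (fm_enum (cx (S N))) (B N).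
have h n : N <= n -> tk (S n) N j = B n.
  move/subnK <-; elim: (n - N) => [|k IH].
    by rewrite -ej; case: (N) => [|m] //=; rewrite eqxx.
  rewrite [tk _ _ _]/= ltn_eqF ?ltnS ?leq_addl // IH sB //.
  by rewrite leq_addl.
have [n le e] := schedP N j.
by exists n => //; rewrite /task e h.
Qed.

Definition Th (B : limf) := exists N, forall n, N <= n -> List.In (B n) (hy (S n)).
Definition Thp (B : limf) := exists N, forall n, N <= n -> prf T (hy (S n)) (B n).

Lemma Th_in N (B : limf) n : stablef N B -> N <= n ->
  List.In (B n) (hy (S n)) -> Th B.
Proof.
move=> sB le h; exists n => m /subnK <-; elim: (m - n) => //= k IH.
rewrite sB ?(leq_trans le) ?leq_addl //; exact: S_in.
Qed.

Lemma Th_dec N (B : limf) : stablef N B -> Th B \/ Th (fun n => ¬ B n).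
Proof.
move=> sB; have [n le e] := task_hit sB.
have sB' : stablef N (fun n => ¬ B n) by move=> m /sB ->.
have h : List.In (fwk (B n)) (hy (S n.+1)) \/ List.In (fwk (¬ B n)) (hy (S n.+1)).
  by rewrite -e; apply: next_dec.
have le' : N <= n.+1 by apply: leq_trans le _.
rewrite -[fwk (¬ _)]/(¬ (fwk (B n))) -sB // in h.
by case: h => h; [left; apply: (Th_in sB le')|right; apply: (Th_in sB' le')].
Qed.

(** Deductive closure follows from completeness of the limit theory: if the negation had been added
    instead, some later stage would be inconsistent. *)
Lemma Th_prf N (B : limf) : stablef N B -> Thp B <-> Th B.
Proof.
move=> sB; split=> [[M hM]|[M hM]]; last by exists M => n /hM; apply: prf_In.
case: (Th_dec sB) => // -[M' hM']; case: (@S_consistent (maxn M M')).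
apply: prf_impE (hM _ (leq_maxl _ _)); apply: prf_In; apply: hM'.
exact: leq_maxr.
Qed.

Lemma Th_bot (B : limf) : (forall n, B n = Bot) -> ~ Th B.
Proof.
move=> e [M /(_ M (leqnn M)) h]; apply: (@S_consistent M); rewrite -(e M).
exact: prf_In.
Qed.

Definition limt t := forall n, tm (cx (S n)) t.
Definition stable N t (x : limt t) := forall n, N <= n -> x n.+1 = wk (x n).

Definition raw t := {x : limt t | exists N, stable N x}.
Definition at_ t (x : raw t) n := proj1_sig x n.

(** Fills the stages before a term comes into existence. The choice is immaterial, as only tails
    matter. *)
Fixpoint default G t : tm G t :=
  match t with tN => Zero | Arr s t => Pi · default G t end.

Definition place N n t (x : tm (cx (S N)) t) (y : tm (cx (S n)) t) : tm (cx (S n)) t :=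
  match eq_comparable N n with
  | left e => eq_rect N (fun n => tm (cx (S n)) t) x n e
  | right _ => y
  end.

Lemma place_id N t (x y : tm (cx (S N)) t) : place x y = x.
Proof. by rewrite /place; case: (eq_comparable N N) => // e; rewrite (eq_axiomK e). Qed.

Fixpoint extend N t (x : tm (cx (S N)) t) n : tm (cx (S n)) t :=
  match n with
  | 0 => place x (default _ _)
  | n.+1 => place (n := n.+1) x (wk (extend x n))
  end.

Lemma extend0 N t (x : tm (cx (S N)) t) : extend x N = x.
Proof. case: N x => [|N] x; exact: place_id. Qed.

Lemma extend_stable N t (x : tm (cx (S N)) t) : stable N (extend x).
Proof.
move=> n le; rewrite [LHS]/= /place; case: (eq_comparable N n.+1) => // e.
by exfalso; move: le; rewrite e ltnn.
Qed.

Definition raw_at N t (x : tm (cx (S N)) t) : raw t :=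
  exist _ (extend x) (ex_intro _ N (extend_stable x)).

Lemma raw_app_stable s t (f : raw (s ⟶ t)) (x : raw s) :
  exists N, stable N (fun n => at_ f n · at_ x n).
Proof.
case: f x => f [N hN] [x [M hM]]; exists (maxn N M) => n.
by rewrite geq_max /at_ /= => /andP[/hN -> /hM ->].
Qed.

Definition raw_const t (x : forall n, tm (cx (S n)) t)
  (h : forall n, x n.+1 = wk (x n)) : raw t :=
  exist _ x (ex_intro _ 0 (fun n _ => h n)).

Definition rawS : structure := @Structure raw
  (fun s t f x => exist _ (fun n => at_ f n · at_ x n) (raw_app_stable f x))
  (@raw_const _ (fun n => Zero) (fun _ => erefl))
  (@raw_const _ (fun n => One) (fun _ => erefl))
  (@raw_const _ (fun n => Plus) (fun _ => erefl))
  (@raw_const _ (fun n => Times) (fun _ => erefl))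
  (fun s t => @raw_const _ (fun n => Pi) (fun _ => erefl))
  (fun r s t => @raw_const _ (fun n => Sigma) (fun _ => erefl))
  (fun s => @raw_const _ (fun n => Rec) (fun _ => erefl)).

Definition senv D (r : env rawS D) n : sub D (cx (S n)) := fun t v => at_ (r t v) n.

Lemma senv_stable D (r : env rawS D) :
  exists N, forall n, N <= n -> senv r n.+1 = fun t v => wk (senv r n v).
Proof.
elim: D r => [|s D IH] r.
  by exists 0 => n _; apply: funext => t; apply: funext => v; case: (var_nil v).
have [N hN] := IH (fun t v => r t (Vs v)).
have [M hM] := proj2_sig (r s Vz).
exists (maxn N M) => n; rewrite geq_max => /andP[/hN {}hN /hM {}hM].
apply: subP; first exact: hM.
by move=> t v; exact: (f_equal (fun f : sub D _ => f t v) hN).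
Qed.

Definition limfm D (r : env rawS D) (A : fm D) : limf := fun n => fsub (senv r n) A.

Lemma limfm_stable D (r : env rawS D) (A : fm D) : exists N, stablef N (limfm r A).
Proof.
have [N hN] := senv_stable r; exists N => n /hN e.
by rewrite /limfm e /fwk /fren fsub_comp.
Qed.

Lemma eval_at D (r : env rawS D) t (x : tm D t) n :
  at_ (eval r x) n = tsub (senv r n) x.
Proof. by elim: x => //= s u x IHx y IHy; rewrite -IHx -IHy. Qed.

Lemma senv_cons D (r : env rawS D) s (d : rawS s) n :
  senv (econs d r) n = scons (at_ d n) (senv r n).
Proof. exact: subP. Qed.

Lemma limfm_cons D (r : env rawS D) s (d : rawS s) (A : fm (s :: D)) n :
  limfm (econs d r) A n = inst (fsub (up (senv r n)) A) (at_ d n).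
Proof. by rewrite /limfm senv_cons inst_up. Qed.

Definition req (x y : rawS tN) := Th (fun n => at_ x n ≐ at_ y n).
Definition rlt (x y : rawS tN) := Th (fun n => at_ x n ≺ at_ y n).

Lemma Thfm_prf D (r : env rawS D) (A : fm D) : Thp (limfm r A) <-> Th (limfm r A).
Proof. have [N h] := limfm_stable r A; exact: Th_prf h. Qed.

Lemma Thfm_dec D (r : env rawS D) (A : fm D) :
  Th (limfm r A) \/ Th (limfm r (¬ A)).
Proof. have [N h] := limfm_stable r A; exact: (Th_dec h). Qed.

(** Finitely many premises share a stage from which all of them are provable, so a deduction that
    works at every stage passes to the limit theory. *)
Lemma Thfm_rule D (r : env rawS D) (As : seq (fm D)) (B : fm D) :
  (forall n (f := senv r n), (forall A, List.In A As -> prf T (hy (S n)) (fsub f A)) ->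
     prf T (hy (S n)) (fsub f B)) ->
  (forall A, List.In A As -> Th (limfm r A)) -> Th (limfm r B).
Proof.
move=> h hA; apply/Thfm_prf.
have [N hN] : exists N, forall n, N <= n -> forall A, List.In A As -> prf T (hy (S n)) (limfm r A n).
  elim: As {h} hA => [|A As IH] hA; first by exists 0.
  have [N hN] := IH (fun B hB => hA B (or_intror hB)).
  have [M hM] := (Thfm_prf _ _).2 (hA A (or_introl erefl)).
  exists (maxn N M) => n; rewrite geq_max => /andP[/hN {}hN /hM {}hM] C [<- //|].
  exact: hN.
by exists N => n /hN {}hN; apply: h.
Qed.

Lemma Thfm_absurd D (r : env rawS D) (A : fm D) :
  Th (limfm r A) -> Th (limfm r (¬ A)) -> False.
Proof.
move=> [N hN] [M hM]; apply: (@S_consistent (maxn N M)).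
apply: prf_impE (prf_In _ (hN _ (leq_maxl _ _))); apply: prf_In; apply: hM.
exact: leq_maxr.
Qed.

(** The formula is called as a task at a stage where it already belongs to the theory. It is then
    consistent with that stage, so its witness variable is added there. *)
Lemma Thfm_ex D (r : env rawS D) t (A : fm (t :: D)) :
  Th (limfm r (Ex t A)) -> exists d, Th (limfm (econs d r) A).
Proof.
move=> h; have [N0 s0] := limfm_stable r (Ex t A).
have [N1 s1] := senv_stable r.
have [M hM] := h.
pose N := maxn M (maxn N0 N1).
have sN : stablef N (limfm r (Ex t A)).
  by move=> n; rewrite !geq_max => /and3P[_ /s0].
have [n] := task_hit sN; rewrite !geq_max => /and3P[leM le0 le1] e.
have c : consistent (task n (S n) :: hy (S n)).
  rewrite e => p; apply: (@S_consistent n); apply: prf_impE (prf_impI p) _.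
  by apply: prf_In; apply: hM.
have [y hy'] := next_wit (e : _ = Ex t (fsub (up (senv r n)) A)) c.
pose d : rawS t := @raw_at n.+1 t y; exists d.
have [N2 s2] := limfm_stable (econs d r) A.
have eS : limfm (econs d r) A n.+1 =
          fsub (scons y (fun t v => Var (Vs v))) (fsub (up (senv r n)) A).
  rewrite /limfm senv_cons fsub_comp; congr fsub; apply: subP.
    exact: (@extend0 n.+1 t y).
  move=> u v; rewrite /sub_then /= wk_tsub /= s1 //.
apply: (@Th_in n.+1 _ n.+1) => //; last by rewrite eS.
move=> m lem; have := s1 m (leq_trans le1 (ltnW lem)) => em.
rewrite /limfm !senv_cons em /fwk /fren fsub_comp; congr fsub; apply: subP => //=.
exact: (@extend_stable n.+1 t y).
Qed.

Lemma truth D (A : fm D) (r : env rawS D) : sat req rlt r A <-> Th (limfm r A).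
Proof.
elim: A r => {D}.
- move=> D x y r /=; rewrite /req /limfm /=.
  have -> // : (fun n => at_ (eval r x) n ≐ at_ (eval r y) n) =
          (fun n => tsub (senv r n) x ≐ tsub (senv r n) y).
  by apply: funext => n; rewrite !eval_at.
- move=> D x y r /=; rewrite /rlt /limfm /=.
  have -> // : (fun n => at_ (eval r x) n ≺ at_ (eval r y) n) =
          (fun n => tsub (senv r n) x ≺ tsub (senv r n) y).
  by apply: funext => n; rewrite !eval_at.
- by move=> D r; split=> //= /Th_bot; apply.
- move=> D A IHA B IHB r /=; rewrite IHA IHB; split=> [[hA hB]|h].
    apply: (Thfm_rule (As := [:: A; B])).
      by move=> n f h; apply: prf_andI; apply: h; [left|right; left].
    by move=> C [<-|[<-|//]].
  split; apply: (Thfm_rule (As := [:: A ⊓ B])).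
  + by move=> n f /(_ _ (or_introl erefl)) /prf_andEl.
  + by move=> C [<-|//].
  + by move=> n f /(_ _ (or_introl erefl)) /prf_andEr.
  + by move=> C [<-|//].
- move=> D A IHA B IHB r /=; rewrite IHA IHB; split=> [[h|h]|h].
  + apply: (Thfm_rule (As := [:: A])); last by move=> C [<-|//].
    by move=> n f h'; apply: prf_orIl; apply: (h' A); left.
  + apply: (Thfm_rule (As := [:: B])); last by move=> C [<-|//].
    by move=> n f h'; apply: prf_orIr; apply: (h' B); left.
  + case: (Thfm_dec r A) => hA; first by left.
    case: (Thfm_dec r B) => hB; first by right.
    have [] := @Th_bot (limfm r Bot) => //.
    have [N hN] := h; have [N' hN'] := hA; have [N'' hN''] := hB.
    exists (maxn N (maxn N' N'')) => n; rewrite !geq_max => /and3P[/hN {}hN /hN' {}hN' /hN'' {}hN''].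
    case: (@S_consistent n); apply: prf_orE (prf_In _ hN) _ _.
      by apply: (prf_impE (A := fsub (senv r n) A)); apply: prf_In; [right|left].
    by apply: (prf_impE (A := fsub (senv r n) B)); apply: prf_In; [right|left].
- move=> D A IHA B IHB r /=; rewrite IHA IHB; split=> h; last first.
    move=> hA; apply: (Thfm_rule (As := [:: A ⊃ B; A])); last by move=> C [<-|[<-|]].
    move=> n f h'; apply: (prf_impE (A := fsub f A)).
      by apply: (h' (A ⊃ B)); left.
    by apply: (h' A); right; left.
  apply/Thfm_prf; case: (Thfm_dec r B) => [[N hN]|hB].
    by exists N => n /hN {}h; apply: prf_impI; apply: prf_In; right.
  case: (Thfm_dec r A) => [/h hA|[N hN]]; first by case: (Thfm_absurd hA hB).
  exists N => n /hN {}h; apply: prf_impI; apply: prf_raa.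
  apply: (prf_impE (A := fsub (senv r n) A)); apply: prf_In; last by right; left.
  by right; right.
- move=> D t A IH r /=; split=> [h|h d]; last first.
    apply/IH/Thfm_prf; have [N hN] := (Thfm_prf _ _).2 h.
    by exists N => n /hN p; rewrite limfm_cons; apply: prf_allE p.
  case: (Thfm_dec r (Ex t (¬ A))) => [/Thfm_ex[d hd]|[M hM]].
    by case: (Thfm_absurd ((IH _).1 (h d)) hd).
  apply/Thfm_prf; exists M => n /hM {}hM; apply: (@prf_allI _ _ _ _ (fsub (up (senv r n)) A)); apply: prf_raa.
  have hM' : List.In (fwk (s := t) (¬ Ex t (fsub (up (senv r n)) (¬ A)))) (map fwk (hy (S n))).
    exact: (@List.in_map _ _ (@fwk t _) _ (limfm r (¬ Ex t (¬ A)) n) hM).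
  apply: (prf_impE (A := fwk (s := t) (Ex t (fsub (up (senv r n)) (¬ A))))); first by apply: prf_In; right.
  apply: (prf_exI (x := v0)).
  have -> : inst (fsub (up (fun t0 v => Var (@shift t (cx (S n)) t0 v))) (fsub (up (senv r n)) (¬ A))) v0
     = fsub (up (senv r n)) (¬ A).
    rewrite inst_up -[RHS]fsub_id; congr fsub; exact: subP.
  by apply: prf_In; left.
- move=> D t A IH r /=; split=> [[d /IH h]|/Thfm_ex[d h]]; last by exists d; apply/IH.
  apply/Thfm_prf; have [N hN] := (Thfm_prf _ _).2 h.
  by exists N => n /hN; rewrite limfm_cons; apply: prf_exI.
Qed.

Lemma raw_model : is_model req rlt T.
Proof.
move=> G A r hA; apply/truth/Thfm_prf; exists 0 => n _; apply: prf_ax; exact: T_sub.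
Qed.

Lemma raw_refutes : ~ sat req rlt enil A0.
Proof.
move/truth => h; apply: (Thfm_absurd h); exists 0 => n _.
elim: n => [|n IH] /=.
  left; congr (¬ _); rewrite -[LHS]fsub_id; congr fsub.
  by apply: funext => t; apply: funext => v; case: (var_nil v).
move: (S_in IH); congr List.In; rewrite /limfm /fwk /fren fsub_comp; congr fsub.
by apply: funext => t; apply: funext => v; case: (var_nil v).
Qed.

Lemma req_refl (x : rawS tN) : req x x.
Proof.
have := Thfm_rule (r := econs x enil) (As := [::]) (B := v0 ≐ v0); apply => //.
by move=> n f _; apply: prf_refl.
Qed.

Lemma req_subst (x y : rawS tN) D (r : env rawS D) (A : fm (tN :: D)) :
  req x y -> sat req rlt (econs x r) A -> sat req rlt (econs y r) A.
Proof.
move=> e /truth h; apply/truth.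
have := Thfm_rule (r := econs x (econs y r)) (As := [:: v0 ≐ v1;
  fsub (scons v0 (fun t v => Var (Vs (Vs v)))) A])
  (B := fsub (scons v1 (fun t v => Var (Vs (Vs v)))) A).
have eS z : limfm (econs x (econs y r))
    (fsub (scons (Var z) (fun t v => Var (Vs (Vs v)))) A) =
    limfm (econs (econs x (econs y r) z) r) A.
  apply: funext => n; rewrite /limfm fsub_comp; congr fsub; exact: subP.
rewrite [limfm _ (fsub (scons v1 _) A)](eS (Vs Vz)).
apply; last by move=> C [<-|[<-|//]]; [exact: e|rewrite (eS Vz)].
move=> n f hA; have p1 := hA _ (or_introl erefl).
have p2 := hA _ (or_intror (or_introl erefl)).
have eA u (z : var (tN :: tN :: D) u) (A' : fm (u :: D)) : fsub f (fsub (scons (Var z) (fun t v => Var (Vs (Vs v)))) A') =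
   inst (fsub (up (senv r n)) A') (f _ z).
  rewrite inst_up fsub_comp; congr fsub; exact: subP.
rewrite (eA _ (Vs Vz)); rewrite (eA _ Vz) in p2; exact: prf_subst p1 p2.
Qed.

Lemma req_sym (x y : rawS tN) : req x y -> req y x.
Proof.
by move=> e; have := req_subst (r := econs x enil) (A := v0 ≐ v1) e; apply; exact: req_refl.
Qed.

Lemma req_trans (x y z : rawS tN) : req x y -> req y z -> req x z.
Proof.
move=> e e'; have := req_subst (r := econs x enil) (A := v1 ≐ v0) e'.
by apply.
Qed.

Lemma rlt_congr (x x' y y' : rawS tN) : req x x' -> req y y' -> rlt x y -> rlt x' y'.
Proof.
move=> e e' h.
have := req_subst (r := econs x' enil) (A := v1 ≺ v0) e'; apply.
by have := req_subst (r := econs y enil) (A := v0 ≺ v1) e; apply.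
Qed.
End Henkin.

Definition extensional (M : structure) :=
  forall s t (f g : M (s ⟶ t)), (forall z, app f z = app g z) -> f = g.

(** Equality is primitive at type [tN] only. The extensionality axioms make hereditary equality a
    congruence of the Henkin model, and the quotient is an extensional structure in which equality
    is genuine. *)
Theorem completeness (T : theory) (A : fm [::]) : sub_closed T ->
  (forall G s t (f : tm G (s ⟶ t)) x y, T G (eqt x y ⊃ eqt (f · x) (f · y))) ->
  (forall (M : structure) (lt : M tN -> M tN -> Prop), extensional M ->
     is_model eq lt T -> sat eq lt enil A) ->
  proves T A.
Proof.
move=> Tsub Text h; apply: NNPP => np.
have rm := raw_model Tsub (A0 := A) np.
have cong s t (f : rawS T A (s ⟶ t)) x y :
    ext_eq (@req T A) x y -> ext_eq (@req T A) (app f x) (app f y).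
  move=> e.
  have := rm _ _ (econs f (econs x (econs y enil))) (Text [:: s ⟶ t; s; s] _ _ v0 v1 v2).
  by rewrite /= !sat_eqt; apply.
pose M := quot (@req T A).
have := h M (@qlt _ (@req T A) (@rlt T A)).
have rl := req_refl np; have rs := req_sym np; have rt := req_trans np.
have rc := rlt_congr np.
move=> /(_ (fun s t => @qext _ _ rl rs rt cong s t)).
move=> /(_ (quot_model rl rs rt rc cong rm)).
have -> : (enil : env M [::]) = @qenv (rawS T A) (@req T A) [::] enil.
  by apply: funext => t; apply: funext => v; case: (var_nil v).
rewrite qsat //; exact: raw_refutes.
Qed.

(** * Forcing *)

Section Forcing.
Variable key : Type.

Definition world := key -> option nat.
Definition wle (p q : world) := forall k m, p k = Some m -> q k = Some m.

(** Dependence on the generic object enters at type [tN] alone, through the world. A name of higher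
    type is any functional on names, with no condition of totality or extensionality; [per] imposes
    both. *)
Fixpoint name (t : ty) : Type :=
  match t with tN => world -> nat | Arr s t => name s -> name t end.

(** [Rec] is only axiomatised at type [tN]. *)
Definition name_rec s : name ((tN ⟶ s ⟶ s) ⟶ s ⟶ tN ⟶ s) :=
  match s return name ((tN ⟶ s ⟶ s) ⟶ s ⟶ tN ⟶ s) with
  | tN => fun f m n q => nat_rect (fun _ => world -> nat) m (fun k a => f (fun _ => k) a) (n q) q
  | Arr _ _ => fun f m n => m
  end.

Definition names : structure := @Structure name (fun s t f x => f x)
  (fun _ => 0) (fun _ => 1) (fun x y q => x q + y q) (fun x y q => x q * y q)
  (fun s t x y => x) (fun r s t x y z => x z (y z)) name_rec.

Lemma wle_refl p : wle p p. Proof. by []. Qed.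
Lemma wle_trans p q r : wle p q -> wle q r -> wle p r.
Proof. by move=> h h' k m /h/h'. Qed.

(** [part] is a finite or infinite piece of an injection into [nat]; [free] are
    the values still available. *)
Record cond := Cond {
  part : world;
  free : nat -> Prop;
  part_inj : forall k k' m, part k = Some m -> part k' = Some m -> k = k';
  free_inf : forall n, exists2 m, n <= m & free m;
  free_part : forall k m, part k = Some m -> ~ free m }.

Definition ext (d c : cond) :=
  [/\ wle (part c) (part d),
      forall k m, part d k = Some m -> part c k = Some m \/ free c m &
      forall m, free d m -> free c m].

Lemma cond_refl c : ext c c.
Proof. by split=> // k m ->; left. Qed.
Lemma cond_trans c d e : ext e d -> ext d c -> ext e c.
Proof.
move=> [h1 h2 h3] [g1 g2 g3]; split; first exact: wle_trans g1 h1.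
  by move=> k m /h2 [/g2 //|/g3]; right.
by move=> m /h3/g3.
Qed.
Lemma ext_wle d c : ext d c -> wle (part c) (part d). Proof. by case. Qed.

Definition dense (P : cond -> Prop) c := forall d, ext d c -> exists2 e, ext e d & P e.

Lemma dense_mono P c d : ext d c -> dense P c -> dense P d.
Proof. by move=> h hP e he; apply: hP (cond_trans he h). Qed.
Lemma dense_here P c : dense P c -> exists2 e, ext e c & P e.
Proof. by apply; apply: cond_refl. Qed.
Lemma dense_imp P Q c : (forall d, ext d c -> P d -> Q d) -> dense P c -> dense Q c.
Proof.
move=> h hP d hd; have [e he pe] := hP d hd; exists e => //; apply: h => //.
exact: cond_trans he hd.
Qed.
Lemma dense_dense P c : dense (dense P) c -> dense P c.
Proof.
move=> h d hd; have [e he /dense_here[f hf pf]] := h d hd.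
by exists f => //; apply: cond_trans hf he.
Qed.
Lemma dense_all (P : cond -> Prop) c : (forall d, ext d c -> P d) -> dense P c.
Proof. by move=> h d hd; exists d; [apply: cond_refl|apply: h]. Qed.

Definition upward (P : cond -> Prop) := forall c d, ext d c -> P c -> P d.

Lemma dense_and P Q c : upward P -> dense P c -> dense Q c -> dense (fun d => P d /\ Q d) c.
Proof.
move=> uP hP hQ d hd; have [e he pe] := hP d hd.
have [f hf qf] := hQ e (cond_trans he hd); exists f; first exact: cond_trans hf he.
by split=> //; apply: uP pe.
Qed.

(** All worlds above [p] count, including those that are not injective or use values no longer free.
    Only positive information determines a value, so determination survives any change of the free
    values; the fusion argument rests on this. *)
Definition det (p : world) (x : name tN) n := forall q, wle p q -> x q = n.

Lemma det_mono p q x n : wle p q -> det p x n -> det q x n.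
Proof. by move=> h hx r hr; apply: hx; apply: wle_trans hr. Qed.
Lemma det_upward x n : upward (fun c => det (part c) x n).
Proof. by move=> c d /ext_wle; apply: det_mono. Qed.
Lemma det_uniq p x n m : det p x n -> det p x m -> n = m.
Proof. by move=> h h'; rewrite -(h p (@wle_refl p)) (h' p (@wle_refl p)). Qed.

Definition fcmp (R : nat -> nat -> Prop) c (x y : name tN) :=
  dense (fun e => exists n m, [/\ det (part e) x n, det (part e) y m & R n m]) c.

(** The partial equivalence relation of hereditarily total and extensional
    names; the quantifiers range over its domain. *)
Fixpoint per t (c : cond) : name t -> name t -> Prop :=
  match t return name t -> name t -> Prop with
  | tN => fcmp eq c
  | Arr s t => fun f g => forall d x y, ext d c -> per d x y -> per d (f x) (g y)
  end.
Arguments per {t} c _ _.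

Lemma per_mono t c d (x y : name t) : ext d c -> per c x y -> per d x y.
Proof.
case: t x y => [|s t] x y /=; first exact: dense_mono.
by move=> h hx e a b he; apply: hx; apply: cond_trans h.
Qed.

Lemma per_dense t c (x y : name t) : dense (fun d => per d x y) c -> per c x y.
Proof.
elim: t c x y => [|s _ t IH] c x y /=; first exact: dense_dense.
move=> h d a b hd hab; apply: IH; apply: dense_imp (dense_mono hd h) => e he hxy.
by apply: hxy; [apply: cond_refl|apply: per_mono hab].
Qed.

Lemma per_sym t c (x y : name t) : per c x y -> per c y x.
Proof.
elim: t c x y => [|s IHs t IHt] c x y /=.
  by apply: dense_imp => d _ [n [m [h1 h2 e]]]; exists m, n.
by move=> h d a b hd /IHs hab; apply: IHt; apply: h.
Qed.

Lemma per_trans t c (x y z : name t) : per c x y -> per c y z -> per c x z.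
Proof.
elim: t c x y z => [|s IHs t IHt] c x y z /=.
  move=> h h'; have u : upward (fun e => exists n m, [/\ det (part e) x n, det (part e) y m & n = m]).
    by move=> d e hd [n [m [h1 h2 h3]]]; exists n, m; split=> //; apply: det_upward hd _.
  apply: dense_imp (dense_and u h h') => d _ [[n [m [h1 h2 e]]] [n' [m' [h3 h4 e']]]].
  by exists n, m'; split=> //; rewrite e (det_uniq h2 h3).
move=> h h' d a b hd hab; apply: IHt (h _ _ _ hd hab) (h' _ _ _ hd _).
exact: IHs (per_sym hab) hab.
Qed.

Lemma per_refl t c (x y : name t) : per c x y -> per c x x.
Proof. by move=> h; apply: per_trans h (per_sym h). Qed.

Lemma per_det c (x : name tN) n : det (part c) x n -> per (t := tN) c x (fun _ => n).
Proof.
move=> h; apply: dense_all => d hd; exists n, n; split=> //; exact: det_upward hd h.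
Qed.

Lemma per_cone c (x y : name tN) : (forall q, wle (part c) q -> x q = y q) -> per (t := tN) c y y -> per (t := tN) c x y.
Proof.
move=> h; apply: dense_imp => d hd [n [_ [h1 _ _]]]; exists n, n; split=> // q hq.
by rewrite h ?h1 //; apply: wle_trans (ext_wle hd) hq.
Qed.

Lemma per_const c n : per (t := tN) c (fun _ => n) (fun _ => n).
Proof. exact: per_det. Qed.

Lemma total_det c (x y : name tN) : per (t := tN) c x y ->
  dense (fun e => exists n, det (part e) x n /\ det (part e) y n) c.
Proof. by apply: dense_imp => d _ [n [m [h1 h2 e]]]; exists n; rewrite {2}e. Qed.

Lemma per_op c (op : nat -> nat -> nat) (x x' y y' : name tN) : per (t := tN) c x x' -> per (t := tN) c y y' ->
  per (t := tN) c (fun q => op (x q) (y q)) (fun q => op (x' q) (y' q)).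
Proof.
move=> /total_det h /total_det h'.
have u : upward (fun e => exists n, det (part e) x n /\ det (part e) x' n).
  by move=> d e hd [n [h1 h2]]; exists n; split; apply: det_upward hd _.
apply: dense_imp (dense_and u h h') => d _ [[n [h1 h2]] [m [h3 h4]]].
by exists (op n m), (op n m); split=> // q hq; rewrite ?h1 ?h2 ?h3 ?h4.
Qed.

(** Only the number of iterations has to be determined; for a fixed number, induction in the
    metatheory relates the two iterations. At higher types the base value is returned. *)
Lemma per_rec s c : per c (crec names s) (crec names s).
Proof.
case: s => [|s t] d f g hd hf e m m' he hm e1 n n' he1 hn; last exact: (@per_mono (s ⟶ t)) he1 hm.
have {}hf := @per_mono (tN ⟶ tN ⟶ tN) _ _ _ _ (cond_trans he1 he) hf.
have {}hm := @per_mono tN _ _ _ _ he1 hm.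
apply: (@per_dense tN); apply: dense_imp (total_det hn) => e2 he2 [k [h1 h2]].
pose it (f : name (tN ⟶ tN ⟶ tN)) (m : name tN) k : name tN :=
  nat_rect (fun _ => world -> nat) m (fun k a => f (fun _ => k) a) k.
have hit : per (t := tN) e2 (it f m k) (it g m' k).
  elim: k {h1 h2} => [|k IH]; first exact: (@per_mono tN) he2 hm.
  by apply: hf; [exact: he2|exact: per_const|exact: cond_refl|exact: IH].
have a1 : per (t := tN) e2 (@name_rec tN f m n) (it f m k).
  by apply: per_cone (per_refl hit) => q hq; rewrite /= h1.
have a2 : per (t := tN) e2 (@name_rec tN g m' n') (it g m' k).
  by apply: per_cone (per_refl (per_sym hit)) => q hq; rewrite /= h2.
exact: per_trans a1 (per_trans hit (per_sym a2)).
Qed.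

Definition perenv G c (r r' : env names G) := forall t v, per c (r t v) (r' t v).

Lemma perenv_mono G c d (r r' : env names G) : ext d c -> perenv c r r' -> perenv d r r'.
Proof. by move=> h hr t v; apply: per_mono h (hr t v). Qed.

Lemma perenv_cons G c (r r' : env names G) s (x x' : names s) :
  per c x x' -> perenv c r r' -> perenv c (econs x r) (econs x' r').
Proof. by move=> hx hr; apply: varP. Qed.

(** The fundamental lemma of logical relations, for [per] at a fixed condition. *)
Lemma per_eval G c (r r' : env names G) t (x : tm G t) :
  perenv c r r' -> per c (eval r x) (eval r' x).
Proof.
elim: x => {t}.
- by move=> t v; apply.
- by move=> s t f IHf x IHx h; apply: (IHf h); [apply: cond_refl|apply: IHx].
- by move=> _; apply: per_const.
- by move=> _; apply: per_const.
- move=> _ d x y hd hx e x' y' he hx'; exact: (per_op addn (@per_mono tN _ _ _ _ he hx) hx').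
- move=> _ d x y hd hx e x' y' he hx'; exact: (per_op muln (@per_mono tN _ _ _ _ he hx) hx').
- by move=> s t _ d x y hd hx e x' y' he hx'; apply: (@per_mono s) he hx.
- move=> a s t _ d x y hd hx e x' y' he hx' f x'' y'' hf hx''.
  apply: hx; [exact: cond_trans hf he|exact: hx''|exact: cond_refl|].
  exact: hx'.
- by move=> s _; apply: per_rec.
Qed.

(** Density is built into atoms, disjunction and existence. This makes forcing a local property, see
    [frc_dense], and classical logic sound without a double negation translation. *)
Fixpoint frc G (c : cond) (r : env names G) (A : fm G) : Prop :=
  match A return env names _ -> Prop with
  | Eq0 x y => fun r => fcmp eq c (eval r x) (eval r y)
  | Lt0 x y => fun r => fcmp (fun n m => n < m) c (eval r x) (eval r y)
  | Bot => fun r => False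
  | And A B => fun r => frc c r A /\ frc c r B
  | Or A B => fun r => dense (fun e => frc e r A \/ frc e r B) c
  | Imp A B => fun r => forall d, ext d c -> frc d r A -> frc d r B
  | All t A => fun r => forall d (x : names t), ext d c -> per d x x -> frc d (econs x r) A
  | Ex t A => fun r => dense (fun e => exists2 x : names t, per e x x & frc e (econs x r) A) c
  end r.

Lemma frc_mono G c d (r : env names G) A : ext d c -> frc c r A -> frc d r A.
Proof.
elim: A c d r => {G} /=.
- by move=> *; apply: dense_mono; eauto.
- by move=> *; apply: dense_mono; eauto.
- by [].
- by move=> G A IHA B IHB c d r h [/IHA hA /IHB hB]; split; eauto.
- by move=> *; apply: dense_mono; eauto.
- by move=> G A IHA B IHB c d r h hAB e he; apply: hAB; apply: cond_trans h.
- by move=> G t A IH c d r h hA e x he; apply: hA; apply: cond_trans h.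
- by move=> *; apply: dense_mono; eauto.
Qed.

Lemma frc_dense G c (r : env names G) A : dense (fun d => frc d r A) c -> frc c r A.
Proof.
elim: A c r => {G} /=.
- by move=> *; apply: dense_dense.
- by move=> *; apply: dense_dense.
- by move=> G c r /dense_here[].
- move=> G A IHA B IHB c r h; split; [apply: IHA|apply: IHB]; apply: dense_imp h => d _ [] //.
- by move=> *; apply: dense_dense.
- move=> G A IHA B IHB c r h d hd hA; apply: IHB; apply: dense_imp (dense_mono hd h) => e he.
  by apply; [apply: cond_refl|apply: frc_mono hA].
- move=> G t A IH c r h d x hd hx; apply: IH; apply: dense_imp (dense_mono hd h) => e he.
  by apply; [apply: cond_refl|apply: per_mono hx].
- by move=> *; apply: dense_dense.
Qed.

(** If no extension forces the negation, then the conditions forcing [A] are dense, and locality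
    applies. *)
Lemma frc_raa G c (r : env names G) A : (forall d, ext d c -> frc d r (¬ A) -> False) -> frc c r A.
Proof.
move=> h; apply: frc_dense => d hd; apply: NNPP => nh; apply: (h d hd) => e he hA.
by apply: nh; exists e.
Qed.

Lemma fcmp_per (Q : nat -> nat -> Prop) c (x x' y y' : name tN) : per (t := tN) c x x' -> per (t := tN) c y y' ->
  fcmp Q c x y -> fcmp Q c x' y'.
Proof.
move=> /total_det hx /total_det hy h.
have u z z' : upward (fun e => exists n, det (part e) z n /\ det (part e) z' n).
  by move=> d e hd [n [h1 h2]]; exists n; split; apply: det_upward hd _.
have h' := dense_and (@u x x') hx (dense_and (@u y y') hy h).
apply: dense_imp h' => d _ [[n [h1 h2]] [[m [h3 h4]] [n' [m' [h5 h6]]]]].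
by rewrite (det_uniq h5 h1) (det_uniq h6 h3); exists n, m.
Qed.

(** Makes the substitution of equals sound, and later lets a name be replaced by the canonical name
    of a ground object. *)
Lemma frc_per G c (r r' : env names G) A : perenv c r r' -> frc c r A -> frc c r' A.
Proof.
elim: A c r r' => {G} /=.
- by move=> G x y c r r' h; apply: fcmp_per; apply: per_eval.
- by move=> G x y c r r' h; apply: fcmp_per; apply: per_eval.
- by [].
- by move=> G A IHA B IHB c r r' h [hA hB]; split; eauto.
- move=> G A IHA B IHB c r r' h; apply: dense_imp => d hd.
  by have hd' := perenv_mono hd h; move=> [?|?]; [left|right]; eauto.
- move=> G A IHA B IHB c r r' h hAB d hd hA; have h' := perenv_mono hd h.
  apply: (IHB _ _ _ h'); apply: hAB => //; apply: IHA hA => t v; exact: per_sym (h' t v).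
- move=> G t A IH c r r' h hA d x hd hx; apply: IH (hA d x hd hx).
  by apply: perenv_cons => //; apply: perenv_mono h.
- move=> G t A IH c r r' h; apply: dense_imp => d hd [x hx hA]; exists x => //.
  by apply: IH hA; apply: perenv_cons => //; apply: perenv_mono h.
Qed.

Lemma dense_ext P Q c : (forall d, P d = Q d) -> dense P c = dense Q c.
Proof. by move=> h; congr dense; apply: funext. Qed.

Lemma frc_fsub G (A : fm G) D (f : sub G D) c (r : env names D) :
  frc c r (fsub f A) = frc c (fun t v => eval r (f t v)) A.
Proof.
elim: A D f c r => {G} //=.
- by move=> *; rewrite !eval_tsub.
- by move=> *; rewrite !eval_tsub.
- by move=> G A IHA B IHB *; rewrite IHA IHB.
- by move=> G A IHA B IHB *; apply: dense_ext => d; rewrite IHA IHB.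
- move=> G A IHA B IHB D f c r; apply: propext.
  by split=> h d hd; move: (h d hd); rewrite IHA IHB.
- move=> G t A IH D f c r; apply: propext.
  by split=> h d x hd hx; move: (h d x hd hx); rewrite IH eval_up.
- move=> G t A IH D f c r; apply: dense_ext => d; apply: propext.
  by split=> -[x hx h]; exists x => //; move: h; rewrite IH eval_up.
Qed.

Lemma frc_fwk s G c (x : names s) (r : env names G) A : frc c (econs x r) (fwk A) = frc c r A.
Proof. by rewrite /fwk /fren frc_fsub. Qed.

Lemma frc_inst s G c (A : fm (s :: G)) x (r : env names G) :
  frc c r (inst A x) = frc c (econs (eval r x) r) A.
Proof. by rewrite /inst frc_fsub eval_scons. Qed.

Definition forces_theory (T : theory) := forall G (A : fm G) c (r : env names G),
  perenv c r r -> T G A -> frc c r A.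

Theorem frc_sound T G (H : seq (fm G)) A : forces_theory T -> prf T H A ->
  forall c (r : env names G), perenv c r r -> (forall B, List.In B H -> frc c r B) -> frc c r A.
Proof.
move=> hT; elim=> {G H A}.
- by move=> G H A hA c r hr _; apply: hT.
- by move=> G H1 H2 A c r _; apply; apply/List.in_app_iff; right; left.
- by move=> G H A B _ IHA _ IHB c r hr h; split; [apply: IHA|apply: IHB].
- by move=> G H A B _ IH c r hr h; case: (IH c r hr h).
- by move=> G H A B _ IH c r hr h; case: (IH c r hr h).
- by move=> G H A B _ IH c r hr h; apply: dense_all => d hd; left; apply: frc_mono hd _; apply: IH.
- by move=> G H A B _ IH c r hr h; apply: dense_all => d hd; right; apply: frc_mono hd _; apply: IH.
- move=> G H A B C _ IH _ IHA _ IHB c r hr h; apply: frc_dense.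
  apply: dense_imp (IH c r hr h) => d hd.
  by case=> h'; [apply: IHA|apply: IHB]; (try exact: perenv_mono hr) => E [<- //|/h /(frc_mono hd)].
- move=> G H A B _ IH c r hr h d hd hA; apply: IH; first exact: perenv_mono hr.
  by move=> E [<- //|/h /(frc_mono hd)].
- by move=> G H A B _ IHAB _ IHA c r hr h; apply: (IHAB c r hr h); [apply: cond_refl|apply: IHA].
- move=> G H A _ IH c r hr h; apply: frc_raa => d hd hA; apply: (IH d r); first exact: perenv_mono hr.
  by move=> E [<- //|/h /(frc_mono hd)].
- move=> G H t A _ IH c r hr h d x hd hx; apply: IH.
    by apply: perenv_cons => //; apply: perenv_mono hr.
  by move=> B /List.in_map_iff[E [<- /h hE]]; rewrite frc_fwk; apply: frc_mono hE.
- move=> G H t A x _ IH c r hr h; rewrite frc_inst; apply: (IH c r hr h); first exact: cond_refl.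
  exact: per_eval.
- move=> G H t A x _ IH c r hr h; apply: dense_all => d hd; exists (eval r x).
    exact: per_mono hd (per_eval _ hr).
  by apply: (frc_mono hd); rewrite -(frc_inst c A x r); apply: IH.
- move=> G H t A B _ IHE _ IHB c r hr h; apply: frc_dense.
  apply: dense_imp (IHE c r hr h) => d hd [x hx hA]; rewrite -(frc_fwk d x r).
  apply: IHB; first by apply: perenv_cons => //; apply: perenv_mono hr.
  move=> E [<- //|/List.in_map_iff[E' [<- /h hE]]]; rewrite frc_fwk; exact: frc_mono hE.
- by move=> G H x c r hr _; apply: (@per_eval _ c r r tN x).
- move=> G H A x y _ IHe _ IHA c r hr h; move: (IHA c r hr h); rewrite !frc_inst.
  by apply: frc_per; apply: perenv_cons => //; apply: IHe.
Qed.
End Forcing.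
Notation nconsN := (@econs (names _) tN _).
Notation ncons1 := (@econs (names _) t1 _).
Notation perN_mono := (@per_mono _ tN _ _ _ _).
Notation per1_mono := (@per_mono _ t1 _ _ _ _).
Notation perR2_mono := (@per_mono _ tR2 _ _ _ _).
Notation perN_sym := (@per_sym _ tN _ _ _).
Notation per1_sym := (@per_sym _ t1 _ _ _).
Notation per1_refl := (@per_refl _ t1 _ _ _).

(** * The axioms of [RCA0w] are forced *)

Section ForcingRCA.
Variable key : Type.
Local Notation world := (world key).
Local Notation name := (name key).
Local Notation names := (names key).
Local Notation cond := (cond key).
Implicit Types c d e : cond.

Lemma frc_eqt t G c (r : env names G) (x y : tm G t) : perenv c r r ->
  frc c r (eqt x y) <-> per (t := t) c (eval r x) (eval r y).
Proof.
elim: t G c r x y => //= s _ t IH G c r x y hr; split=> [h d a b hd hab|h d a hd ha].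
  have hda := @per_refl _ s _ _ _ hab.
  have hr' : perenv d (econs (M := names) a r) (econs (M := names) a r).
    by apply: perenv_cons => //; apply: perenv_mono hr.
  have := h d a hd hda; rewrite IH // => h'.
  rewrite /= !eval_wk in h'.
  apply: per_trans h' _; apply: (per_eval y hr) => //.
have hr' : perenv d (econs (M := names) a r) (econs (M := names) a r).
  by apply: perenv_cons => //; apply: perenv_mono hr.
by rewrite IH //= !eval_wk; apply: h.
Qed.

Fixpoint ev G (r : env names G) (A : fm G) (q : world) : Prop :=
  match A return env names _ -> Prop with
  | Eq0 x y => fun r => eval r x q = eval r y q
  | Lt0 x y => fun r => eval r x q < eval r y q
  | And A B => fun r => ev r A q /\ ev r B q
  | Or A B => fun r => ev r A q \/ ev r B q
  | Imp A B => fun r => ev r A q -> ev r B q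
  | _ => fun r => False
  end r.

(** Truth computed world by world is constant above [e] and agrees with forcing. For quantifier-free
    formulas such conditions are dense, which transfers the arithmetic axioms from the numbers and
    controls functionals defined world by world. *)
Definition settled G (r : env names G) (A : fm G) (e : cond) :=
  (forall q, wle (part e) q -> ev r A q) /\ frc e r A \/
  (forall q, wle (part e) q -> ~ ev r A q) /\ frc e r (¬ A).

Lemma settled_upward G (r : env names G) A : upward (settled r A).
Proof.
move=> d e hd [[h h']|[h h']]; [left|right]; split; try exact: frc_mono hd h';
  by move=> q hq; apply: h; apply: wle_trans (ext_wle hd) hq.
Qed.

Lemma not_fcmp (Q : nat -> nat -> Prop) c (x y : name tN) n m :
  det (part c) x n -> det (part c) y m -> ~ Q n m ->
  forall d, ext d c -> fcmp Q d x y -> False.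
Proof.
move=> hx hy nQ d hd /dense_here[e he [n' [m' [h1 h2 h3]]]]; apply: nQ.
have he' := cond_trans he hd.
by rewrite -(det_uniq h1 (det_upward he' hx)) -(det_uniq h2 (det_upward he' hy)).
Qed.

Lemma atom_settled (Q : nat -> nat -> Prop) c (x y : name tN) :
  per (t := tN) c x x -> per (t := tN) c y y ->
  dense (fun e => (forall q, wle (part e) q -> Q (x q) (y q)) /\ fcmp Q e x y \/
    (forall q, wle (part e) q -> ~ Q (x q) (y q)) /\
    forall d, ext d e -> fcmp Q d x y -> False) c.
Proof.
move=> /total_det hx /total_det hy.
have u z : upward (fun e : cond => exists n, det (part e) z n /\ det (part e) z n).
  by move=> d e hd [n [h1 h2]]; exists n; split; apply: det_upward hd _.
apply: dense_imp (dense_and (@u x) hx hy) => e _ [[n [h1 _]] [m [h2 _]]].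
case: (classic (Q n m)) => h; [left|right]; split.
- by move=> q hq; rewrite h1 // h2.
- apply: dense_all => d hd; exists n, m; split=> //; exact: det_upward hd _.
- by move=> q hq; rewrite h1 // h2.
- exact: not_fcmp h1 h2 h.
Qed.

Lemma qf_settled G (A : fm G) c (r : env names G) : qf A -> perenv c r r ->
  dense (settled r A) c.
Proof.
elim: A c r => {G} //=.
- move=> G x y c r _ hr; exact: (atom_settled eq (per_eval x hr) (per_eval y hr)).
- move=> G x y c r _ hr; exact: (atom_settled (fun n m => n < m) (per_eval x hr) (per_eval y hr)).
- by move=> G c r _ _; apply: dense_all => d _; right; split=> // e _ [].
- move=> G A IHA B IHB c r /andP[qA qB] hr.
  apply: dense_imp (dense_and (@settled_upward _ r A) (IHA c r qA hr) (IHB c r qB hr)) => d _.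
  move=> [[[a1 a2]|[a1 a2]] [[b1 b2]|[b1 b2]]]; [left|right|right|right]; split=> /=.
  + by move=> q hq; split; [apply: a1|apply: b1].
  + by [].
  + by move=> q hq [_ /(b1 q hq)].
  + by move=> e he [_ /(b2 e he)].
  + by move=> q hq [/(a1 q hq)].
  + by move=> e he [/(a2 e he)].
  + by move=> q hq [/(a1 q hq)].
  + by move=> e he [/(a2 e he)].
- move=> G A IHA B IHB c r /andP[qA qB] hr.
  apply: dense_imp (dense_and (@settled_upward _ r A) (IHA c r qA hr) (IHB c r qB hr)) => d _.
  move=> [[[a1 a2]|[a1 a2]] [[b1 b2]|[b1 b2]]]; [left|left|left|right]; split=> /=.
  + by move=> q hq; left; apply: a1.
  + by apply: dense_all => e he; left; apply: frc_mono he a2.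
  + by move=> q hq; left; apply: a1.
  + by apply: dense_all => e he; left; apply: frc_mono he a2.
  + by move=> q hq; right; apply: b1.
  + by apply: dense_all => e he; right; apply: frc_mono he b2.
  + by move=> q hq [/(a1 q hq)|/(b1 q hq)].
  + move=> e he /dense_here[f hf [h|h]].
      exact: a2 (cond_trans hf he) h.
    exact: b2 (cond_trans hf he) h.
- move=> G A IHA B IHB c r /andP[qA qB] hr.
  apply: dense_imp (dense_and (@settled_upward _ r A) (IHA c r qA hr) (IHB c r qB hr)) => d _.
  move=> [[[a1 a2]|[a1 a2]] [[b1 b2]|[b1 b2]]]; [left|right|left|left]; split=> /=.
  + by move=> q hq _; apply: b1.
  + by move=> e he _; apply: frc_mono he b2.
  + by move=> q hq h; apply: (b1 q hq); apply: h; apply: a1.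
  + by move=> e he h; apply: (b2 e he); apply: (h e (cond_refl e)); apply: frc_mono he a2.
  + by move=> q hq /(a1 q hq).
  + by move=> e he /(a2 e he).
  + by move=> q hq /(a1 q hq).
  + by move=> e he /(a2 e he).
Qed.

Lemma frc_qf G (A : fm G) c (r : env names G) : qf A -> perenv c r r ->
  (forall q, ev r A q) -> frc c r A.
Proof.
move=> qA hr h; apply: frc_dense; apply: dense_imp (qf_settled qA hr) => d _ [[]//|[h' _]].
by case: (h' (part d)).
Qed.

Definition least (P : nat -> Prop) n := P n /\ forall m, m < n -> ~ P m.

Lemma least_ex (P : nat -> Prop) : (exists n, P n) -> exists n, least P n.
Proof.
move=> [n]; elim/ltn_ind: n => n IH hn.
case: (classic (exists2 m, m < n & P m)) => [[m lt hm]|no]; first exact: IH hm.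
by exists n; split=> // m lt hm; apply: no; exists m.
Qed.

(** The choice functional of [QF-AC] returns the least witness at every world. *)
Definition choice_name G (r : env names G) (A : fm (tN :: t1 :: G)) : name t2 := fun x q =>
  if pselect (exists n, least
     (fun n => ev (nconsN (fun _ => n) (ncons1 x r)) A q) n)
  is left h then proj1_sig (cid h) else 0.

Lemma choice_nameE G (r : env names G) A x q n : least
  (fun n => ev (nconsN (fun _ => n) (ncons1 x r)) A q) n ->
  choice_name r A x q = n.
Proof.
move=> [h1 h2]; rewrite /choice_name; case: pselect => [h|[]]; last by exists n.
case: cid => m [h3 h4] /=.
by case: (ltngtP m n) => // lt; [case: (h2 _ lt)|case: (h4 _ lt)].
Qed.

Section Choice.
Variables (G : ctx) (A : fm (tN :: t1 :: G)) (r : env names G).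
Hypothesis qA : qf A.
Let at_ (n : nat) (x : name t1) : env names _ :=
  nconsN (fun _ => n) (ncons1 x r).

Lemma at_per c n (x y : name t1) : per (t := t1) c x y -> perenv c r r ->
  perenv c (at_ n x) (at_ n y).
Proof. by move=> hx hr; apply: perenv_cons; [apply: per_const|apply: perenv_cons]. Qed.

Lemma settled_below c (x : name t1) N : per (t := t1) c x x -> perenv c r r ->
  dense (fun e => forall n, n < N -> settled (at_ n x) A e) c.
Proof.
move=> hx hr; elim: N => [|N IH]; first exact: dense_all.
have u : upward (fun e => forall n, n < N -> settled (at_ n x) A e).
  by move=> d e hd h n /h; apply: settled_upward.
apply: dense_imp (dense_and u IH (qf_settled qA (at_per N hx hr))) => d _ [h1 h2] n.
by rewrite ltnS leq_eqVlt => /orP[/eqP ->|/h1].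
Qed.

Definition chosen (e : cond) (x : name t1) n :=
  frc e (at_ n x) A /\ forall m, m < n -> frc e (at_ m x) (¬ A).

Lemma chosen_det c (x : name t1) n : per (t := t1) c x x -> perenv c r r -> chosen c x n ->
  dense (fun e => det (part e) (choice_name r A x) n) c.
Proof.
move=> hx hr [h1 h2]; apply: dense_imp (settled_below n.+1 hx hr) => e he h q hq.
apply: choice_nameE; split.
  case: (h n (ltnSn n)) => [[h' _]|[_ h']]; first exact: h'.
  by case: (h' e (cond_refl e)); apply: frc_mono h1.
move=> m lt; case: (h m (ltnW lt)) => [[_ h']|[h' _]]; last exact: h'.
by case: (h2 m lt e he).
Qed.

Lemma chosen_per c (x y : name t1) n : per (t := t1) c x y -> perenv c r r ->
  chosen c x n -> chosen c y n.
Proof.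
move=> hx hr [h1 h2]; split=> [|m lt].
  exact: frc_per (at_per n hx hr) h1.
exact: frc_per (at_per m hx hr) (h2 m lt).
Qed.

Lemma chosen_dense c (x : name t1) : per (t := t1) c x x -> perenv c r r ->
  frc c (ncons1 x r) (Ex tN A) -> dense (fun e => exists n, chosen e x n) c.
Proof.
move=> hx hr hE; apply: dense_dense; apply: dense_imp hE => d hd [y hy hA].
apply: dense_dense; apply: dense_imp (total_det hy) => e he [n [hn _]].
have hed := cond_trans he hd.
have hxe := per1_mono hed hx.
apply: dense_imp (settled_below n.+1 hxe (perenv_mono hed hr)) => f hf h.
have fA : frc f (at_ n x) A.
  apply: frc_mono hf _; apply: (frc_per (r := nconsN y (ncons1 x r))).
    apply: perenv_cons; first exact: (@per_det _ _ y n).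
    by apply: perenv_cons => //; apply: perenv_mono hr.
  exact: frc_mono he hA.
(* The least forced witness may lie below [n]. Smaller instances are settled and not forced, hence
   their negations are forced. *)
have [m [hm1 hm2]] : exists m, least (fun m => frc f (at_ m x) A) m.
  by apply: least_ex; exists n.
exists m; split=> // k lt; have le : m <= n.
  by rewrite leqNgt; apply/negP => /hm2.
case: (h k) => [|[_ /(hm2 _ lt)//]|[_ //]].
by apply: ltn_trans lt _; rewrite ltnS.
Qed.
End Choice.

Lemma frc_qfac G (A : fm (tN :: t1 :: G)) c (r : env names G) : qf A -> perenv c r r ->
  frc c r (All t1 (Ex tN A) ⊃ Ex t2 (All t1 (at_choice A))).
Proof.
move=> qA hr d hd hE; apply: dense_all => e he.
have hed := cond_trans he hd; have hre := perenv_mono hed hr.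
(* Related arguments have the same least witness; this is the extensionality of the choice
   functional. *)
have key1 f (x y : name t1) : ext f e -> per (t := t1) f x y ->
   dense (fun g => exists n, [/\ chosen A r g x n, det (part g) (choice_name r A x) n &
     det (part g) (choice_name r A y) n]) f.
  move=> hf hxy; have hx := per1_refl hxy; have hy := per1_refl (per1_sym hxy).
  have hrf := perenv_mono hf hre.
  apply: dense_dense; apply: dense_imp (chosen_dense qA hx hrf (hE f x (cond_trans hf he) hx)).
  move=> g hg [n hn]; have hrg := perenv_mono hg hrf.
  have hxy' := per1_mono hg hxy.
  have h1 := chosen_det qA (per1_mono hg hx) hrg hn.
  have h2 := chosen_det qA (per1_mono hg hy) hrg (chosen_per hxy' hrg hn).
  have u z : upward (fun e : cond => det (part e) (choice_name r A z) n).
    by move=> ? ? hh; apply: det_upward.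
  apply: dense_imp (dense_and (@u x) h1 h2) => h hh [h3 h4]; exists n; split=> //.
  by case: hn => h5 h6; split=> [|m lt]; [exact: frc_mono hh h5|exact: frc_mono hh (h6 m lt)].
exists (choice_name r A : names t2).
  move=> f x y hf hxy; apply: dense_imp (key1 f x y hf hxy) => g _ [n [_ h1 h2]].
  by exists n, n.
move=> f x hf hx; apply: frc_dense; apply: dense_imp (key1 f x x hf hx) => g hg [n [[h1 _] h2 _]].
rewrite /at_choice frc_fsub; apply: frc_per h1.
have hrg := perenv_mono hg (perenv_mono hf hre).
have -> : (fun t v => eval (ncons1 x (econs (M := names) (s := t2) (choice_name r A) r))
    (scons (v1 · v0) (scons v0 (fun t v => Var (Vs (Vs v)))) v)) =
  nconsN (choice_name r A x) (ncons1 x r).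
  by apply: subP => //; apply: varP.
apply: perenv_cons; first exact: (perN_sym (@per_det _ _ (choice_name r A x) n h2)).
by apply: perenv_cons => //; exact: (per1_mono hg hx).
Qed.

(** A number of the extension is densely a ground number, so induction in the metatheory over
    constant names suffices. *)
Lemma frc_ind G (A : fm (tN :: G)) c (r : env names G) : perenv c r r ->
  frc c r (inst A Zero ⊓ All tN (A ⊃ at_succ A) ⊃ All tN A).
Proof.
move=> hr d hd [h0 hS] e x he hx.
have key1 n : frc d (nconsN (fun _ => n) r) A.
  elim: n => [|n IH].
    by have h : frc d r (inst A Zero) := h0; rewrite frc_inst in h.
  have h : frc d (nconsN (fun _ => n) r) (at_succ A).
    exact: (hS d (fun _ => n) (cond_refl d) (@per_const _ d n) d (cond_refl d) IH).
  move: h; rewrite /at_succ frc_fsub; congr frc; apply: subP => //=.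
  by apply: funext => q; rewrite addn1.
apply: frc_dense; apply: dense_imp (total_det hx) => f hf [n [hn _]].
apply: (frc_per (r := nconsN (fun _ => n) r)).
  apply: perenv_cons; last exact: perenv_mono (cond_trans hf (cond_trans he hd)) hr.
  exact: (perN_sym (@per_det _ _ x n hn)).
exact: frc_mono (cond_trans hf he) (key1 n).
Qed.

Lemma forces_RCA0w : @forces_theory key RCA0w.
Proof.
move=> G A c r hr H; case: H r hr => {G A}.
- by move=> G x y z r hr; apply: frc_qf => //= q; rewrite addnA.
- by move=> G x y r hr; apply: frc_qf => //= q; rewrite addnC.
- by move=> G x r hr; apply: frc_qf => //= q; rewrite addn0.
- by move=> G x y z r hr; apply: frc_qf => //= q; rewrite mulnA.
- by move=> G x y r hr; apply: frc_qf => //= q; rewrite mulnC.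
- by move=> G x r hr; apply: frc_qf => //= q; rewrite muln1.
- by move=> G x r hr; apply: frc_qf => //= q; rewrite muln0.
- by move=> G x y z r hr; apply: frc_qf => //= q; rewrite mulnDr.
- by move=> G x r hr; apply: frc_qf => //= q; rewrite ltnn.
- by move=> G x y z r hr; apply: frc_qf => //= q; apply: ltn_trans.
- move=> G x y r hr; apply: frc_qf => //= q.
  by case: (ltngtP (eval r x q) (eval r y q)); auto.
- by move=> G r hr; apply: frc_qf.
- by move=> G x y z r hr; apply: frc_qf => //= q; rewrite ltn_add2r.
- by move=> G x y z r hr; apply: frc_qf => //= q h; rewrite ltn_pmul2r.
- by move=> G s t x y r hr; apply/(frc_eqt _ _ hr); apply: (per_eval x hr).
- move=> G a s t x y z r hr; apply/(frc_eqt _ _ hr).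
  exact: (per_eval (x · z · (y · z)) hr).
- by move=> G f m r hr; apply: frc_qf.
- move=> G f m n r hr; apply: (@per_dense _ tN).
  apply: dense_imp (total_det (per_eval n hr)) => e he [k [hk _]]; have hre := perenv_mono he hr.
  pose it : name tN := nat_rect (fun _ => world -> nat) (eval r m) (fun k a => eval r f (fun _ => k) a) k.
  have hit : per (t := tN) e it (eval r (Rec · f · m · n)).
    apply: per_cone; last exact: (per_eval (Rec · f · m · n) hre).
    by move=> q hq; rewrite /= hk.
  have hf : per (t := tN) e (eval r f (fun _ => k) it) (eval r (f · n · (Rec · f · m · n))).
    have h0 := perN_sym (@per_det _ _ (eval r n) k hk).
    exact: (per_eval f hre e _ _ (cond_refl e) h0 e _ _ (cond_refl e) hit).
  have h1 := @per_refl _ tN _ _ _ hf.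
  apply: (@per_trans _ tN _ _ _ _ _ hf); apply: per_cone h1 => q hq.
  by rewrite /= hk // addn1.
- move=> G s t f x y r hr d hd h; have hrd := perenv_mono hd hr.
  apply/(frc_eqt _ _ hrd); apply: (per_eval f hrd); first exact: cond_refl.
  exact/(frc_eqt _ _ hrd).
- by move=> G A _ r hr; apply: frc_ind.
- by move=> G A qA r hr; apply: frc_qfac.
Qed.

(** Fusion: the infinite set of free values is split into infinitely many
    infinite pieces; step [k] only spends values of piece [k + 1], so that
    piece [0] is still free in the limit. *)
Section Fusion.
Variable E : nat -> cond -> Prop.
Variable c : cond.
(** The limit contains the parts of all intermediate conditions but does not extend these
    conditions, since it restores free values that they had given up. Hence the requirements may
    depend on the part only. *)
Hypothesis E_part : forall n d e, wle (part d) (part e) -> E n d -> E n e.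
Hypothesis E_dense : forall n, dense (E n) c.

Let next (n : nat) : {m | n <= m /\ free c m}.
Proof.
apply: cid; have [m h1 h2] := free_inf c n.
by exists m.
Qed.
Let enum := fix enum n := proj1_sig (next (match n with 0 => 0 | n.+1 => (enum n).+1 end)).
Let enum_free n : free c (enum n).
Proof. by case: n => [|n] /=; case: next => m []. Qed.
Let enum_lt n : enum n < enum n.+1.
Proof. by rewrite [enum n.+1]/=; case: next => m []. Qed.
Let enum_mono n m : n < m -> enum n < enum m.
Proof.
elim: m => // m IH; rewrite ltnS leq_eqVlt => /orP[/eqP ->|/IH h]; first exact: enum_lt.
exact: ltn_trans h (enum_lt m).
Qed.
Let enum_inj n m : enum n = enum m -> n = m.
Proof. by move=> e; case: (ltngtP n m) => // /enum_mono; rewrite e ltnn. Qed.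
Let enum_ge n : n <= enum n.
Proof. by elim: n => // n IH; apply: leq_ltn_trans IH (enum_lt n). Qed.

(** A pairing function splits the enumeration of free values. Each piece is infinite by the
    pigeonhole principle, because pairing with a fixed [k] is injective. *)
Let piece (k m : nat) := exists j : nat, m = enum (pickle (k, j)).
Let piece_inf k n : exists2 m, n <= m & piece k m.
Proof.
apply: NNPP => no.
have lt (j : nat) : pickle (k, j) < n.
  rewrite ltnNge; apply/negP => le; apply: no; exists (enum (pickle (k, j))); last by exists j.
  exact: leq_trans le (enum_ge _).
pose f (i : 'I_n.+1) : 'I_n := Ordinal (lt i).
have /leq_card : injective f.
  by move=> i j /(f_equal val) /= /(pcan_inj pickleK) [] /val_inj.
by rewrite !card_ord ltnn.
Qed.

Let piece_disj k k' m : piece k m -> piece k' m -> k = k'.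
Proof. by move=> [j ->] [j' /enum_inj/(pcan_inj pickleK)[]]. Qed.
Let piece_free k m : piece k m -> free c m.
Proof. by move=> [j ->]; apply: enum_free. Qed.

(** The invariant after [k] steps. Piece 0 and all pieces beyond [k] are untouched, so either kind
    can serve as the set of free values in [good_cond]. *)
Let good k (p : world) :=
  [/\ wle (part c) p,
      forall x y m, p x = Some m -> p y = Some m -> x = y &
      forall x m, p x = Some m -> part c x = Some m \/ exists2 i, 0 < i <= k & piece i m].

Let good_new k k' p x m : good k p -> (k' = 0 \/ k < k') -> p x = Some m -> ~ piece k' m.
Proof.
move=> [h1 h2 h3] hk hx hm; have [h|[i /andP[i0 ik] hi]] := h3 x m hx.
  exact: free_part h (piece_free hm).
by move: hk; rewrite (piece_disj hm hi) => -[e|]; [rewrite e in i0|rewrite ltnNge ik].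
Qed.

Let good_cond k k' p (hp : good k p) (hk : k' = 0 \/ k < k') : cond :=
  Cond (let: And3 _ h _ := hp in h) (piece_inf k') (fun x m => good_new hp hk).

Let good_ext k k' p (hp : good k p) (hk : k' = 0 \/ k < k') : ext (good_cond hp hk) c.
Proof.
have [h1 h2 h3] := hp; split=> //= [x m /h3 [h|[i _ /piece_free]]|m]; [by left|by right|].
exact: piece_free.
Qed.

Let stage_next k p : good k p -> exists q, [/\ good k.+1 q, wle p q &
  forall d, part d = q -> E k d].
Proof.
move=> hp; have hk : k.+1 = 0 \/ k < k.+1 by right.
have [e he hE] := dense_here (dense_mono (good_ext hp hk) (E_dense k)).
have [h1 h2 h3] := he; have [g1 g2 g3] := hp.
exists (part e); split=> //; last by move=> d ed; apply: E_part hE; rewrite ed.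
split; [exact: wle_trans g1 h1|exact: part_inj|move=> x m /h2 [/g3|] /=].
  move=> [|[i /andP[i0 ik] hi]]; first by left.
  by right; exists i => //; rewrite i0 (leq_trans ik).
by move=> hm; right; exists k.+1 => //; rewrite ltnSn.
Qed.

Let stages := fix stages k : {p | good k p} :=
  match k with
  | 0 => exist (good 0) (part c) (And3 (@wle_refl _ _) (@part_inj _ c) (fun x m h => or_introl h))
  | k.+1 => let h := cid (stage_next (proj2_sig (stages k))) in
      exist (good k.+1) (proj1_sig h) (let: And3 h _ _ := proj2_sig h in h)
  end.
Let st k := proj1_sig (stages k).
Let st_next k : wle (st k) (st k.+1).
Proof. by rewrite /st /=; case: cid => q []. Qed.
Let st_E k d : part d = st k.+1 -> E k d.
Proof. by rewrite /st /=; case: cid => q [] /= _ _; apply. Qed.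
Let st_mono k k' : k <= k' -> wle (st k) (st k').
Proof.
move/subnK <-; elim: (k' - k) => [|i IH]; first exact: wle_refl.
by move=> x m /IH; apply: st_next.
Qed.

Let limit : world := fun x =>
  if pselect (exists m k, st k x = Some m) is left h
  then Some (proj1_sig (cid h)) else None.

Let limitP x m : limit x = Some m <-> exists k, st k x = Some m.
Proof.
rewrite /limit; case: pselect => h; last first.
  by split=> // -[k hk]; case: h; exists m, k.
case: cid => m' [k hk] /=; split=> [[<-]|[k' hk']].
  by exists k.
have a := st_mono (leq_maxl k k') hk; have b := st_mono (leq_maxr k k') hk'.
by rewrite -a -b.
Qed.

Let limit_inj x y m : limit x = Some m -> limit y = Some m -> x = y.
Proof.
move=> /limitP[k hk] /limitP[k' hk']; have [_ h _] := proj2_sig (stages (maxn k k')).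
by apply: h (st_mono (leq_maxl k k') hk) (st_mono (leq_maxr k k') hk').
Qed.

Let limit_free x m : limit x = Some m -> ~ piece 0 m.
Proof.
move=> /limitP[k hk]; exact: (good_new (proj2_sig (stages k)) (or_introl erefl) hk).
Qed.

Lemma fusion : exists2 e, ext e c & forall n, E n e.
Proof.
exists (Cond limit_inj (piece_inf 0) limit_free).
  split=> /= [x m h|x m /limitP[k hk]|m /piece_free //].
    by apply/limitP; exists 0.
  have [_ _ h] := proj2_sig (stages k); case: (h _ _ hk) => [|[i _ /piece_free]]; by [left|right].
move=> n; have [h1 h2 h3] := proj2_sig (stages n.+1).
have hk : 0 = 0 \/ n.+1 < 0 by left.
(* Stage [n.+1] is read with piece 0 as its free values; [st_E] holds for every condition with this
   part. *)
apply: (E_part (d := good_cond (proj2_sig (stages n.+1)) hk)); last exact: st_E.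
by move=> x m h; apply/limitP; exists n.+1.
Qed.
End Fusion.
End ForcingRCA.

(** * The ground model and absoluteness *)

Fixpoint fn (t : ty) : Type := match t with tN => nat | Arr s t => fn s -> fn t end.

Definition fn_rec s : fn ((tN ⟶ s ⟶ s) ⟶ s ⟶ tN ⟶ s) :=
  match s return fn ((tN ⟶ s ⟶ s) ⟶ s ⟶ tN ⟶ s) with
  | tN => fun f m n => nat_rect (fun _ => nat) m f n
  | Arr _ _ => fun f m n => m
  end.

Definition std : structure := @Structure fn (fun s t f x => f x)
  0 1 addn muln (fun s t x y => x) (fun r s t x y z => x z (y z)) fn_rec.
Definition std_lt : std tN -> std tN -> Prop := fun n m => n < m.
Notation gconsN := (@econs std tN _).
Notation gcons1 := (@econs std t1 _).
Notation std_sat := (@sat std eq std_lt).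

(** The formulas of second-order arithmetic: quantifiers range over numbers and functions on
    numbers, while terms may contain constants of any type. *)
Fixpoint arith G (A : fm G) : bool :=
  match A with
  | And A B | Or A B | Imp A B => arith A && arith B
  | All t A | Ex t A => match t with tN | Arr tN tN => arith A | _ => false end
  | _ => true
  end.

(** Bracket abstraction commutes with renamings but not with substitution in general: abstracting
    over a weakened application gives [Sigma · _ · _], not [Pi · _]. Renamings suffice to move
    normal forms between contexts. *)
Lemma lam_ren s G D t (x : tm (s :: G) t) (g : ren G D) :
  tsub (fun t v => Var (g t v)) (lam x) = lam (tsub (up (fun t v => Var (g t v))) x).
Proof.
elim: x => //= {t} [|a t f -> x -> //].
by apply: varP.
Qed.

Definition up_ren s G D (g : ren G D) : ren (s :: G) (s :: D) :=
  vcase (P := var (s :: D)) Vz (fun t v => Vs (g t v)).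
Lemma up_renE s G D (g : ren G D) :
  up (s := s) (fun t v => Var (g t v)) = (fun t v => Var (up_ren g v)).
Proof. exact: subP. Qed.

Lemma bar_ren G D (g : ren G D) f n : tsub (fun t v => Var (g t v)) (bar f n) =
  bar (tsub (fun t v => Var (g t v)) f) (tsub (fun t v => Var (g t v)) n).
Proof.
rewrite /bar [LHS]/=; congr (Rec · _ · _ · _).
rewrite -[LHS]/(tsub (fun t v => Var (g t v)) (lam (lam (cpair v0 (wk (wk f) · v1) ⊕ One)))).
rewrite lam_ren up_renE lam_ren -!up_renE; congr (lam (lam _)).
rewrite -[LHS]/(cpair v0 (tsub (up (up (fun t v => Var (g t v)))) (wk (wk f)) · v1) ⊕ One).
by rewrite !up_wk.
Qed.

Lemma tuple_code_sub G D (f : sub G D) xs :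
  tsub f (tuple_code xs) = tuple_code [seq tsub f x | x <- xs].
Proof. by case: xs => //= x xs; elim: xs x => //= y xs IH x; rewrite IH. Qed.

Lemma normal_form_ren k b G D (g : ren G D) f gs :
  fsub (fun t v => Var (g t v)) (normal_form k b f gs) =
  normal_form k b (tsub (fun t v => Var (g t v)) f) [seq tsub (fun t v => Var (g t v)) x | x <- gs].
Proof.
elim: k b G D g f gs => [|k IH] b G D g f gs.
  have e : tsub (up (fun t v => Var (g t v))) (wk f · tuple_code [seq bar (wk h) v0 | h <- gs]) =
    wk (tsub (fun t v => Var (g t v)) f) · tuple_code [seq bar (wk h) v0 | h <- [seq tsub (fun t v => Var (g t v)) x | x <- gs]].
    rewrite [LHS]/= up_wk tuple_code_sub; congr (_ · tuple_code _); rewrite -!map_comp.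
    apply: eq_map => h; rewrite -[LHS]/(tsub (up (fun t v => Var (g t v))) (bar (wk h) v0)).
    rewrite -[RHS]/(bar (wk (tsub (fun t v => Var (g t v)) h)) v0).
    by rewrite up_renE bar_ren -up_renE up_wk.
  by case: b; [exact: (f_equal (fun t => Ex tN (t ≐ Zero)) e)|exact: (f_equal (fun t => All tN (t ≐ Zero)) e)].
have e : fsub (up (fun t v => Var (g t v))) (normal_form k (~~ b) (wk f) (rcons (map wk gs) v0)) =
  normal_form k (~~ b) (wk (s := t1) (tsub (fun t v => Var (g t v)) f))
   (rcons (map wk [seq tsub (fun t v => Var (g t v)) x | x <- gs]) v0).
  rewrite up_renE IH -up_renE up_wk map_rcons -!map_comp; congr normal_form; congr rcons.
  by apply: eq_map => h /=; rewrite up_wk.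
by case: b e => e; [exact: (f_equal (Ex t1) e)|exact: (f_equal (All t1) e)].
Qed.

Lemma arith_normal_form k b G (f : tm G t1) gs : arith (normal_form k b f gs).
Proof. by elim: k b G f gs => [|k IH] [] G f gs //=; apply: IH. Qed.

(** * No new functions on the numbers, and absoluteness *)

Section Absolute.
Variable key : Type.
Local Notation world := (world key).
Local Notation name := (name key).
Local Notation names := (names key).
Local Notation cond := (cond key).
Implicit Types c d e : cond.

Fixpoint ground t : fn t -> name t -> Prop :=
  match t return fn t -> name t -> Prop with
  | tN => fun n x => x = fun _ => n
  | Arr s t => fun f F => forall a A, ground a A -> ground (f a) (F A)
  end.

Lemma ground_eval G (r : env std G) (r' : env names G) t (x : tm G t) :
  (forall t v, @ground t (r t v) (r' t v)) -> @ground t (eval r x) (eval r' x).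
Proof.
move=> h; elim: x => //= {t}.
- by move=> s t f IHf x IHx; apply: IHf.
- by move=> n x -> m y ->.
- by move=> n x -> m y ->.
- by move=> a s t f F hF g g' hg x X hX; exact: (hF x X hX (g x) (g' X) (hg x X hX)).
- case=> [|s t] f F hF m m' hm n n' hn //=; move: hm hn => /= -> ->.
  apply: funext => q.
  suff -> : nat_rect (fun _ => world -> nat) (fun _ => m) (fun k a => F (fun _ => k) a) n =
    fun _ => nat_rect (fun _ => nat) m f n by [].
  elim: n => //= n ->; exact: (hF n (fun _ => n) erefl _ _ erefl).
Qed.

Definition hat (f : nat -> nat) : name t1 := fun x q => f (x q).
Lemma ground_hat f : @ground t1 f (hat f).
Proof. by move=> a A ->. Qed.

Lemma per_hat c f : per (t := t1) c (hat f) (hat f).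
Proof.
move=> d x y hd /total_det; apply: dense_imp => e he [n [h1 h2]].
by exists (f n), (f n); split=> // q hq; rewrite /hat ?h1 ?h2.
Qed.

Lemma det_hat c (x : name t1) f : per (t := t1) c x x ->
  (forall n, det (part c) (x (fun _ => n)) (f n)) -> per (t := t1) c x (hat f).
Proof.
move=> hx hf d a b hd hab; apply: (@per_dense _ tN).
apply: dense_imp (total_det hab) => e he [n [h1 h2]]; have hec := cond_trans he hd.
have p1 : per (t := tN) e (x a) (x (fun _ => n)) by apply: hx => //; apply: per_det.
have p2 : per (t := tN) e (x (fun _ => n)) (fun _ => f n).
  by apply: per_det; apply: det_upward hec _.
apply: (@per_trans _ tN _ _ _ _ p1); apply: (@per_trans _ tN _ _ _ _ p2).
apply: (@per_sym _ tN); apply: per_det => q hq; by rewrite /hat h2.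
Qed.

(** Fusion, where the [n]-th requirement is that the value at [n] be determined: one condition then
    determines all values at once. *)
Lemma ground_dense c (x : name t1) : per (t := t1) c x x ->
  dense (fun e => exists f, forall n, det (part e) (x (fun _ => n)) (f n)) c.
Proof.
move=> hx d hd; have hxd := per1_mono hd hx.
have [|n|e he h] := @fusion key (fun n e => exists m, det (part e) (x (fun _ => n)) m) d.
- by move=> n e f h [m hm]; exists m; apply: det_mono hm.
- have := total_det (hxd d _ _ (cond_refl d) (@per_const _ d n)).
  by apply: dense_imp => e _ [m [h _]]; exists m.
exists e => //; exists (fun n => proj1_sig (cid (h n))) => n.
by case: cid.
Qed.

Lemma ground_per c (x : name t1) : per (t := t1) c x x ->
  dense (fun e => exists f, per (t := t1) e x (hat f)) c.
Proof.
move=> hx; apply: dense_imp (ground_dense hx) => d hd [f hf]; exists f.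
by apply: det_hat => //; apply: (@per_mono _ t1) hx.
Qed.

(** Numbers and functions of the extension are densely ground ones, so quantifiers of both sorts
    range over the same objects on either side, and what is forced does not depend on the
    condition. *)
Lemma absolute G (A : fm G) (r : env std G) (r' : env names G) : arith A ->
  (forall t v, @ground t (r t v) (r' t v)) -> (forall c, perenv c r' r') ->
  forall c, frc c r' A <-> std_sat r A.
Proof.
elim: A r r' => {G} /=.
- move=> G x y r r' _ hg hr c.
  rewrite (ground_eval x hg : _ = _) (ground_eval y hg : _ = _); split=> [|->]; last exact: per_const.
  move=> /dense_here[e _ [n [m [h1 h2 nm]]]].
  by move: (h1 (part e) (@wle_refl _ _)) (h2 (part e) (@wle_refl _ _)) => /= -> ->.
- move=> G x y r r' _ hg hr c.
  rewrite (ground_eval x hg : _ = _) (ground_eval y hg : _ = _) /std_lt; split=> [|lt].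
    move=> /dense_here[e _ [n [m [h1 h2 nm]]]].
    by move: (h1 (part e) (@wle_refl _ _)) (h2 (part e) (@wle_refl _ _)) => /= -> ->.
  apply: dense_all => d _; eexists; eexists; split; [| |exact: lt]; by [].
- by move=> G r r' _ _ _ c.
- by move=> G A IHA B IHB r r' /andP[/IHA{}IHA /IHB{}IHB] hg hr c; rewrite (IHA r) // (IHB r).
- move=> G A IHA B IHB r r' /andP[/IHA{}IHA /IHB{}IHB] hg hr c; split.
    by move=> /dense_here[e _ [/IHA h|/IHB h]]; [left|right]; auto.
  by move=> h; apply: dense_all => d _; case: h => h; [left; apply/IHA; eauto|right; apply/IHB; eauto].
- move=> G A IHA B IHB r r' /andP[/IHA{}IHA /IHB{}IHB] hg hr c; split=> h.
    move=> hA; apply/(IHB r r' hg hr c); apply: h (cond_refl c) _; exact/(IHA r r' hg hr c).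
  by move=> d _ /(IHA r r' hg hr) /h ?; apply/(IHB r r' hg hr).
- move=> G [|[] []] A IH // r r' qA hg hr c; split=> h.
  + move=> n; apply/(IH (gconsN n r) (nconsN (fun _ => n) r') qA _ _ c).
    * by apply: varP.
    * by move=> d; apply: perenv_cons => //; apply: per_const.
    * by apply: h; [apply: cond_refl|apply: per_const].
  + move=> d x hd hx; apply: frc_dense; apply: dense_imp (total_det hx) => e he [n [hn _]].
    apply: (frc_per (r := nconsN (fun _ => n) r')).
      by apply: perenv_cons => //; exact: (perN_sym (@per_det _ _ x n hn)).
    apply/(IH (gconsN n r)) => //; first by apply: varP.
    by move=> f; apply: perenv_cons => //; apply: per_const.
  + move=> n; apply/(IH (gcons1 n r) (ncons1 (hat n) r') qA _ _ c).
    * by apply: varP => //; apply: ground_hat.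
    * by move=> d; apply: perenv_cons => //; apply: per_hat.
    * by apply: h; [apply: cond_refl|apply: per_hat].
  + move=> d x hd hx; apply: frc_dense; apply: dense_imp (ground_per hx) => e he [f hf].
    apply: (frc_per (r := ncons1 (hat f) r')).
      by apply: perenv_cons => //; exact: (per1_sym hf).
    apply/(IH (gcons1 f r)) => //; first by apply: varP => //; apply: ground_hat.
    by move=> g; apply: perenv_cons => //; apply: per_hat.
- move=> G [|[] []] A IH // r r' qA hg hr c; split.
  + move=> /dense_here[d hd [x hx hA]].
    have [e he [n [hn _]]] := dense_here (total_det hx).
    exists n; apply/(IH (gconsN n r) (nconsN (fun _ => n) r') qA _ _ e).
    * by apply: varP.
    * by move=> ?; apply: perenv_cons => //; apply: per_const.
    * apply: (frc_per (r := nconsN x r')); last exact: frc_mono he hA.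
      by apply: perenv_cons => //; apply: (@per_det _ _ x n).
  + move=> [n h]; apply: dense_all => d hd; exists (fun _ => n); first exact: per_const.
    apply/(IH (gconsN n r)) => //; first by apply: varP.
    by move=> ?; apply: perenv_cons => //; apply: per_const.
  + move=> /dense_here[d hd [x hx hA]].
    have [e he [f hf]] := dense_here (ground_per hx).
    exists f; apply/(IH (gcons1 f r) (ncons1 (hat f) r') qA _ _ e).
    * by apply: varP => //; apply: ground_hat.
    * by move=> ?; apply: perenv_cons => //; apply: per_hat.
    * apply: (frc_per (r := ncons1 x r')); last exact: frc_mono he hA.
      exact: perenv_cons.
  + move=> [f h]; apply: dense_all => d hd; exists (hat f); first exact: per_hat.
    apply/(IH (gcons1 f r)) => //; first by apply: varP => //; apply: ground_hat.
    by move=> ?; apply: perenv_cons => //; apply: per_hat.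
Qed.

Lemma absolute1 (A : fm [:: t1]) c f : arith A ->
  frc c (ncons1 (hat f) enil) A <-> std_sat (gcons1 f enil) A.
Proof.
move=> qA; apply: absolute => //.
  by apply: varP => [|t v]; [apply: ground_hat|case: (var_nil v)].
by move=> d; apply: perenv_cons => [|t v]; [apply: per_hat|case: (var_nil v)].
Qed.

Definition S_true k (f : nat -> nat) := std_sat (gcons1 f enil) (Sigma1 k v0).

(** The answer is looked up in the ground model as soon as the world determines all of [x]. Before
    that the value is 1, a default that may still change; above a condition that determines [x] it
    no longer does. *)
Definition S_name k : name t2 := fun x q =>
  if pselect
    (exists2 f, (forall n, det q (x (fun _ => n)) (f n)) & S_true k f) then 0 else 1.

Lemma S_name_det k c (x : name t1) f : (forall n, det (part c) (x (fun _ => n)) (f n)) ->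
  det (part c) (S_name k x) (if pselect (S_true k f) then 0 else 1).
Proof.
move=> hf q hq; rewrite /S_name; case: pselect => [[g hg tg]|no];
  case: pselect => // h.
  case: h; have -> // : f = g.
  by apply: funext => n; apply: det_uniq (hg n); apply: det_mono (hf n).
by case: no; exists f => // n; apply: det_mono (hf n).
Qed.

Lemma S_name_per k c : per (t := t2) c (S_name k) (S_name k).
Proof.
move=> d x y hd hxy; have hx := per1_refl hxy.
have hy := per1_refl (per1_sym hxy).
have u (z : name t1) : upward (fun e : cond => exists f : nat -> nat, forall n, det (part e) (z (fun _ => n)) (f n)).
  by move=> e e' he [f hf]; exists f => n; apply: det_upward he _.
apply: dense_imp (dense_and (@u x) (ground_dense hx) (ground_dense hy)) => e he [[f hf] [g hg]].
have e0 : g = f.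
  apply: funext => n.
  have /total_det/dense_here[e' he' [m [h1 h2]]] := hxy e _ _ he (@per_const _ e n).
  by rewrite (det_uniq (det_upward he' (hg n)) h2) (det_uniq (det_upward he' (hf n)) h1).
by rewrite e0 in hg; eexists; eexists; split; [exact: S_name_det hf|exact: S_name_det hg|].
Qed.

Lemma env_nil (M : structure) (r : env M [::]) : r = enil.
Proof. by apply: funext => t; apply: funext => v; case: (var_nil v). Qed.

Lemma frc_lift G c (r : env names G) A : frc c r (lift G A) = frc c enil A.
Proof. by rewrite /lift /fren frc_fsub; congr frc; apply: env_nil. Qed.

Lemma frc_Sigma1 k G c (r : env names (t1 :: G)) f : perenv c r r ->
  per (t := t1) c (r _ Vz) (hat f) -> frc c r (Sigma1 k v0) <-> S_true k f.
Proof.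
move=> hr hf; rewrite /S_true -(absolute1 c f); last exact: arith_normal_form.
pose g : ren [:: t1] (t1 :: G) := vcase (P := var (t1 :: G)) Vz (fun t v => False_rect _ (var_nil v)).
have -> : Sigma1 k (v0 : tm (t1 :: G) t1) = fsub (fun t v => Var (g t v)) (Sigma1 k v0).
  by rewrite /Sigma1 normal_form_ren.
rewrite frc_fsub.
have p : perenv c (fun t v => eval r (Var (g t v))) (ncons1 (hat f) enil).
  by apply: varP => [|t v]; [exact: hf|case: (var_nil v)].
split; apply: frc_per => // t v; exact: per_sym (p t v).
Qed.

Lemma forces_Z2w : @forces_theory key Z2w.
Proof.
move=> G A c r hr H; case: H r hr => {G A} [G A hA r hr|k G _ r hr].
  exact: forces_RCA0w.
rewrite frc_lift; apply: dense_all => d hd; exists (S_name k : names t2); first exact: S_name_per.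
move=> e x he hx.
pose r' : env names [:: t1; t2] := ncons1 x
  (econs (M := names) (s := t2) (S_name k) enil).
apply: (@frc_dense key _ e r' ((v1 · v0 ≐ Zero ⊔ v1 · v0 ≐ One) ⊓ (Sigma1 k v0 ⇔ v1 · v0 ≐ Zero))).
(* From here on the argument is one ground function, so the truth of the formula and the value of
   the functional are both fixed. *)
apply: dense_imp (ground_dense hx) => e1 he1 [f hf].
have hx1 := per1_mono he1 hx.
have pf := det_hat hx1 hf; have hd1 := S_name_det k hf.
have hr' e2 : ext e2 e1 -> perenv e2 r' r'.
  move=> h2; apply: perenv_cons; first exact: (@per_mono _ t1) h2 hx1.
  by apply: perenv_cons => [|t v]; [apply: S_name_per|case: (var_nil v)].
have hS e2 : ext e2 e1 -> frc e2 r' (Sigma1 k v0) <-> S_true k f.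
  by move=> h2; apply: frc_Sigma1; [apply: hr'|apply: (@per_mono _ t1) h2 pf].
have hv e2 n : ext e2 e1 -> (fcmp eq e2 (S_name k x) (fun _ => n) <->
     (if pselect (S_true k f) then 0 else 1) = n).
  move=> h2; split=> [/dense_here[e3 h3 [a [b [h4 h5 ab]]]]|<-].
    rewrite (det_uniq (det_upward (cond_trans h3 h2) hd1) h4) ab.
    by rewrite -(h5 _ (@wle_refl _ _)).
  by apply: per_det; apply: det_upward h2 hd1.
have hv0 e2 : ext e2 e1 -> (fcmp eq e2 (S_name k x) (fun _ => 0) <-> S_true k f).
  by move=> h2; rewrite hv //; case: pselect.
split; last split.
- apply: dense_all => e2 h2; case: (classic (S_true k f)) => h; [left|right].
    exact/(hv0 e2 h2).
  by apply/(hv e2 1 h2); case: pselect.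
- by move=> e2 h2 /(hS e2 h2) h; apply/(hv0 e2 h2).
- by move=> e2 h2 /(hv0 e2 h2) h; apply/(hS e2 h2).
Qed.
End Absolute.

(** * Arithmetic and rationals in a model of RCA0w *)

Record rca_model := RcaModel {
  mcar :> structure;
  mlt : mcar tN -> mcar tN -> Prop;
  mext : extensional mcar;
  mvalid : is_model eq mlt RCA0w }.

Declare Scope mn_scope.
Delimit Scope mn_scope with mn.
Definition madd (M : structure) (x y : M tN) : M tN := app (app (cplus M) x) y.
Definition mmul (M : structure) (x y : M tN) : M tN := app (app (ctimes M) x) y.
Notation "x + y" := (madd x y) : mn_scope.
Notation "x * y" := (mmul x y) : mn_scope.
Notation "0" := (czero _) : mn_scope.
Notation "1" := (cone _) : mn_scope.
Notation "x < y" := (mlt x y) : mn_scope.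
Definition mle (M : rca_model) (x y : M tN) := mlt x y \/ x = y.
Notation "x <= y" := (mle x y) : mn_scope.
Notation "f $ x" := (app f x) (at level 11, left associativity) : mn_scope.

Section Model.
Variable M : rca_model.
Local Open Scope mn_scope.
Notation N := (M tN).
Implicit Types x y z : N.
Local Notation sat := (sat eq (@mlt M)).

Lemma ext_eqE t (f g : M t) : ext_eq eq f g -> f = g.
Proof. by elim: t f g => //= s _ t IH f g h; apply: (mext (r := M)) => z; apply: IH. Qed.

Lemma appK s t (x : M s) (y : M t) : cpi M s t $ x $ y = x.
Proof.
have := mvalid (econs x (econs y enil)) (ax_Pi v0 v1).
by rewrite sat_eqt => /ext_eqE.
Qed.

Lemma appS r s t (x : M (r ⟶ s ⟶ t)) (y : M (r ⟶ s)) (z : M r) :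
  csigma M r s t $ x $ y $ z = x $ z $ (y $ z).
Proof.
have := mvalid (econs x (econs y (econs z enil))) (ax_Sigma v0 v1 v2).
by rewrite sat_eqt => /ext_eqE.
Qed.

Lemma lamE G s t (x : tm (s :: G) t) (r : env M G) (d : M s) :
  eval r (lam x) $ d = eval (econs d r) x.
Proof.
elim: x => /= {t}; try by move=> *; rewrite appK.
  refine (varP (P := fun t v => eval r (vcase (P := fun t => tm G (s ⟶ t))
      (Sigma · Pi · (Pi (t := s))) (fun t v => Pi · Var v) v) $ d = _) _ _) => /=.
    by rewrite appS appK.
  by move=> u v /=; rewrite appK.
by move=> a b f IHf x IHx; rewrite appS IHf IHx.
Qed.

Local Opaque lam.

Lemma mn_addA x y z : x + (y + z) = x + y + z.
Proof. exact: (mvalid (econs x (econs y (econs z enil))) (ax_addA v0 v1 v2)). Qed.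
Lemma mn_addC x y : x + y = y + x.
Proof. exact: (mvalid (econs x (econs y enil)) (ax_addC v0 v1)). Qed.
Lemma mn_add0 x : x + 0 = x.
Proof. exact: (mvalid (econs x enil) (ax_add0 v0)). Qed.
Lemma mn_mulA x y z : x * (y * z) = x * y * z.
Proof. exact: (mvalid (econs x (econs y (econs z enil))) (ax_mulA v0 v1 v2)). Qed.
Lemma mn_mulC x y : x * y = y * x.
Proof. exact: (mvalid (econs x (econs y enil)) (ax_mulC v0 v1)). Qed.
Lemma mn_mul1 x : x * 1 = x.
Proof. exact: (mvalid (econs x enil) (ax_mul1 v0)). Qed.
Lemma mn_mul0 x : x * 0 = 0.
Proof. exact: (mvalid (econs x enil) (ax_mul0 v0)). Qed.
Lemma mn_mulD x y z : x * (y + z) = x * y + x * z.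
Proof. exact: (mvalid (econs x (econs y (econs z enil))) (ax_mulD v0 v1 v2)). Qed.
Lemma mn_ltI x : ~ (x < x).
Proof. exact: (mvalid (econs x enil) (ax_ltI v0)). Qed.
Lemma mn_ltT x y z : x < y -> y < z -> x < z.
Proof. exact: (mvalid (econs x (econs y (econs z enil))) (ax_ltT v0 v1 v2)). Qed.
Lemma mn_lt_total x y : (x < y \/ x = y) \/ y < x.
Proof.
have := (mvalid (econs x (econs y enil)) (ax_lt_total v0 v1)) => /=; tauto.
Qed.
Lemma mn_lt01 : (0 : N) < 1.
Proof. exact: (mvalid enil (ax_lt01 _)). Qed.
Lemma mn_lt_add x y z : x < y -> x + z < y + z.
Proof. exact: (mvalid (econs x (econs y (econs z enil))) (ax_lt_add v0 v1 v2)). Qed.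
Lemma mn_lt_mul x y z : 0 < z -> x < y -> x * z < y * z.
Proof. exact: (mvalid (econs x (econs y (econs z enil))) (ax_lt_mul v0 v1 v2)). Qed.
Lemma mn_rec0 (f : M (tN ⟶ tN ⟶ tN)) m : crec M tN $ f $ m $ 0 = m.
Proof. exact: (mvalid (econs f (econs m enil)) (ax_rec0 v0 v1)). Qed.
Lemma mn_recS (f : M (tN ⟶ tN ⟶ tN)) m n :
  crec M tN $ f $ m $ (n + 1) = f $ n $ (crec M tN $ f $ m $ n).
Proof. exact: (mvalid (econs f (econs m (econs n enil))) (ax_recS v0 v1 v2)). Qed.

Lemma sat_ind G (A : fm (tN :: G)) (r : env M G) : qf A ->
  sat (econs (0 : N) r) A ->
  (forall n : N, sat (econs n r) A -> sat (econs (n + 1) r) A) ->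
  forall n, sat (econs n r) A.
Proof.
move=> q h0 hS; have /= := mvalid r (ax_ind q); apply.
rewrite sat_inst; split=> // d h.
rewrite /at_succ sat_fsub eval_scons; exact: hS.
Qed.

Lemma semi_ring : semi_ring_theory (0 : N) 1 (@madd M) (@mmul M) eq.
Proof.
constructor.
- by move=> x; rewrite mn_addC mn_add0.
- exact: mn_addC.
- exact: mn_addA.
- by move=> x; rewrite mn_mulC mn_mul1.
- by move=> x; rewrite mn_mulC mn_mul0.
- exact: mn_mulC.
- exact: mn_mulA.
- by move=> x y z; rewrite mn_mulC mn_mulD !(mn_mulC z).
Qed.
Add Ring Nring : semi_ring.

Lemma mn_ge0 x : 0 <= x.
Proof.
suff h : sat (econs x enil) (Zero ≺ v0 ⊔ Zero ≐ v0) by case: h; [left|right].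
move: x; apply: sat_ind => //=; first by right.
move=> n h; left.
have h' : n < n + 1 by have := mn_lt_add n mn_lt01; rewrite mn_addC mn_add0 mn_addC.
by case: h => [h|->]; [apply: mn_ltT h h'|].
Qed.

Lemma mn_le_lt_trans x y z : x <= y -> y < z -> x < z.
Proof. by case=> [h|-> //]; apply: mn_ltT. Qed.
Lemma mn_lt_le_trans x y z : x < y -> y <= z -> x < z.
Proof. by move=> h [h'|<- //]; apply: mn_ltT h'. Qed.
Lemma mn_le_trans x y z : x <= y -> y <= z -> x <= z.
Proof. by move=> [h|->] // h'; left; apply: mn_lt_le_trans h'. Qed.
Lemma mn_le_add x y z : x <= y -> x + z <= y + z.
Proof. by case=> [h|->]; [left; apply: mn_lt_add|right]. Qed.
Lemma mn_lt_leF x y : x < y -> y <= x -> False.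
Proof. by move=> h h'; apply: (@mn_ltI x); apply: mn_lt_le_trans h'. Qed.
Lemma mn_nltP x y : ~ x < y <-> y <= x.
Proof.
split=> [h|h h']; last exact: mn_lt_leF h' h.
by case: (mn_lt_total x y) => [[//|->]|]; [right|left].
Qed.
Lemma mn_ltS x : x < x + 1.
Proof. by have := mn_lt_add x mn_lt01; rewrite mn_addC mn_add0 mn_addC. Qed.

Lemma mn_addI z x y : x + z = y + z -> x = y.
Proof.
move=> e; case: (mn_lt_total x y) => [[h|//]|h]; move: (mn_lt_add z h); rewrite e => /mn_ltI //.
Qed.

Lemma mn_mulI z x y : 0 < z -> x * z = y * z -> x = y.
Proof.
move=> p e; case: (mn_lt_total x y) => [[h|//]|h]; move: (mn_lt_mul p h); rewrite e => /mn_ltI //.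
Qed.

Definition predE : M t1 := crec M tN $ (eval enil (lam (lam v1))) $ 0.
Lemma mn_pred0 : predE $ 0 = 0.
Proof. exact: mn_rec0. Qed.
Lemma mn_predS n : predE $ (n + 1) = n.
Proof. by rewrite /predE mn_recS !lamE. Qed.
Local Opaque predE.

Definition subE : M (tN ⟶ tN ⟶ tN) :=
  crec M tN $ (eval (econs predE enil) (lam (lam (v2 · v0)))).
Lemma mn_sub0 x : subE $ x $ 0 = x.
Proof. exact: mn_rec0. Qed.
Lemma mn_subS x y : subE $ x $ (y + 1) = predE $ (subE $ x $ y).
Proof. by rewrite /subE mn_recS !lamE. Qed.
Local Opaque subE.

Lemma mn_predP x : x = 0 \/ x = predE $ x + 1.
Proof.
suff h : sat (econs x (econs predE enil)) (v0 ≐ Zero ⊔ v0 ≐ (v1 · v0) ⊕ One) by exact: h.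
move: x; apply: sat_ind => //=; first by left.
by move=> n _; right; rewrite -!/(madd _ _) mn_predS.
Qed.

Lemma mn_subK x y : y <= x -> y + subE $ x $ y = x.
Proof.
move/mn_nltP.
suff h : sat (econs y (econs x (econs subE enil))) (¬ (v1 ≺ v0) ⊃ v0 ⊕ (v2 · v1 · v0) ≐ v1) by exact: h.
move: y; apply: sat_ind => //=; rewrite -/(madd _ _).
  by rewrite mn_sub0 mn_addC mn_add0.
move=> n; rewrite -!/(madd _ _) => h hn.
have {h} e : n + subE $ x $ n = x by apply: h => h; apply: hn; apply: mn_ltT h (mn_ltS _).
rewrite mn_subS; case: (mn_predP (subE $ x $ n)) => e'.
  by case: hn; rewrite -{1}e e' mn_add0; apply: mn_ltS.
by rewrite -[RHS]e {2}e'; semiring.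
Qed.

Lemma mn_ltS_le x y : x < y + 1 -> x <= y.
Proof.
move=> h; apply/mn_nltP => h'; have e := mn_subK (or_introl h').
case: (mn_predP (subE $ x $ y)) => e'; first by move: h'; rewrite -e e' mn_add0 => /mn_ltI.
rewrite e' in e; have := mn_le_add (y + 1) (mn_ge0 (predE $ (subE $ x $ y))).
have -> : predE $ (subE $ x $ y) + (y + 1) = x by rewrite -[RHS]e; semiring.
by rewrite mn_addC mn_add0 => /(mn_lt_leF h).
Qed.

Lemma mn_subE0 x y : subE $ x $ y = 0 <-> x <= y.
Proof.
split=> [e|].
  by apply/mn_nltP => h; have := mn_subK (or_introl h); rewrite e mn_add0 => h'; move: h; rewrite h' => /mn_ltI.
move/mn_nltP.
suff h : sat (econs y (econs x (econs subE enil))) (¬ (v0 ≺ v1) ⊃ (v2 · v1 · v0) ≐ Zero) by exact: h.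
move: y; apply: sat_ind => //=.
  move/mn_nltP; rewrite mn_sub0 => -[h|//]; case: (mn_lt_leF h (mn_ge0 _)).
move=> n; rewrite -!/(madd _ _) mn_subS => h /mn_nltP[/mn_ltS_le /mn_nltP /h ->|e]; first exact: mn_pred0.
have h' : n <= x by rewrite e; left; apply: mn_ltS.
have e' := mn_subK h'; have e1 : subE $ x $ n = 0 + 1.
  by apply: (@mn_addI n); rewrite mn_addC e' e; semiring.
by rewrite e1 mn_predS.
Qed.

Definition definable t (f : N -> M t) := exists e : M (tN ⟶ t), forall n, e $ n = f n.

Lemma def_id : definable id.
Proof. by exists (csigma M _ (tN ⟶ tN) _ $ (cpi M _ _) $ (cpi M _ _)) => n; rewrite appS appK. Qed.

Lemma def_const t (c : M t) : definable (fun _ => c).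
Proof. by exists (cpi M _ _ $ c) => n; rewrite appK. Qed.

Lemma def_app s t (f : N -> M (s ⟶ t)) (g : N -> M s) :
  definable f -> definable g -> definable (fun n => f n $ g n).
Proof.
move=> [e he] [e' he']; exists (csigma M _ _ _ $ e $ e') => n.
by rewrite appS he he'.
Qed.

Lemma def_add (f g : N -> N) : definable (t := tN) f -> definable (t := tN) g -> definable (t := tN) (fun n => f n + g n).
Proof. by move=> hf hg; apply: (def_app (def_app (def_const _) hf) hg). Qed.

Lemma def_mul (f g : N -> N) : definable (t := tN) f -> definable (t := tN) g -> definable (t := tN) (fun n => f n * g n).
Proof. by move=> hf hg; apply: (def_app (def_app (def_const _) hf) hg). Qed.

(** The predicates to which the quantifier-free induction of the model applies, by way of [mind]:
    the test has to be an element of the model. Parameters from the model are allowed. *)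
Definition decidable (P : N -> Prop) :=
  exists2 f, @definable tN f & forall n, P n <-> f n = 0.

Lemma mn_sum0 x y : x + y = 0 <-> x = 0 /\ y = 0.
Proof.
split=> [e|[-> ->]]; last exact: mn_add0.
have h : x <= 0.
  have := mn_le_add x (mn_ge0 y); rewrite (mn_addC y) e.
  by rewrite mn_addC mn_add0.
have -> : x = 0 by case: h => // h; case: (mn_lt_leF h (mn_ge0 _)).
split=> //; have h' : y <= 0.
  have := mn_le_add y (mn_ge0 x); rewrite e.
  by rewrite mn_addC mn_add0.
by case: h' => // h'; case: (mn_lt_leF h' (mn_ge0 _)).
Qed.

Lemma mn_prod0 x y : x * y = 0 <-> x = 0 \/ y = 0.
Proof.
split=> [e|[->|->]]; last 2 first.
- by rewrite mn_mulC mn_mul0.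
- exact: mn_mul0.
case: (mn_ge0 y) => [h|<-]; last by right.
left; apply: (mn_mulI h); rewrite e; semiring.
Qed.

Lemma decid_iff P Q : (forall n, P n <-> Q n) -> decidable P -> decidable Q.
Proof. by move=> h [f hf e]; exists f => // n; rewrite -h. Qed.

Lemma decid_and P Q : decidable P -> decidable Q -> decidable (fun n => P n /\ Q n).
Proof.
move=> [f hf ef] [g hg eg]; exists (fun n => f n + g n); first exact: def_add.
by move=> n; rewrite mn_sum0 ef eg.
Qed.

Lemma decid_or P Q : decidable P -> decidable Q -> decidable (fun n => P n \/ Q n).
Proof.
move=> [f hf ef] [g hg eg]; exists (fun n => f n * g n); first exact: def_mul.
by move=> n; rewrite mn_prod0 ef eg.
Qed.

Lemma decid_not P : decidable P -> decidable (fun n => ~ P n).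
Proof.
move=> [f hf ef]; exists (fun n => subE $ 1 $ (f n)).
  by apply: def_app => //; apply: def_const.
move=> n; rewrite mn_subE0 ef; split=> [h|h e]; last first.
  by move: h; rewrite e => -[|e']; [apply: (fun h => mn_lt_leF mn_lt01 (or_introl h))|move: mn_lt01; rewrite e' => /mn_ltI].
case: (mn_predP (f n)) => // ->; have := mn_le_add 1 (mn_ge0 (predE $ f n)).
by rewrite mn_addC mn_add0.
Qed.

Lemma decid_imp P Q : decidable P -> decidable Q -> decidable (fun n => P n -> Q n).
Proof.
move=> hP hQ; apply: (decid_iff _ (decid_or (decid_not hP) hQ)) => n.
by split=> [[h /h //|//]|h]; case: (classic (P n)) => hp; [right; apply: h|left].
Qed.

(** A side condition without the induction variable, however complex, has a constant test by
    excluded middle in the metatheory. *)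
Lemma decid_prop (P : Prop) : decidable (fun _ => P).
Proof.
case: (classic P) => h; [exists (fun _ => 0)|exists (fun _ => 1)]; try exact: def_const.
  by split.
by split=> // e; move: mn_lt01; rewrite e => /mn_ltI.
Qed.

Lemma decid_le (f g : N -> N) : definable (t := tN) f -> definable (t := tN) g -> decidable (fun n => f n <= g n).
Proof.
move=> hf hg; exists (fun n => subE $ (f n) $ (g n)); last by move=> n; rewrite mn_subE0.
exact: (def_app (def_app (def_const _) hf) hg).
Qed.

Lemma mn_le_anti x y : x <= y -> y <= x -> x = y.
Proof. by move=> [h h'|//]; case: (mn_lt_leF h h'). Qed.

Lemma decid_eq (f g : N -> N) : definable (t := tN) f -> definable (t := tN) g -> decidable (fun n => f n = g n).
Proof.
move=> hf hg; apply: (decid_iff _ (decid_and (decid_le hf hg) (decid_le hg hf))) => n.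
by split=> [[]|->]; [apply: mn_le_anti|split; right].
Qed.

Lemma decid_lt (f g : N -> N) : definable (t := tN) f -> definable (t := tN) g -> decidable (fun n => f n < g n).
Proof.
move=> hf hg; apply: (decid_iff _ (decid_not (decid_le hg hf))) => n.
by rewrite -mn_nltP; split=> [/NNPP|h].
Qed.

Lemma mind P : decidable P -> P 0 -> (forall n, P n -> P (n + 1)) -> forall n, P n.
Proof.
move=> [f [e he] ef] h0 hS n; apply/ef; rewrite -he.
suff h : sat (econs n (econs e enil)) (v1 · v0 ≐ Zero) by exact: h.
move: n; apply: sat_ind => //=; first by rewrite he; apply/ef.
by move=> n; rewrite !he -!ef -/(madd _ _); apply: hS.
Qed.

End Model.

Ltac definable := repeat first
  [ exact: def_const | exact: def_id | apply: def_add | apply: def_mul | apply: def_app ].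
Ltac decid := repeat first
  [ exact: decid_prop | apply: decid_and | apply: decid_or | apply: decid_not
  | apply: decid_imp | apply: decid_eq; definable | apply: decid_lt; definable
  | apply: decid_le; definable ].

(** * The ordered field of fractions of a model *)

Section Fractions.
Variable M : rca_model.
Local Open Scope mn_scope.
Notation N := (M tN).
Implicit Types x y z : N.
Add Ring Nring : (semi_ring M).

Lemma mn_lt_addI z x y : x + z < y + z -> x < y.
Proof.
move=> h; case: (mn_lt_total x y) => [[//|e]|/(mn_lt_add z) h'].
  by move: h; rewrite e => /mn_ltI.
by case: (mn_ltI (mn_ltT h h')).
Qed.

Lemma mn_lt_mulI z x y : 0 < z -> x * z < y * z -> x < y.
Proof.
move=> p h; case: (mn_lt_total x y) => [[//|e]|/(mn_lt_mul p) h'].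
  by move: h; rewrite e => /mn_ltI.
by case: (mn_ltI (mn_ltT h h')).
Qed.

Lemma mn_gt0S x : 0 < x + 1.
Proof. exact: mn_le_lt_trans (mn_ge0 x) (mn_ltS x). Qed.

(** [(p, m, d)] stands for [(p - m) / (d + 1)]. *)
Definition triple : Type := N * N * N.
Implicit Types a b c : triple.

Definition teq a b :=
  let: (p, m, d) := a in let: (q, n, e) := b in
  p * (e + 1) + n * (d + 1) = q * (d + 1) + m * (e + 1).

(** The third component is [(d + 1) (e + 1) - 1], because denominators are stored minus one. *)
Definition tadd a b : triple :=
  let: (p, m, d) := a in let: (q, n, e) := b in
  (p * (e + 1) + q * (d + 1), m * (e + 1) + n * (d + 1), d * e + d + e).
Definition tmul a b : triple :=
  let: (p, m, d) := a in let: (q, n, e) := b in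
  (p * q + m * n, p * n + m * q, d * e + d + e).
Definition topp a : triple := let: (p, m, d) := a in (m, p, d).
Definition tpos a : Prop := let: (p, m, d) := a in m < p.

Lemma teq_refl a : teq a a.
Proof. by case: a => -[p m] d /=. Qed.
Lemma teq_sym a b : teq a b -> teq b a.
Proof. by case: a b => -[p m] d [[q n] e] /= ->. Qed.

Lemma teq_trans a b c : teq a b -> teq b c -> teq a c.
Proof.
case: a b c => -[p m] d [[q n] e] [[r o] f] /= h1 h2.
apply: (mn_mulI (mn_gt0S e)); apply: (@mn_addI _ (n * (d + 1) * (f + 1) + q * (d + 1) * (f + 1))).
transitivity ((p * (e + 1) + n * (d + 1)) * (f + 1) + (q * (f + 1) + o * (e + 1)) * (d + 1)).
  by semiring.
by rewrite h1 h2; semiring.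
Qed.

Lemma tadd_congr a a' b b' : teq a a' -> teq b b' -> teq (tadd a b) (tadd a' b').
Proof.
case: a a' b b' => -[p m] d [[p' m'] d'] [[q n] e] [[q' n'] e'] /= h1 h2.
transitivity ((p * (d' + 1) + m' * (d + 1)) * ((e + 1) * (e' + 1)) +
              (q * (e' + 1) + n' * (e + 1)) * ((d + 1) * (d' + 1))).
  by semiring.
by rewrite h1 h2; semiring.
Qed.

Lemma tmulC a b : tmul a b = tmul b a.
Proof. by case: a b => -[p m] d [[q n] e] /=; congr (_, _, _); semiring. Qed.

Lemma tmul_congl a a' b : teq a a' -> teq (tmul a b) (tmul a' b).
Proof.
case: a a' b => -[p m] d [[p' m'] d'] [[q n] e] /= h.
transitivity ((e + 1) * (q * (p * (d' + 1) + m' * (d + 1)) +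
     n * (p' * (d + 1) + m * (d' + 1)))); first by semiring.
transitivity ((e + 1) * (q * (p' * (d + 1) + m * (d' + 1)) +
     n * (p * (d' + 1) + m' * (d + 1)))); first by rewrite !h.
by semiring.
Qed.

Lemma tpos_congr a b : teq a b -> tpos a -> tpos b.
Proof.
case: a b => -[p m] d [[q n] e] /= h lt; apply: (mn_lt_mulI (mn_gt0S d)).
apply: (@mn_lt_addI (m * (e + 1))); rewrite -h mn_addC; apply: mn_lt_add; apply: mn_lt_mul lt.
exact: mn_gt0S.
Qed.

(** The numbers of the model may be nonstandard, so the rationals of the metatheory do not apply.
    Once [K] is an ordered field, inequalities between coded rationals are settled by [lra]. *)
Definition K : Type := classes teq.
Definition frac p m d : K := cls teq (p, m, d).
Local Notation cl := (cls teq).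

Lemma cl_eq a b : cl a = cl b <-> teq a b.
Proof. by apply: cls_eq; [exact: teq_refl|exact: teq_sym|exact: teq_trans]. Qed.

Lemma KP (x : K) : exists p m d, x = frac p m d.
Proof. by rewrite -(repK x); case: (rep x) => -[p m] d; exists p, m, d. Qed.

Lemma rep_cl a : teq (rep (cl a)) a.
Proof. by apply/cl_eq; rewrite repK. Qed.

Definition kadd (x y : K) : K := cl (tadd (rep x) (rep y)).
Definition kmul (x y : K) : K := cl (tmul (rep x) (rep y)).
Definition kopp (x : K) : K := cl (topp (rep x)).
Definition kpos (x : K) : Prop := tpos (rep x).

Lemma kaddE a b : kadd (cl a) (cl b) = cl (tadd a b).
Proof. by apply/cl_eq; apply: tadd_congr; apply: rep_cl. Qed.
Lemma kmulE a b : kmul (cl a) (cl b) = cl (tmul a b).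
Proof.
apply/cl_eq; apply: teq_trans (tmul_congl _ (rep_cl _)) _.
rewrite tmulC [tmul a b]tmulC; exact: tmul_congl (rep_cl _).
Qed.
Lemma koppE a : kopp (cl a) = cl (topp a).
Proof.
apply/cl_eq; move: (rep_cl a); case: (rep _) => -[p m] d; case: a => -[q n] e /= h.
by rewrite mn_addC -h mn_addC.
Qed.
Lemma kposE a : kpos (cl a) <-> tpos a.
Proof.
by split; apply: tpos_congr; [apply: rep_cl|apply: teq_sym; apply: rep_cl].
Qed.

Definition kzero : K := frac 0 0 0.
Definition kone : K := frac 1 0 0.

Lemma kaddA : associative kadd.
Proof. by move=> x y z; move: x y z => /KP[? [? [? ->]]] /KP[? [? [? ->]]] /KP[? [? [? ->]]];
  rewrite /frac !kaddE; apply/cl_eq => /=; semiring. Qed.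
Lemma kaddC : commutative kadd.
Proof. by move=> x y; move: x y => /KP[? [? [? ->]]] /KP[? [? [? ->]]];
  rewrite /frac !kaddE; apply/cl_eq => /=; semiring. Qed.
Lemma kadd0 : left_id kzero kadd.
Proof. by move=> x; move: x => /KP[? [? [? ->]]];
  rewrite /kzero /frac !kaddE; apply/cl_eq => /=; semiring. Qed.
Lemma kaddN : left_inverse kzero kopp kadd.
Proof. by move=> x; move: x => /KP[? [? [? ->]]];
  rewrite /kzero /frac koppE !kaddE; apply/cl_eq => /=; semiring. Qed.
Lemma kmulA : associative kmul.
Proof. by move=> x y z; move: x y z => /KP[? [? [? ->]]] /KP[? [? [? ->]]] /KP[? [? [? ->]]];
  rewrite /frac !kmulE; apply/cl_eq => /=; semiring. Qed.
Lemma kmulC : commutative kmul.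
Proof. by move=> x y; move: x y => /KP[? [? [? ->]]] /KP[? [? [? ->]]];
  rewrite /frac !kmulE tmulC. Qed.
Lemma kmul1 : left_id kone kmul.
Proof. by move=> x; move: x => /KP[? [? [? ->]]];
  rewrite /kone /frac !kmulE; apply/cl_eq => /=; semiring. Qed.
Lemma kmulD : left_distributive kmul kadd.
Proof. by move=> x y z; move: x y z => /KP[? [? [? ->]]] /KP[? [? [? ->]]] /KP[? [? [? ->]]];
  rewrite /frac !(kmulE, kaddE); apply/cl_eq => /=; semiring. Qed.
Lemma kone_neq0 : kone <> kzero.
Proof.
move/cl_eq => /= h; have e : (1 : N) = 0.
  by transitivity (1 * (0 + 1) + 0 * (0 + 1) : N); [semiring|rewrite h; semiring].
by move: (mn_lt01 M); rewrite e => /mn_ltI.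
Qed.

HB.instance Definition _ := gen_eqMixin K.
HB.instance Definition _ := gen_choiceMixin K.
HB.instance Definition _ := GRing.isZmodule.Build K kaddA kaddC kadd0 kaddN.
Lemma kone_neq0b : kone != 0%R.
Proof. exact/eqP/kone_neq0. Qed.
HB.instance Definition _ := GRing.Zmodule_isComNzRing.Build K kmulA kmulC kmul1 kmulD kone_neq0b.

Definition kinv (x : K) : K :=
  if pselect (x <> 0%R /\ exists y : K, kmul y x = kone) is left h
  then proj1_sig (cid (proj2 h)) else 0%R.

Lemma kinv_ex (x : K) : x <> 0%R -> exists y : K, kmul y x = kone.
Proof.
move: x => /KP[p [m [d ->]]] nz.
have [[lt|e]|lt] := mn_lt_total p m.
- have le := mn_subK (or_introl lt); set k := subE M $ m $ p in le.
  have pk : 0 < k by case: (mn_ge0 k) => // e; move: lt; rewrite -le -e mn_add0 => /mn_ltI.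
  case: (mn_predP k) => e; first by move: pk; rewrite e => /mn_ltI.
  (* Here the fraction is [- k / (d + 1)] with [k] positive, so the inverse is [- (d + 1) / k],
     whose denominator is stored as the predecessor of [k]. *)
  exists (frac 0 (d + 1) (predE M $ k)); rewrite kmulE; apply/cl_eq => /=.
  set j := _ $ k in e *; rewrite -le e; semiring.
- by case: nz; apply/cl_eq; rewrite e /=; semiring.
- have le := mn_subK (or_introl lt); set k := subE M $ p $ m in le.
  have pk : 0 < k by case: (mn_ge0 k) => // e; move: lt; rewrite -le -e mn_add0 => /mn_ltI.
  case: (mn_predP k) => e; first by move: pk; rewrite e => /mn_ltI.
  exists (frac (d + 1) 0 (predE M $ k)); rewrite kmulE; apply/cl_eq => /=.
  set j := _ $ k in e *; rewrite -le e; semiring.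
Qed.

Lemma kmulV (x : K) : x != 0%R -> (kinv x * x = 1)%R.
Proof.
move/eqP => nz; rewrite /kinv; case: pselect => [h|[]].
  by case: cid.
by split=> //; apply: kinv_ex.
Qed.
Lemma kinv0 : kinv 0%R = 0%R.
Proof. by rewrite /kinv; case: pselect => // -[]. Qed.

HB.instance Definition _ := GRing.ComNzRing_isField.Build K kmulV kinv0.

Local Open Scope ring_scope.
Definition klt (x y : K) : bool := `[< kpos (y - x) >].
Definition kle (x y : K) : bool := (x == y) || klt x y.
Definition knorm (x : K) : K := if klt x 0 then - x else x.

Lemma kposP (x : K) : klt 0 x = `[< kpos x >].
Proof. by rewrite /klt subr0. Qed.

Lemma kpos_add (x y : K) : klt 0 x -> klt 0 y -> klt 0 (x + y).
Proof.
rewrite !kposP => /asboolP h /asboolP h'; apply/asboolP; move: h h'.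
move: x y => /KP[p [m [d ->]]] /KP[q [n [e ->]]].
have -> : (frac p m d : K) + (frac q n e : K) = (cl (tadd (p, m, d) (q, n, e)) : K) by exact: kaddE.
rewrite !kposE => /= h h'.
have {h} h := mn_lt_mul (mn_gt0S e) h; have {h'} h' := mn_lt_mul (mn_gt0S d) h'.
apply: mn_ltT (mn_lt_add _ h) _.
by rewrite mn_addC [X in mlt _ X]mn_addC; apply: mn_lt_add.
Qed.

Lemma kpos_mul (x y : K) : klt 0 x -> klt 0 y -> klt 0 (x * y).
Proof.
rewrite !kposP => /asboolP h /asboolP h'; apply/asboolP; move: h h'.
move: x y => /KP[p [m [d ->]]] /KP[q [n [e ->]]].
have -> : (frac p m d : K) * (frac q n e : K) = (cl (tmul (p, m, d) (q, n, e)) : K) by exact: kmulE.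
rewrite !kposE => /= h h'.
have e1 := mn_subK (or_introl h); have e2 := mn_subK (or_introl h').
set k := app _ m in e1; set l := app _ n in e2.
have pk : mlt 0%mn k.
  by case: (mn_ge0 k) => // ek; move: h; rewrite -e1 -ek mn_add0 => /mn_ltI.
have pl : mlt 0%mn l.
  by case: (mn_ge0 l) => // ek; move: h'; rewrite -e2 -ek mn_add0 => /mn_ltI.
rewrite -e1 -e2.
have := mn_lt_add (madd (mmul (madd m k) n) (mmul m (madd n l))) (mn_lt_mul pl pk).
have -> : madd (mmul 0%mn l) (madd (mmul (madd m k) n) (mmul m (madd n l))) =
   madd (mmul (madd m k) n) (mmul m (madd n l)) by semiring.
have -> : madd (mmul k l) (madd (mmul (madd m k) n) (mmul m (madd n l))) =
   madd (mmul (madd m k) (madd n l)) (mmul m n) by semiring.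
by [].
Qed.

Lemma klt_anti (x : K) : klt 0 x -> ~~ klt x 0.
Proof.
move=> h; apply/negP => h'.
have {}h' : klt 0 (- x) by move: h'; rewrite /klt subr0 sub0r.
have := kpos_add h h'; rewrite subrr kposP => /asboolP.
by rewrite kposE /= => /mn_ltI.
Qed.

Lemma klt_sub (x y : K) : klt 0 (y - x) = klt x y.
Proof. by rewrite /klt subr0. Qed.

Lemma klt_total (x : K) : x != 0 -> klt 0 x || klt x 0.
Proof.
move/eqP => nz; rewrite /klt subr0 sub0r; move: nz; move: x => /KP[p [m [d ->]]] nz.
have -> : - (frac p m d : K) = (frac m p d : K) by exact: koppE.
have [[lt|e]|lt] := mn_lt_total p m.
- by apply/orP; right; apply/asboolP/kposE.
- by case: nz; apply/cl_eq; rewrite e /=; semiring.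
- by apply/orP; left; apply/asboolP/kposE.
Qed.

Lemma knormN (x : K) : knorm (- x) = knorm x.
Proof.
rewrite /knorm opprK; case: (eqVneq x 0) => [->|nz]; first by rewrite oppr0.
have e : klt (- x) 0 = klt 0 x by rewrite /klt sub0r opprK subr0.
rewrite e; case: ifP => h; first by rewrite (negbTE (klt_anti h)).
by have := klt_total nz; rewrite h /= => ->.
Qed.

Lemma kge0_norm (x : K) : kle 0 x -> knorm x = x.
Proof.
rewrite /kle /knorm => /orP[/eqP <-|h]; first by case: ifP; rewrite ?oppr0.
by rewrite (negbTE (klt_anti h)).
Qed.

HB.instance Definition _ := Num.IntegralDomain_isLtReal.Build K
  kpos_add kpos_mul klt_anti klt_sub klt_total knormN kge0_norm (fun _ _ => erefl).

End Fractions.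

(** * Case distinction, subtraction and unpairing as terms *)

Definition pred_ G (n : tm G tN) : tm G tN := Rec · lam (lam v1) · Zero · n.
Definition sub_ G (x y : tm G tN) : tm G tN := Rec · lam (lam (pred_ v0)) · x · y.
Definition ifz G (c x y : tm G tN) : tm G tN := Rec · lam (lam (wk (wk y))) · x · c.
(** The diagonal of the pair coded by [n]. *)
Definition row_ G (n : tm G tN) : tm G tN :=
  Rec · lam (lam (ifz (sub_ (tri (v0 ⊕ One)) (v1 ⊕ One)) (v0 ⊕ One) v0)) · Zero · n.
Definition snd_ G (q : tm G tN) : tm G tN := sub_ q (tri (row_ q)).
Definition fst_ G (q : tm G tN) : tm G tN := sub_ (row_ q) (snd_ q).

Section Arith.
Variable M : rca_model.
Notation N := (M tN).
Implicit Types x y z n m p q d : N.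
Local Open Scope ring_scope.
Local Open Scope mn_scope.
Add Ring Nring : (semi_ring M).
Local Opaque lam.

Definition iota x : K M := frac x 0 0.

Lemma iota0 : iota 0 = 0%R. Proof. by []. Qed.
Lemma iota1 : iota 1 = 1%R. Proof. by []. Qed.
Lemma iotaD x y : iota (x + y) = (iota x + iota y)%R.
Proof. by rewrite [RHS](kaddE (x, _, _) (y, _, _)); apply/cl_eq => /=; semiring. Qed.
Lemma iotaM x y : iota (x * y) = (iota x * iota y)%R.
Proof. by rewrite [RHS](kmulE (x, _, _) (y, _, _)); apply/cl_eq => /=; semiring. Qed.

Lemma iota_lt x y : x < y <-> (iota x < iota y)%R.
Proof.
have -> : (iota x < iota y)%R = `[< kpos (iota y - iota x)%R >] by [].
have -> : (iota y - iota x)%R = frac y x 0.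
  have -> : (- iota x)%R = frac 0 x 0 by exact: koppE.
  by rewrite [LHS](kaddE (y, _, _) (0, x, _)); apply/cl_eq => /=; semiring.
by split=> [h|/asboolP/kposE //]; apply/asboolP/kposE.
Qed.

Lemma iota_inj : injective iota.
Proof.
move=> x y e; case: (mn_lt_total x y) => [[|//]|] /iota_lt; by rewrite e ltxx.
Qed.

Lemma iota_eq x y : x = y <-> iota x = iota y.
Proof. by split=> [->//|/iota_inj]. Qed.

Definition iotaE := (iota0, iota1, iotaD, iotaM).

Lemma iota_le x y : x <= y <-> (iota x <= iota y)%R.
Proof.
split=> [[/iota_lt/ltW //|->]|]; first exact: lexx.
by rewrite le_eqVlt => /orP[/eqP/iota_inj ->|/iota_lt]; [right|left].
Qed.

Lemma iota_ge0 x : (0 <= iota x)%R.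
Proof. exact/(iota_le 0)/mn_ge0. Qed.

(** The integrality of the numbers, which [lra] cannot see in the field, is supplied through this
    step. *)
Lemma iota_discrete x y : (iota x < iota y)%R -> (iota x + 1 <= iota y)%R.
Proof.
move/iota_lt => h; rewrite -iota1 -iotaD -iota_le; apply: mn_ltS_le.
by apply: mn_lt_add.
Qed.

Lemma fracE p m d : frac p m d = ((iota p - iota m) / (iota d + 1))%R.
Proof.
have h : (iota d + 1 != 0)%R by have := iota_ge0 d; lra.
apply: (mulIf h); rewrite mulfVK //.
have -> : (iota p - iota m)%R = frac p m 0.
  have -> : (- iota m)%R = frac 0 m 0 by exact: koppE.
  by rewrite [LHS](kaddE (p, _, _) (0, m, _)); apply/cl_eq => /=; semiring.
rewrite -iota1 -iotaD [LHS](kmulE (p, _, _) (_, _, _)); apply/cl_eq => /=; semiring.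
Qed.

Lemma sub_def x y : y <= x -> iota (subE M $ x $ y) = (iota x - iota y)%R.
Proof. by move/mn_subK/iota_eq; rewrite iotaD => <-; ring. Qed.

Lemma evalA G (r : env M G) s t : eval r (s ⊕ t) = eval r s + eval r t.
Proof. by []. Qed.
Lemma evalM G (r : env M G) s t : eval r (s ⊗ t) = eval r s * eval r t.
Proof. by []. Qed.
Lemma eval_app G (r : env M G) s t (f : tm G (s ⟶ t)) (u : tm G s) : eval r (f · u) = eval r f $ (eval r u).
Proof. by []. Qed.

Lemma mext2 s t u (f g : M (s ⟶ t ⟶ u)) : (forall a b, f $ a $ b = g $ a $ b) -> f = g.
Proof. by move=> h; apply: (mext (r := M)) => a; apply: (mext (r := M)) => b. Qed.

Lemma eval_rec G (r : env M G) (f g : tm _ tN) t :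
  eval r (Rec · lam (lam f) · g · t) =
  crec M tN $ (eval r (lam (lam f))) $ (eval r g) $ (eval r t).
Proof. by []. Qed.

Lemma eval_pred G (r : env M G) t : eval r (pred_ t) = predE M $ (eval r t).
Proof.
by rewrite eval_rec; congr (app (app (app _ _) _) _); apply: mext2 => a b; rewrite !lamE.
Qed.

Lemma eval_sub G (r : env M G) s t : eval r (sub_ s t) = subE M $ (eval r s) $ (eval r t).
Proof.
by rewrite eval_rec; congr (app (app (app _ _) _) _); apply: mext2 => a b; rewrite !lamE ?eval_pred.
Qed.

Definition mif (c x y : N) : N := if pselect (c = 0) then x else y.

Lemma eval_ifz G (r : env M G) c s t : eval r (ifz c s t) = mif (eval r c) (eval r s) (eval r t).
Proof.
rewrite /ifz /mif eval_rec; case: pselect => [e|nz] /=.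
  by rewrite e mn_rec0.
by case: (mn_predP (eval r c)) => // ->; rewrite mn_recS !lamE !eval_wk.
Qed.

Definition triE : M t1 := crec M tN $ (eval enil (lam (lam (v0 ⊕ (v1 ⊕ One))))) $ 0.
Definition expE : M t1 := crec M tN $ (eval enil (lam (lam (v0 ⊕ v0)))) $ 1.
Lemma tri0 : triE $ 0 = 0. Proof. exact: mn_rec0. Qed.
Lemma triS n : triE $ (n + 1) = triE $ n + (n + 1).
Proof. by rewrite /triE mn_recS !lamE. Qed.
Lemma exp0 : expE $ 0 = 1. Proof. exact: mn_rec0. Qed.
Lemma expS n : expE $ (n + 1) = expE $ n + expE $ n.
Proof. by rewrite /expE mn_recS !lamE. Qed.

Lemma eval_tri G (r : env M G) t : eval r (tri t) = triE $ (eval r t).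
Proof.
by rewrite eval_rec; congr (app (app (app _ _) _) _); apply: mext2 => a b; rewrite !lamE.
Qed.
Lemma eval_exp2 G (r : env M G) t : eval r (exp2 t) = expE $ (eval r t).
Proof.
by rewrite eval_rec; congr (app (app (app _ _) _) _); apply: mext2 => a b; rewrite !lamE.
Qed.

Definition rowE : M t1 := crec M tN $ (eval enil
  (lam (lam (ifz (sub_ (tri (v0 ⊕ One)) (v1 ⊕ One)) (v0 ⊕ One) v0)))) $ 0.
Lemma row0 : rowE $ 0 = 0. Proof. exact: mn_rec0. Qed.
Lemma rowS n : rowE $ (n + 1) =
  mif (subE M $ (triE $ (rowE $ n + 1)) $ (n + 1)) (rowE $ n + 1) (rowE $ n).
Proof. by rewrite /rowE mn_recS !lamE eval_ifz eval_sub eval_tri. Qed.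
Lemma eval_row G (r : env M G) t : eval r (row_ t) = rowE $ (eval r t).
Proof.
by rewrite eval_rec; congr (app (app (app _ _) _) _); apply: mext2 => a b; rewrite !lamE ?eval_ifz ?eval_sub ?eval_tri.
Qed.
Local Opaque triE expE rowE.

Definition sndN q := subE M $ q $ (triE $ (rowE $ q)).
Definition fstN q := subE M $ (rowE $ q) $ (sndN q).
Definition cp x y := triE $ (x + y) + y.

Lemma eval_snd G (r : env M G) t : eval r (snd_ t) = sndN (eval r t).
Proof. by rewrite eval_sub eval_tri eval_row. Qed.
Lemma eval_fst G (r : env M G) t : eval r (fst_ t) = fstN (eval r t).
Proof. by rewrite eval_sub eval_row eval_snd. Qed.
Lemma eval_cpair G (r : env M G) s t : eval r (cpair s t) = cp (eval r s) (eval r t).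
Proof. by rewrite /cpair evalA eval_tri. Qed.

Lemma row_spec q : triE $ (rowE $ q) <= q /\ q < triE $ (rowE $ q + 1).
Proof.
move: q; apply: mind; first by decid.
  by rewrite row0 tri0 triS tri0; split; [right|apply/iota_lt; rewrite !iotaE; lra].
move=> n [h1 h2]; rewrite rowS /mif; set r := rowE $ n in h1 h2 *.
case: pselect => e /=.
  have h := (mn_subE0 _ _).1 e; split=> //; rewrite !triS; move: h1 h2 h; rewrite !triS !(iota_lt, iota_le) !iotaE => h1 h2 h.
  by have := iota_ge0 r; lra.
by split; [apply: mn_le_trans h1 _; left; apply: mn_ltS|apply: NNPP => /mn_nltP/mn_subE0/e].
Qed.

Lemma tri_mono x y : x < y -> triE $ (x + 1) <= triE $ y.
Proof.
move: y; apply: mind; first by decid.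
  by move/iota_lt; rewrite iota0; have := iota_ge0 x; lra.
move=> y IH /mn_ltS_le [/IH h|->]; last by right.
apply: mn_le_trans h _; apply/iota_le; rewrite !triS !iotaE.
have := iota_ge0 y; lra.
Qed.

Lemma cp_row x y : rowE $ (cp x y) = x + y.
Proof.
have [h1 h2] := row_spec (cp x y); set r := rowE $ _ in h1 h2 *.
case: (mn_lt_total r (x + y)) => [[h|//]|h]; exfalso.
  have := tri_mono h; move: h2; rewrite /cp !(iota_lt, iota_le) !iotaE.
  by have := iota_ge0 y; lra.
have := tri_mono h; move: h1; rewrite /cp triS !(iota_lt, iota_le) !iotaE.
by have := iota_ge0 x; lra.
Qed.

Lemma sndK x y : sndN (cp x y) = y.
Proof.
rewrite /sndN cp_row; apply: iota_inj; rewrite sub_def /cp ?iotaE; first by ring.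
by apply/iota_le; rewrite iotaE; have := iota_ge0 y; lra.
Qed.

Lemma fstK x y : fstN (cp x y) = x.
Proof.
rewrite /fstN cp_row sndK; apply: iota_inj; rewrite sub_def ?iotaE; first by ring.
by apply/iota_le; rewrite iotaE; have := iota_ge0 x; lra.
Qed.

Lemma cpK q : cp (fstN q) (sndN q) = q.
Proof.
have [h1 h2] := row_spec q; rewrite /cp.
have e1 : iota (sndN q) = (iota q - iota (triE $ (rowE $ q)))%R by rewrite sub_def.
have h3 : sndN q <= rowE $ q.
  by apply/iota_le; rewrite e1; have /iota_lt/iota_discrete := h2; rewrite triS !iotaE; lra.
have e2 : fstN q + sndN q = rowE $ q by rewrite mn_addC; apply: mn_subK.
by rewrite e2; apply: iota_inj; rewrite iotaD e1; ring.
Qed.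
End Arith.

(** * Reals in a model *)

Section QTerms.
Variable G : ctx.
Implicit Types x y n : tm G tN.
Definition qp x := fst_ (fst_ x).
Definition qm x := snd_ (fst_ x).
Definition qd x := snd_ x.
Definition qadd x y := codeQ
  (qp x ⊗ (qd y ⊕ One) ⊕ qp y ⊗ (qd x ⊕ One))
  (qm x ⊗ (qd y ⊕ One) ⊕ qm y ⊗ (qd x ⊕ One)) (qd x ⊗ qd y ⊕ qd x ⊕ qd y).
Definition qopp x := codeQ (qm x) (qp x) (qd x).
Definition qhalf x := codeQ (qp x) (qm x) (qd x ⊕ qd x ⊕ One).
(** Zero if and only if [x <= y]. *)
Definition qle x y := sub_
  (qp x ⊗ (qd y ⊕ One) ⊕ qm y ⊗ (qd x ⊕ One))
  (qp y ⊗ (qd x ⊕ One) ⊕ qm x ⊗ (qd y ⊕ One)).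
Definition qmax x y := ifz (qle x y) y x.
Definition qmin x y := ifz (qle x y) x y.
Definition qeps n := codeQ One Zero (pred_ (exp2 n)).
End QTerms.

Section FracField.
Variable F : realFieldType.
Implicit Types p m d q n e c : F.
Local Open Scope ring_scope.
Lemma frac_add p m d q n e : d + 1 != 0 -> e + 1 != 0 ->
  (p * (e + 1) + q * (d + 1) - (m * (e + 1) + n * (d + 1))) / (d * e + d + e + 1) =
  (p - m) / (d + 1) + (q - n) / (e + 1).
Proof.
move=> hd he; have -> : d * e + d + e + 1 = (d + 1) * (e + 1) by ring.
by field; rewrite he hd.
Qed.
Lemma frac_half p m d : d + 1 != 0 -> (p - m) / (d + d + 1 + 1) = (p - m) / (d + 1) / 2.
Proof.
move=> hd; have -> : d + d + 1 + 1 = 2 * (d + 1) by ring.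
by field; rewrite hd.
Qed.
Lemma frac_diff p m d q n e c : d + 1 != 0 -> e + 1 != 0 ->
  ((p - m) / (d + 1) - (q - n) / (e + 1)) * (c * ((d + 1) * (e + 1))) +
    c * (m * (e + 1) + q * (d + 1)) = c * (p * (e + 1) + n * (d + 1)).
Proof. by move=> hd he; field; rewrite he hd. Qed.
End FracField.

Section Reals.
Variable M : rca_model.
Notation N := (M tN).
Local Open Scope ring_scope.
Local Opaque lam tri exp2 cpair.
Local Notation sat := (sat eq (@mlt M)).
Local Notation ι := (@iota M).

Definition val (q : N) : K M :=
  (ι (fstN (fstN q)) - ι (sndN (fstN q))) / (ι (sndN q) + 1).

Lemma den_gt0 (d : N) : 0 < ι d + 1.
Proof. by have := iota_ge0 d; lra. Qed.
Lemma den_neq0 (d : N) : ι d + 1 != 0.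
Proof. by have := iota_ge0 d; lra. Qed.
Hint Resolve den_gt0 den_neq0 : core.

Lemma eval_codeQ G (r : env M G) p m d :
  eval r (codeQ p m d) = cp (cp (eval r p) (eval r m)) (eval r d).
Proof. by rewrite /codeQ !eval_cpair. Qed.
Local Opaque codeQ.

Lemma val_code (p m d : N) : val (cp (cp p m) d) = (ι p - ι m) / (ι d + 1).
Proof. by rewrite /val !(sndK, fstK). Qed.

Section Eval.
Variables (G : ctx) (r : env M G).
Implicit Types x y n : tm G tN.
Lemma eval_qp x : eval r (qp x) = fstN (fstN (eval r x)).
Proof. by rewrite /qp !eval_fst. Qed.
Lemma eval_qm x : eval r (qm x) = sndN (fstN (eval r x)).
Proof. by rewrite /qm eval_snd !eval_fst. Qed.
Lemma eval_qd x : eval r (qd x) = sndN (eval r x).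
Proof. by rewrite /qd eval_snd. Qed.
Let evalE := (evalA, evalM, eval_qp, eval_qm, eval_qd, eval_codeQ, val_code).

Lemma val_add x y : val (eval r (qadd x y)) = val (eval r x) + val (eval r y).
Proof.
by rewrite /qadd !evalE !iotaE frac_add.
Qed.
Lemma val_opp x : val (eval r (qopp x)) = - val (eval r x).
Proof. by rewrite /qopp !evalE -mulNr opprB. Qed.
Lemma val_half x : val (eval r (qhalf x)) = val (eval r x) / 2.
Proof.
by rewrite /qhalf !evalE !iotaE frac_half.
Qed.
Lemma qleP x y : eval r (qle x y) = czero M <-> val (eval r x) <= val (eval r y).
Proof.
rewrite /qle eval_sub mn_subE0 iota_le !evalE !iotaE /val.
rewrite ler_pdivrMr // mulrAC ler_pdivlMr //; split => h; lra.
Qed.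
Lemma val_max x y : val (eval r (qmax x y)) = Num.max (val (eval r x)) (val (eval r y)).
Proof.
rewrite /qmax eval_ifz /mif; case: pselect => /= [/qleP h|h].
  by rewrite max_r.
by rewrite max_l //; apply/ltW; rewrite ltNge; apply/negP => /qleP.
Qed.
Lemma val_min x y : val (eval r (qmin x y)) = Num.min (val (eval r x)) (val (eval r y)).
Proof.
rewrite /qmin eval_ifz /mif; case: pselect => /= [/qleP h|h].
  by rewrite min_l.
by rewrite min_r //; apply/ltW; rewrite ltNge; apply/negP => /qleP.
Qed.
End Eval.

Definition eps (n : N) : K M := (ι (app (expE M) n))^-1.
Lemma exp_gt0 n : 0 < ι (app (expE M) n).
Proof.
rewrite -(iota0 M) -iota_lt; move: n; apply: mind; first by decid.
  by rewrite exp0; apply: mn_lt01.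
by move=> n; rewrite expS !iota_lt !iotaE => h; lra.
Qed.
Lemma eps_gt0 n : 0 < eps n.
Proof. by rewrite invr_gt0 exp_gt0. Qed.
Lemma eps0 : eps (czero M) = 1.
Proof. by rewrite /eps exp0 iota1 invr1. Qed.
Lemma epsS n : eps (madd n (cone M)) = eps n / 2.
Proof. by rewrite /eps expS iotaD; field; have := exp_gt0 n; lra. Qed.
Lemma eps_add (n m : N) : eps (madd n m) = eps n * eps m.
Proof.
apply/eqP; rewrite /eps -invfM; apply/eqP; congr (_^-1); rewrite -iotaM; congr ι.
move: m; apply: mind; first by decid.
  by rewrite mn_add0 exp0 mn_mul1.
by move=> m IH; rewrite mn_addA !expS IH mn_mulD.
Qed.
Lemma eps_le1 n : eps n <= 1.
Proof.
rewrite /eps invf_le1 ?exp_gt0 // -(iota1 M) -iota_le; move: n; apply: mind; first by decid.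
  by rewrite exp0; right.
by move=> n; rewrite expS !iota_le !iotaE; have := exp_gt0 n; lra.
Qed.
Lemma eps_mono (n m : N) : mle n m -> eps m <= eps n.
Proof.
move/mn_subK <-; rewrite eps_add ler_piMr ?eps_le1 //; exact/ltW/eps_gt0.
Qed.
Lemma eps_mono_add (n m : N) : eps (madd n m) <= eps n.
Proof. by rewrite eps_add ler_piMr ?eps_le1 //; apply/ltW/eps_gt0. Qed.
Lemma exp_gt n : ι n < ι (app (expE M) n).
Proof.
rewrite -iota_lt; move: n; apply: mind; first by decid.
  by rewrite exp0; apply: mn_lt01.
move=> n; rewrite expS !iota_lt !iotaE => /iota_discrete; have := iota_ge0 n; lra.
Qed.
(** The field is Archimedean relative to the numbers of the model: a positive fraction is at least
    [1 / (d + 1)], and [2^(d + 1)] exceeds [d + 1]. *)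
Lemma eps_arch (x : K M) : 0 < x -> exists n, eps n < x.
Proof.
case: (KP x) => p [m [d ->]] h; exists (madd d (cone M)).
have lt : ι m + 1 <= ι p.
  apply: iota_discrete; move: h; rewrite fracE pmulr_lgt0 ?invr_gt0 //; lra.
rewrite fracE; apply: (@lt_le_trans _ _ (ι d + 1)^-1).
  rewrite ltf_pV2 ?posrE ?exp_gt0 //; have := exp_gt (madd d (cone M)).
  by rewrite iotaD iota1.
by rewrite -[X in X <= _]mul1r ler_pM2r ?invr_gt0 //; lra.
Qed.

Lemma val_eps G (r : env M G) n : val (eval r (qeps n)) = eps (eval r n).
Proof.
rewrite /qeps eval_codeQ val_code eval_pred eval_exp2 /= iota1 iota0 subr0 mul1r.
rewrite /eps; congr (_^-1); rewrite -(iota1 M) -iotaD; congr ι.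
case: (mn_predP (app (expE M) (eval r n))) => // e.
by have := exp_gt0 (eval r n); rewrite e iota0 ltxx.
Qed.

Lemma val_surj (q : N) : exists p m d, q = cp (cp p m) d.
Proof. by exists (fstN (fstN q)), (sndN (fstN q)), (sndN q); rewrite !cpK. Qed.

(** Clearing denominators is undone by a positive factor [2^n (d1 + 1) (d2 + 1)] and a common
    summand. These are the two invariances asked of [R], and they treat [<] and [<=] together. *)
Lemma sat_diffQ P (R : rel (K M)) :
  (forall G (r : env M G) x y, sat r (P G x y) <-> R (ι (eval r x)) (ι (eval r y))) ->
  (forall x y z, 0 < z -> R (x * z) (y * z) = R x y) ->
  (forall x y z, R (x + z) (y + z) = R x y) ->
  forall G (r : env M G) x y c n, sat r (diffQ P x y c n) <->
  R (val (eval r x) - val (eval r y)) (ι (eval r c) * eps (eval r n)).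
Proof.
move=> hP Rmul Radd G r x y c n.
pose f (p1 m1 d1 p2 m2 d2 : N) := R
  (ι (app (expE M) (eval r n)) * (ι p1 * (ι d2 + 1) + ι m2 * (ι d1 + 1)))
  (ι (app (expE M) (eval r n)) * (ι m1 * (ι d2 + 1) + ι p2 * (ι d1 + 1)) + ι (eval r c) * ((ι d1 + 1) * (ι d2 + 1))).
have hf p1 m1 d1 p2 m2 d2 : f p1 m1 d1 p2 m2 d2 =
    R ((ι p1 - ι m1) / (ι d1 + 1) - (ι p2 - ι m2) / (ι d2 + 1)) (ι (eval r c) * eps (eval r n)).
  have p : 0 < ι (app (expE M) (eval r n)) * ((ι d1 + 1) * (ι d2 + 1)).
    by rewrite !mulr_gt0 // exp_gt0.
  rewrite -[RHS](Rmul _ _ _ p) -[RHS](Radd _ _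
    (ι (app (expE M) (eval r n)) * (ι m1 * (ι d2 + 1) + ι p2 * (ι d1 + 1)))) /f.
  congr R; first by rewrite frac_diff.
  rewrite [RHS]addrC; congr (_ + _); rewrite /eps; field.
  by have := exp_gt0 (eval r n); lra.
split.
  rewrite /diffQ /= => -[d2 [m2 [p2 [d1 [m1 [p1]]]]]].
  rewrite hP !eval_codeQ !evalA !evalM !eval_exp2 !eval_wk !iotaE /=.
  by move=> [-> [-> h]]; rewrite !val_code -hf.
move=> h; rewrite /diffQ /=.
have [p1 [m1 [d1 e1]]] := val_surj (eval r x); have [p2 [m2 [d2 e2]]] := val_surj (eval r y).
exists d2, m2, p2, d1, m1, p1; rewrite hP !eval_codeQ !evalA !evalM !eval_exp2 !eval_wk !iotaE /=.
by split=> //; split=> //; move: h; rewrite e1 e2 !val_code -hf.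
Qed.

Lemma sat_diffQ_lt G (r : env M G) x y c n :
  sat r (diffQ Lt0 x y c n) <->
  val (eval r x) - val (eval r y) < ι (eval r c) * eps (eval r n).
Proof.
apply: (sat_diffQ (R := fun x y => x < y)) => [G' r' x' y'|a b z p|a b z].
- exact: iota_lt.
- by rewrite ltr_pM2r.
- by rewrite ltrD2r.
Qed.

Lemma sat_diffQ_le G (r : env M G) x y c n :
  sat r (diffQ Le0 x y c n) <->
  val (eval r x) - val (eval r y) <= ι (eval r c) * eps (eval r n).
Proof.
apply: (sat_diffQ (R := fun x y => x <= y)) => [G' r' x' y'|a b z p|a b z].
- exact: iota_le.
- by rewrite ler_pM2r.
- by rewrite lerD2r.
Qed.

Definition V (x : M t1) (n : N) : K M := val (app x n).
Definition is_real (x : M t1) := forall n i, `|V x n - V x (madd n i)| < eps n.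
Definition le_real (x y : M t1) := forall n, V x n - V y n <= 2 * eps n.
Definition eq_real (x y : M t1) := le_real x y /\ le_real y x.
Definition is01 (x : M t1) :=
  [/\ is_real x, forall n, - (2 * eps n) <= V x n & forall n, V x n - 1 <= 2 * eps n].

Local Opaque diffQ.
Lemma sat_real G (r : env M G) x : sat r (real x) <-> is_real (eval r x).
Proof.
rewrite /real /distQ /=; split=> h n i; move: (h n i); rewrite !sat_diffQ_lt !eval_app !eval_wk /= iota1 mul1r /V.
  by case=> h1 h2; rewrite ltr_norml; apply/andP; split => //; lra.
by rewrite ltr_norml => /andP[h1 h2]; split => //; lra.
Qed.

Lemma sat_leR G (r : env M G) x y : sat r (leR x y) <-> le_real (eval r x) (eval r y).
Proof.
by rewrite /leR /=; split=> h n; move: (h n);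
  rewrite !sat_diffQ_le !eval_app !eval_wk /= iotaD iota1.
Qed.

Lemma sat_eqR G (r : env M G) x y : sat r (eqR x y) <-> eq_real (eval r x) (eval r y).
Proof.
rewrite /eqR /distQ /=; split=> [h|[h1 h2] n].
  by split=> n; move: (h n); rewrite !sat_diffQ_le !eval_app !eval_wk /= iotaD iota1 => -[].
by rewrite !sat_diffQ_le !eval_app !eval_wk /= iotaD iota1; split; [apply: h1|apply: h2].
Qed.

Local Opaque real leR eqR.

Lemma sat_ltR G (r : env M G) x y : sat r (ltR x y) <-> ~ le_real (eval r y) (eval r x).
Proof. by rewrite /ltR /= sat_leR. Qed.

Lemma sat_in01 G (r : env M G) x : sat r (in01 x) <-> is01 (eval r x).
Proof.
rewrite /in01 /= sat_real !sat_leR /le_real.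
have h0 n : V (eval r (zeroR G)) n = 0.
  by rewrite /V /zeroR eval_app appK eval_codeQ val_code /= iota0 subrr mul0r.
have h1 n : V (eval r (oneR G)) n = 1.
  by rewrite /V /oneR eval_app appK eval_codeQ val_code /= iota0 iota1 subr0 add0r divr1.
split=> [[h [h' h'']]|[h h' h'']]; split=> //.
- by move=> n; move: (h' n); rewrite h0; lra.
- by move=> n; move: (h'' n); rewrite h1; lra.
by split=> n; [move: (h' n); rewrite h0; lra|move: (h'' n); rewrite h1; lra].
Qed.

(** A violation of the bound [2 * eps n] by a margin persists at all later indices, since each real
    moves by less than [eps n]; there it eventually exceeds any [C * eps k]. Later estimates may
    thus lose constants and finitely many indices. *)
Lemma le_realP (x y : M t1) (C : K M) n0 : is_real x -> is_real y ->
  (forall n, mle n0 n -> V x n - V y n <= C * eps n) -> le_real x y.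
Proof.
move=> rx ry h n; rewrite leNgt; apply/negP => lt.
pose g := V x n - V y n - 2 * eps n; have g0 : 0 < g by rewrite /g; lra.
have C0 : 0 < `|C| + 1 by have := normr_ge0 C; lra.
have [m hm] := eps_arch (divr_gt0 g0 C0).
move: hm; rewrite ltr_pdivlMr // => hm.
pose k := madd n (madd n0 m).
have h1 := rx n (madd n0 m); have h2 := ry n (madd n0 m).
have h3 : V x k - V y k <= C * eps k.
  apply: h; apply/iota_le; rewrite /k !iotaD.
  by have := iota_ge0 n; have := iota_ge0 m; lra.
have h4 : eps k <= eps m.
  by apply: eps_mono; rewrite /k; apply/iota_le; rewrite !iotaD; have := iota_ge0 n; have := iota_ge0 n0; lra.
have h5 : C * eps k <= `|C| * eps m.
  apply: le_trans (_ : `|C| * eps k <= _).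
    by rewrite ler_pM2r ?eps_gt0 // ler_norm.
  by apply: ler_wpM2l.
move: h1 h2; rewrite -/k !ltr_norml => /andP[h11 h12] /andP[h21 h22].
have := eps_gt0 m; rewrite /g in hm; lra.
Qed.

Lemma eq_realP (x y : M t1) (C : K M) n0 : is_real x -> is_real y ->
  (forall n, mle n0 n -> `|V x n - V y n| <= C * eps n) -> eq_real x y.
Proof.
move=> rx ry h; split; apply: (le_realP (C := C) (n0 := n0)) => // n /h; rewrite ler_norml => /andP[]; lra.
Qed.

Lemma eq_real_norm (x y : M t1) : eq_real x y <-> forall n, `|V x n - V y n| <= 2 * eps n.
Proof.
split=> [[h1 h2] n|h].
  by rewrite ler_norml; apply/andP; split; [have := h2 n|have := h1 n]; lra.
by split=> n; have := h n; rewrite ler_norml => /andP[]; lra.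
Qed.

Lemma eq_real_refl x : eq_real x x.
Proof. by split=> n; rewrite subrr mulr_ge0 // ltW // eps_gt0. Qed.
Lemma eq_real_sym x y : eq_real x y -> eq_real y x.
Proof. by case. Qed.
Lemma le_real_trans x y z : is_real x -> is_real z -> le_real x y -> le_real y z -> le_real x z.
Proof.
move=> rx rz h1 h2; apply: (@le_realP _ _ 4 (czero M)) => // n _.
by have := h1 n; have := h2 n; lra.
Qed.
Lemma eq_real_trans x y z : is_real x -> is_real z -> eq_real x y -> eq_real y z -> eq_real x z.
Proof. by move=> rx rz [h1 h2] [h3 h4]; split; [exact: le_real_trans h1 h3|exact: le_real_trans h4 h2]. Qed.

Lemma real_near x n m : is_real x -> mle n m -> `|V x n - V x m| < eps n.
Proof. by move=> rx /mn_subK <-. Qed.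
End Reals.

(** * The cover *)

Section CoverTerms.
Variable G : ctx.
Definition q0 : tm G tN := codeQ Zero Zero Zero.
Definition q1 : tm G tN := codeQ One Zero Zero.
Definition qabs (x : tm G tN) := qmax x (qopp x).
Definition qsub (x y : tm G tN) := qadd x (qopp y).
Definition neq_ (x y : tm G tN) := sub_ x y ⊕ sub_ y x.
(** Small against [4^-n], so that step [n] of the nested intervals can avoid the
    interval of index [n]. *)
Definition radius (n : tm G tN) := qeps (n ⊕ n ⊕ One ⊕ One ⊕ One).
End CoverTerms.

(** The midpoint is clamped to the unit interval because [Y] is extensional and injective only
    there. Averaging and clamping do not enlarge errors, so the result is again a real with the
    required modulus. *)
Definition midT G (a b : tm G t1) : tm G t1 :=
  lam (qmax (q0 _) (qmin (q1 _) (qhalf (qadd (wk a · v0) (wk b · v0))))).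
(** An endpoint and the midpoint may both be off, so each distance can have twice the error of the
    data; halving restores the modulus. The cap at 1 keeps the gap in the domain of [Y]. *)
Definition gapT G (Y : tm G t2) (a b : tm G t1) : tm G t1 :=
  lam (qmin (q1 _) (qhalf (qmax
    (qabs (qsub (qsub (wk (midT a b) · v0) (radius (wk (Y · midT a b)))) (wk a · v0)))
    (qabs (qsub (qadd (wk (midT a b) · v0) (radius (wk (Y · midT a b)))) (wk b · v0)))))).
(** The gap vanishes exactly when [(a, b)] is the interval of its midpoint; as [Y]
    is injective, comparing its value there with [Y 0] decides this. *)
Definition coverT G (Y : tm G t2) : tm G tR2 :=
  lam (lam (ifz (neq_ (wk (wk Y) · gapT (wk (wk Y)) v1 v0) (wk (wk Y) · zeroR _)) One Zero)).
Definition indexT G (Y : tm G t2) : tm G tR2 :=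
  lam (lam (wk (wk Y) · midT v1 v0)).

Lemma mifP (M : rca_model) (c x y : M tN) :
  (c = czero M /\ mif c x y = x) \/ (c <> czero M /\ mif c x y = y).
Proof. by rewrite /mif; case: pselect => h; [left|right]. Qed.

Section Cover.
Variable M : rca_model.
Notation N := (M tN).
Local Open Scope ring_scope.
Local Opaque lam.
Local Notation sat := (sat eq (@mlt M)).
Local Notation ι := (@iota M).
Implicit Types a b x y : M t1.

Definition clamp (x : K M) : K M := Num.max 0 (Num.min 1 x).

Lemma clamp_01 (x : K M) : 0 <= clamp x <= 1.
Proof. by rewrite /clamp le_max lexx ge_max ler01 ge_min lexx. Qed.

Lemma clamp_near (x d : K M) : 0 <= d -> - d <= x -> x - 1 <= d -> `|clamp x - x| <= d.
Proof.
rewrite ler_norml /clamp; case: (lerP 1 x) => h1 h2 h3 h4; last by case: (lerP 0 x); lra.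
by rewrite (max_r (@ler01 (K M))); lra.
Qed.

Lemma max_lip (x y x' y' d : K M) : `|x - x'| <= d -> `|y - y'| <= d ->
  `|Num.max x y - Num.max x' y'| <= d.
Proof. by rewrite !ler_norml; case: (lerP x y); case: (lerP x' y'); lra. Qed.
Lemma min_lip (x y x' y' d : K M) : `|x - x'| <= d -> `|y - y'| <= d ->
  `|Num.min x y - Num.min x' y'| <= d.
Proof. by rewrite !ler_norml; case: (lerP x y); case: (lerP x' y'); lra. Qed.
Lemma clamp_lip (x y : K M) : `|clamp x - clamp y| <= `|x - y|.
Proof. by apply: max_lip; [|apply: min_lip]; rewrite ?subrr ?normr0. Qed.
Lemma abs_lip (x y d : K M) : `|x - y| <= d -> `| `|x| - `|y| | <= d.
Proof. exact/le_trans/ler_dist_dist. Qed.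

Section Eval.
Variables (G : ctx) (r : env M G).
Lemma val_q0 : val (eval r (q0 G)) = 0.
Proof. by rewrite /q0 eval_codeQ val_code /= iota0 subrr mul0r. Qed.
Lemma val_q1 : val (eval r (q1 G)) = 1.
Proof. by rewrite /q1 eval_codeQ val_code /= iota0 iota1 subr0 add0r divr1. Qed.
Lemma val_abs (x : tm G tN) : val (eval r (qabs x)) = `|val (eval r x)|.
Proof. by rewrite /qabs val_max val_opp; case: (lerP (val (eval r x)) _) => h; [rewrite ler0_norm|rewrite ger0_norm]; lra. Qed.
Lemma val_sub (x y : tm G tN) : val (eval r (qsub x y)) = val (eval r x) - val (eval r y).
Proof. by rewrite /qsub val_add val_opp. Qed.
Lemma neq_eq0 (x y : tm G tN) : eval r (neq_ x y) = czero M <-> eval r x = eval r y.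
Proof.
rewrite /neq_ evalA mn_sum0 !eval_sub !mn_subE0; split=> [[]|->]; first exact: mn_le_anti.
by split; right.
Qed.
End Eval.

Definition rad (n : N) : K M := eps (madd n n) / 8.
Lemma rad_gt0 n : 0 < rad n.
Proof. by rewrite /rad divr_gt0 // eps_gt0. Qed.
Lemma val_radius G (r : env M G) n : val (eval r (radius n)) = rad (eval r n).
Proof. by rewrite /radius val_eps !evalA !epsS /rad; field. Qed.

Variable Y : M t2.
Definition rho a b : env M [:: t1; t1; t2] := econs b (econs a (econs Y enil)).
Definition mid a b : M t1 := eval (rho a b) (midT v1 v0).
Definition gap a b : M t1 := eval (rho a b) (gapT v2 v1 v0).
Definition F : M tR2 := eval (econs Y enil) (coverT v0).
Definition Z : M tR2 := eval (econs Y enil) (indexT v0).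
Definition zero : M t1 := eval enil (zeroR [::]).

Lemma V_lam G (r : env M G) (x : tm (tN :: G) tN) n :
  V (eval r (lam x)) n = val (eval (econs n r) x).
Proof. by rewrite /V lamE. Qed.

Lemma V_at G (r : env M G) (x : tm G t1) n :
  val (eval (econs n r) (wk x · v0)) = V (eval r x) n.
Proof. by rewrite eval_app eval_wk. Qed.

Lemma Vmid a b n : V (mid a b) n = clamp ((V a n + V b n) / 2).
Proof. by rewrite /mid /midT V_lam val_max val_min val_half val_add val_q0 val_q1 !V_at. Qed.

Local Opaque midT radius qabs qmin qmax qhalf qadd qsub codeQ wk.
Lemma Vgap a b n : V (gap a b) n = Num.min 1 (Num.max
  `|V (mid a b) n - rad (app Y (mid a b)) - V a n|
  `|V (mid a b) n + rad (app Y (mid a b)) - V b n| / 2).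
Proof.
rewrite /gap /gapT V_lam val_min val_half val_max 2!val_abs 3!val_sub val_add val_q1.
by rewrite val_radius !V_at eval_wk eval_app.
Qed.
Local Transparent wk.

Lemma Vzero n : V zero n = 0.
Proof. by rewrite /V /zero /zeroR eval_app appK val_q0. Qed.

Local Opaque gapT.
Lemma FE a b : app (app F a) b = mif
  (eval (rho a b) (neq_ (v2 · gapT v2 v1 v0) (v2 · zeroR _))) (cone M) (czero M).
Proof. by rewrite /F /coverT !lamE eval_ifz. Qed.

Lemma F1 a b : app (app F a) b = cone M <-> app Y (gap a b) = app Y zero.
Proof.
have e0 : eval (rho a b) (neq_ (v2 · gapT v2 v1 v0) (v2 · zeroR _)) = czero M <->
    app Y (gap a b) = app Y zero by exact: neq_eq0.
rewrite FE -e0; case: (mifP (eval (rho a b) (neq_ (v2 · gapT v2 v1 v0) (v2 · zeroR _))) (cone M) (czero M)) => [[e ->]|[ne ->]]; first by split.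
by split=> // e; have := mn_lt01 M; rewrite -e => /mn_ltI.
Qed.

Lemma F01 a b : app (app F a) b = czero M \/ app (app F a) b = cone M.
Proof. by rewrite FE; case: (mifP (eval (rho a b) (neq_ (v2 · gapT v2 v1 v0) (v2 · zeroR _))) (cone M) (czero M)) => -[_ ->]; [right|left]. Qed.

Lemma ZE a b : app (app Z a) b = app Y (mid a b).
Proof. by rewrite /Z /indexT !lamE. Qed.

Local Opaque midT gapT F Z mid gap zero V rad eps.

(** With equal endpoints and different indices this gives the modulus of convergence; with equal
    indices and different endpoints it gives extensionality. [gap_lip] plays the same double role,
    provided that the radii agree. *)
Lemma mid_lip a b a' b' n m (d : K M) : `|V a n - V a' m| <= d -> `|V b n - V b' m| <= d ->
  `|V (mid a b) n - V (mid a' b') m| <= d.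
Proof.
move=> h1 h2; rewrite !Vmid; apply: le_trans (clamp_lip _ _) _.
by move: h1 h2; rewrite !ler_norml; lra.
Qed.

Lemma mid_is01 a b : is_real a -> is_real b -> is01 (mid a b).
Proof.
move=> ra rb; split=> [n i|n|n].
- have ha := ra n i; have hb := rb n i.
  set d := Num.max `|V a n - V a (madd n i)| `|V b n - V b (madd n i)|.
  apply: le_lt_trans (mid_lip (d := d) _ _) _; rewrite /d ?le_max ?lexx ?orbT //.
  by rewrite gt_max ha.
- by have := clamp_01 ((V a n + V b n) / 2); rewrite Vmid; have := eps_gt0 n; lra.
- by have := clamp_01 ((V a n + V b n) / 2); rewrite Vmid; have := eps_gt0 n; lra.
Qed.

Lemma mid_congr a b a' b' : eq_real a a' -> eq_real b b' -> eq_real (mid a b) (mid a' b').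
Proof. by rewrite !eq_real_norm => h1 h2 n; apply: mid_lip. Qed.

Lemma gap_lip a b a' b' n m (d : K M) :
  app Y (mid a b) = app Y (mid a' b') ->
  `|V a n - V a' m| <= d -> `|V b n - V b' m| <= d ->
  `|V (gap a b) n - V (gap a' b') m| <= d.
Proof.
move=> e h1 h2; have h := mid_lip h1 h2; rewrite (Vgap a b) (Vgap a' b') e.
move: (V a n) (V a' m) (V b n) (V b' m) (V (mid a b) n) (V (mid a' b') m) (rad _) h1 h2 h.
move=> {e} va va' vb vb' vm vm' ra h1 h2 h.
apply: min_lip; first by rewrite subrr normr0; apply: le_trans h1.
suff hm : forall x y x' y' : K M, `|x - x'| <= 2 * d -> `|y - y'| <= 2 * d ->
    `|Num.max `|x| `|y| / 2 - Num.max `|x'| `|y'| / 2| <= d.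
  by apply: hm; move: h1 h2 h; rewrite !ler_norml; lra.
move=> x y x' y' hx hy; have hm := max_lip (abs_lip hx) (abs_lip hy).
by rewrite -mulrBl normrM [X in _ * X]ger0_norm; lra.
Qed.

Lemma gap_is01 a b : is_real a -> is_real b -> is01 (gap a b).
Proof.
move=> ra rb; split=> [n i|n|n].
- have ha := ra n i; have hb := rb n i.
  set d := Num.max `|V a n - V a (madd n i)| `|V b n - V b (madd n i)|.
  apply: le_lt_trans (gap_lip (d := d) erefl _ _) _; rewrite /d ?le_max ?lexx ?orbT //.
  by rewrite gt_max ha.
- have : 0 <= V (gap a b) n.
    by rewrite Vgap le_min ler01 divr_ge0 // le_max normr_ge0.
  by have := eps_gt0 n; lra.
- have : V (gap a b) n <= 1 by rewrite Vgap ge_min lexx.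
  by have := eps_gt0 n; lra.
Qed.

Lemma zero_is01 : is01 zero.
Proof.
by split=> [n i|n|n]; rewrite !Vzero ?subrr ?normr0 ?eps_gt0 //; have := eps_gt0 n; lra.
Qed.

Hypothesis Y_fun : forall x y, is01 x -> is01 y -> eq_real x y -> app Y x = app Y y.
Hypothesis Y_inj : forall x y, is01 x -> is01 y -> app Y x = app Y y -> eq_real x y.
Hypothesis Y_surj : forall n, exists2 x, is01 x & app Y x = n.

Lemma F_fun a b a' b' : is_real a -> is_real b -> is_real a' -> is_real b' ->
  eq_real a a' -> eq_real b b' -> app (app F a) b = app (app F a') b'.
Proof.
move=> ra rb ra' rb' ea eb.
have em : app Y (mid a b) = app Y (mid a' b').
  by apply: Y_fun; [apply: mid_is01|apply: mid_is01|apply: mid_congr].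
have eg : app Y (gap a b) = app Y (gap a' b').
  apply: Y_fun; [exact: gap_is01|exact: gap_is01|].
  by apply/eq_real_norm => n; apply: gap_lip => //; [move/eq_real_norm: ea|move/eq_real_norm: eb].
have key c d c' d' : app Y (gap c d) = app Y (gap c' d') ->
    app (app F c) d = cone M -> app (app F c') d' = cone M.
  by move=> e /F1 h; apply/F1; rewrite -e.
case: (F01 a b) => [h|h]; last by rewrite h (key _ _ _ _ eg h).
case: (F01 a' b') => [h'|h']; first by rewrite h h'.
by rewrite h' (key _ _ _ _ (esym eg) h').
Qed.

Definition mem a b := is_real a /\ is_real b /\ app (app F a) b = cone M.

Lemma eps_quarter (n : N) : mle (madd (cone M) (cone M)) n -> eps n <= 1 / 4.
Proof.
move/eps_mono; rewrite epsS (_ : cone M = madd (czero M) (cone M)) ?epsS ?eps0; first lra.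
by rewrite mn_addC mn_add0.
Qed.

(** Membership makes the gap equal to 0 as a real, hence at most [2 * eps n]. From index 2 on this
    is at most 1/2, so the cap at 1 is inactive and undoing the halving gives [4 * eps n]. *)
Lemma mem_near a b n : mem a b -> mle (madd (cone M) (cone M)) n ->
  `|V (mid a b) n - rad (app Y (mid a b)) - V a n| <= 4 * eps n /\
  `|V (mid a b) n + rad (app Y (mid a b)) - V b n| <= 4 * eps n.
Proof.
move=> [ra [rb /F1 e]] /eps_quarter le.
have /eq_real_norm/(_ n) := Y_inj (gap_is01 ra rb) zero_is01 e.
rewrite Vzero subr0 Vgap => h.
set u := `|_ - V a n| in h *; set v := `|_ - V b n| in h *.
have hu : 0 <= u by exact: normr_ge0.
have hv : 0 <= v by exact: normr_ge0.
move: u v hu hv h => u v hu hv h.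
have hm : u <= Num.max u v /\ v <= Num.max u v by rewrite !le_max !lexx orbT.
move: (Num.max u v) hm h => m [hm1 hm2]; rewrite ger0_norm; last first.
  by rewrite le_min ler01 divr_ge0 //; lra.
by rewrite ge_min => /orP[]; lra.
Qed.

Definition left_end (x : M t1) (n : N) : M t1 :=
  eval (econs n (econs x enil)) (lam (qsub (wk v1 · v0) (radius (wk v0)))).
Definition right_end (x : M t1) (n : N) : M t1 :=
  eval (econs n (econs x enil)) (lam (qadd (wk v1 · v0) (radius (wk v0)))).

Lemma Vleft x n m : V (left_end x n) m = V x m - rad n.
Proof. by rewrite /left_end V_lam val_sub V_at val_radius eval_wk. Qed.
Lemma Vright x n m : V (right_end x n) m = V x m + rad n.
Proof. by rewrite /right_end V_lam val_add V_at val_radius eval_wk. Qed.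
Local Opaque left_end right_end.

Lemma around_real x n : is_real x -> is_real (left_end x n) /\ is_real (right_end x n).
Proof.
have sh (u v r : K M) : u - r - (v - r) = u - v by ring.
have sh' (u v r : K M) : u + r - (v + r) = u - v by ring.
by move=> rx; split=> m i; have := rx m i; [rewrite !Vleft sh|rewrite !Vright sh'].
Qed.

Lemma around_mid x n : is01 x -> eq_real (mid (left_end x n) (right_end x n)) x.
Proof.
move=> [rx h0 h1]; apply/eq_real_norm => m; rewrite Vmid Vleft Vright.
have -> : (V x m - rad n + (V x m + rad n)) / 2 = V x m by field.
apply: clamp_near; [|exact: h0|exact: h1].
by have := eps_gt0 m; lra.
Qed.

Lemma around_index x n : is01 x -> app Y (mid (left_end x n) (right_end x n)) = app Y x.
Proof.
move=> hx; have [rx _ _] := hx; have [r1 r2] := around_real n rx.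
by apply: Y_fun; [exact: mid_is01|exact: hx|exact: around_mid].
Qed.

Lemma around_mem x : is01 x -> mem (left_end x (app Y x)) (right_end x (app Y x)).
Proof.
move=> hx; have [rx _ _] := hx; have [r1 r2] := around_real (app Y x) rx.
split=> //; split=> //; apply/F1; apply: Y_fun; [exact: gap_is01|exact: zero_is01|].
apply/eq_real_norm => n; rewrite Vzero subr0 Vgap (around_index _ hx) Vleft Vright.
have /eq_real_norm/(_ n) := around_mid (app Y x) hx.
set m := V (mid _ _) n; move: m (V x n) (rad _) => m v r.
rewrite (_ : m - r - (v - r) = m - v); last by ring.
rewrite (_ : m + r - (v + r) = m - v); last by ring.
rewrite maxxx => h; have h0 : 0 <= `|m - v| by [].
rewrite ger0_norm; last by rewrite le_min ler01 divr_ge0.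
by rewrite ge_min; apply/orP; right; have := eps_gt0 n; lra.
Qed.

Lemma around_lt x n : ~ le_real x (left_end x n) /\ ~ le_real (right_end x n) x.
Proof.
have [m hm] := eps_arch (rad_gt0 n).
have h2 : 2 * eps (madd m (cone M)) < rad n by rewrite epsS; lra.
by split=> /(_ (madd m (cone M))); [rewrite Vleft|rewrite Vright]; lra.
Qed.

Lemma Z_fun a b a' b' : is_real a -> is_real b -> is_real a' -> is_real b' ->
  eq_real a a' -> eq_real b b' -> app (app Z a) b = app (app Z a') b'.
Proof.
move=> ra rb ra' rb' ea eb; rewrite !ZE.
by apply: Y_fun; [apply: mid_is01|apply: mid_is01|apply: mid_congr].
Qed.

Lemma Z_inj a b a' b' : mem a b -> mem a' b' -> app (app Z a) b = app (app Z a') b' ->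
  eq_real a a' /\ eq_real b b'.
Proof.
move=> h h'; have [ra [rb _]] := h; have [ra' [rb' _]] := h'; rewrite !ZE => e.
have /eq_real_norm em := Y_inj (mid_is01 ra rb) (mid_is01 ra' rb') e.
(* The constant is 4 + 2 + 4: endpoint to midpoint, midpoint to midpoint, and back. The radii
   coincide because the indices do. *)
have near n (le : mle (madd (cone M) (cone M)) n) :
    `|V a n - V a' n| <= 10 * eps n /\ `|V b n - V b' n| <= 10 * eps n.
  have := mem_near h le; have := mem_near h' le; have := em n; rewrite e.
  move: (V (mid _ _) n) (V (mid _ _) n) (rad _) (V a n) (V b n) (V a' n) (V b' n) (eps n).
  by move=> m m' r va vb va' vb' en; rewrite !ler_norml; lra.
by split; apply: (eq_realP (C := 10) (n0 := madd (cone M) (cone M))) => // n /near[].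
Qed.

Lemma Z_surj n : exists a b, mem a b /\ app (app Z a) b = n.
Proof.
have [x hx e] := Y_surj n; exists (left_end x n), (right_end x n); split.
  by rewrite -e; apply: around_mem.
by rewrite ZE around_index.
Qed.

Lemma F_cover x : is01 x -> exists a b, mem a b /\ (~ le_real x a /\ ~ le_real b x).
Proof.
move=> hx; exists (left_end x (app Y x)), (right_end x (app Y x)).
by split; [apply: around_mem|apply: around_lt].
Qed.
End Cover.

(** * Nested intervals *)

(** One plus the last index [i < k] with [f i = n], or zero. *)
Definition pick_ G (f : tm G t1) (n k : tm G tN) : tm G tN :=
  Rec · lam (lam (ifz (neq_ (wk (wk f) · v1) (wk (wk n))) (v1 ⊕ One) v0)) · Zero · k.

(** Nested intervals [[L n, L n + 4^-n]]; step [n] avoids the centre whose index is [n]. *)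
Definition nest_step G (c : tm G (tN ⟶ t1)) (f : tm G t1) (k : tm G tN) : tm G (tN ⟶ tN ⟶ tN) :=
  let c := wk (wk c) in let f := wk (wk f) in let k := wk (wk k) in
  let n := v1 in let l := v0 in let p := pick_ f n (k ⊕ One) in
  lam (lam (ifz p l
    (ifz (qle (c · pred_ p · (n ⊕ n ⊕ One ⊕ One ⊕ One ⊕ One)) (qadd l (qeps (n ⊕ n ⊕ One))))
       (qadd l (qadd (qeps (n ⊕ n ⊕ One)) (qeps (n ⊕ n ⊕ One ⊕ One)))) l))).

Section Nest.
Variable M : rca_model.
Notation N := (M tN).
Local Open Scope ring_scope.
Local Opaque lam tri exp2 cpair codeQ rad eps qle qadd qeps.
Local Notation ι := (@iota M).
Local Notation "x + y" := (madd x y) : mn_scope.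
Local Notation "1" := (cone M) : mn_scope.

Lemma VE (x : M t1) n : V x n = val (app x n).
Proof. by []. Qed.
Local Opaque V.

(** Order between coded rationals is tested by the term [qle], so monotonicity of the nested
    intervals can be proved by induction in the model. *)
Lemma decid_val_le (f g : N -> N) : definable f -> definable g ->
  decidable (fun n => val (f n) <= val (g n)).
Proof.
move=> hf hg; pose q : M (tN ⟶ tN ⟶ tN) := eval enil (lam (lam (qle v1 v0))).
exists (fun n => app (app q (f n)) (g n)); first by definable.
by move=> n; rewrite /q !lamE qleP.
Qed.

Variables (C : M (tN ⟶ t1)) (I : M t1) (k : N).
Hypothesis C_01 : forall i, mle i k -> is01 (app C i).
Hypothesis I_inj : forall i j, mle i k -> mle j k -> app I i = app I j ->
  eq_real (app C i) (app C j).

Definition pickE (n : N) : M t1 := app (app (crec M tN)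
  (eval (econs n (econs I enil)) (lam (lam (ifz (neq_ (v3 · v1) v2) (v1 ⊕ One) v0))))) (czero M).

Lemma pick0 n : app (pickE n) (czero M) = czero M.
Proof. exact: mn_rec0. Qed.

Lemma pickS n i : app (pickE n) (madd i (cone M)) =
  if pselect (app I i = n) then madd i (cone M) else app (pickE n) i.
Proof.
rewrite /pickE mn_recS !lamE eval_ifz.
set p := app _ i; set r := econs _ _.
have e : eval r (neq_ (v3 · v1) v2) = czero M <-> app I i = n by exact: neq_eq0.
case: (mifP (eval r (neq_ (v3 · v1) v2)) (eval r (v1 ⊕ One)) (eval r v0)) => -[h ->];
  case: pselect => h' //=; exfalso.
    by apply: h'; apply/e.
by apply: h; apply/e.
Qed.

Lemma eval_pick G (r : env M G) f n t : eval r f = I ->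
  eval r (pick_ f n t) = app (pickE (eval r n)) (eval r t).
Proof.
move=> e; rewrite /pick_ eval_rec; congr (app (app (app _ _) _) _).
apply: mext2 => a b; rewrite !lamE !eval_ifz; congr mif.
by rewrite /neq_ !evalA !eval_sub !eval_app !eval_wk e.
Qed.
Local Opaque pickE pick_.

Lemma pick_some n j : app (pickE n) j = czero M \/
  mlt (app (predE M) (app (pickE n) j)) j /\ app I (app (predE M) (app (pickE n) j)) = n.
Proof.
move: j; apply: mind; first by decid.
  by left; rewrite pick0.
move=> j IH; rewrite pickS; case: pselect => h /=.
  by right; rewrite mn_predS; split=> //; apply: mn_ltS.
case: IH => [->|[lt e]]; [by left|right; split=> //].
exact: mn_ltT lt (mn_ltS _).
Qed.

Lemma pick_all n i j : app I i = n -> mlt i j -> app (pickE n) j <> czero M.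
Proof.
move=> e; move: j; apply: mind; first by decid.
  by move=> h; case: (mn_lt_leF h (mn_ge0 _)).
move=> j IH lt; rewrite pickS; case: pselect => h /=.
  by move=> h0; have := mn_le_lt_trans (mn_ge0 j) (mn_ltS j); rewrite h0 => /mn_ltI.
have [lt'|e'] := mn_ltS_le lt; first exact: IH.
by case: h; rewrite -e'.
Qed.

Definition L : M t1 := app (app (crec M tN)
  (eval (econs k (econs I (econs C enil))) (nest_step v2 v1 v0))) (eval enil (q0 [::])).
Lemma VL0 : V L (czero M) = 0.
Proof. by rewrite VE /L mn_rec0 val_q0. Qed.

Definition dbl (n : N) := madd n n.
Definition centre (n : N) : K M := V (app C (app (predE M) (app (pickE n) (madd k (cone M)))))
   (madd (madd (madd (madd (dbl n) (cone M)) (cone M)) (cone M)) (cone M)).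

Lemma VLS n : let p := app (pickE n) (madd k (cone M)) in
  [\/ p = czero M /\ V L (madd n (cone M)) = V L n,
      p <> czero M /\ centre n <= V L n + eps (dbl n) / 2 /\
        V L (madd n (cone M)) = V L n + eps (dbl n) * 3 / 4 |
      p <> czero M /\ V L n + eps (dbl n) / 2 < centre n /\ V L (madd n (cone M)) = V L n].
Proof.
move=> p.
pose r : env M _ := econs (app L n) (econs n (econs k (econs I (econs C enil)))).
pose pt : tm [:: tN; tN; tN; t1; tN ⟶ t1] tN := pick_ (wk (wk v1)) v1 (wk (wk v0) ⊕ One).
have ep : eval r pt = p by rewrite /pt eval_pick ?eval_wk.
pose ct : tm [:: tN; tN; tN; t1; tN ⟶ t1] tN := wk (wk v2) · pred_ pt · (v1 ⊕ v1 ⊕ One ⊕ One ⊕ One ⊕ One).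
have ec : val (eval r ct) = centre n.
  have -> : centre n = val (app (app C (app (predE M) p)) (eval r (v1 ⊕ v1 ⊕ One ⊕ One ⊕ One ⊕ One))).
    exact: VE.
  by rewrite -ep -eval_pred; congr val; rewrite /ct eval_app eval_app !eval_wk.
pose lt : tm [:: tN; tN; tN; t1; tN ⟶ t1] tN := qadd v0 (qeps (v1 ⊕ v1 ⊕ One)).
have el : val (eval r lt) = V L n + eps (dbl n) / 2 by rewrite val_add val_eps !evalA epsS VE.
pose ht : tm [:: tN; tN; tN; t1; tN ⟶ t1] tN := qadd v0 (qadd (qeps (v1 ⊕ v1 ⊕ One)) (qeps (v1 ⊕ v1 ⊕ One ⊕ One))).
have eh : val (eval r ht) = V L n + eps (dbl n) * 3 / 4.
  by rewrite val_add val_add !val_eps !evalA !epsS VE /dbl; field.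
have eL : app L (madd n (cone M)) = mif (eval r pt) (app L n)
    (mif (eval r (qle ct lt)) (eval r ht) (app L n)).
  by rewrite /L mn_recS /nest_step !lamE !eval_ifz.
rewrite [V L (madd n _)]VE eL ep; case: (mifP p (app L n) (mif (eval r (qle ct lt)) (eval r ht) (app L n))) => -[h ->].
  by constructor 1; rewrite VE.
case: (mifP (eval r (qle ct lt)) (eval r ht) (app L n)) => -[h' ->].
  by constructor 2; split=> //; move/qleP: h'; rewrite ec el eh.
constructor 3; split=> //; split; last by rewrite VE.
rewrite ltNge; apply/negP => h''; apply: h'.
by apply/qleP; rewrite ec el.
Qed.
Local Opaque L centre.

Definition R : M t1 := eval (econs L enil) (lam (qadd (wk v0 · v0) (qeps (v0 ⊕ v0)))).
Lemma VR n : V R n = V L n + eps (dbl n).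
Proof. by rewrite /R V_lam val_add V_at val_eps evalA. Qed.
Local Opaque R.

Lemma eps_dblS n : eps (dbl (madd n (cone M))) = eps (dbl n) / 4.
Proof. by rewrite /dbl eps_add !epsS eps_add; field. Qed.

Lemma L_step n : V L n <= V L (madd n (cone M)).
Proof. by have := eps_gt0 (dbl n); case: (VLS n) => [[_ ->]|[_ [_ ->]]|[_ [_ ->]]]; lra. Qed.

Lemma R_step n : V R (madd n (cone M)) <= V R n.
Proof.
rewrite !VR eps_dblS; have := eps_gt0 (dbl n).
by case: (VLS n) => [[_ ->]|[_ [_ ->]]|[_ [_ ->]]]; lra.
Qed.

Lemma L_mono n i : V L n <= V L (madd n i).
Proof.
rewrite !VE; move: i; apply: mind; first by apply: decid_val_le; definable.
  by rewrite mn_add0.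
by move=> i h; apply: le_trans h _; rewrite mn_addA -!VE L_step.
Qed.

Lemma R_mono n i : V R (madd n i) <= V R n.
Proof.
rewrite !VE; move: i; apply: mind; first by apply: decid_val_le; definable.
  by rewrite mn_add0.
by move=> i h; apply: le_trans h; rewrite mn_addA -!VE R_step.
Qed.

(** Both values lie in the interval of stage [n], whose length [4^-n] is at most [2^-n]; strictness
    comes from the positive length at the later stage. *)
Lemma L_real : is_real L.
Proof.
move=> n i; have := L_mono n i; have := R_mono n i; rewrite !VR.
have := eps_gt0 (dbl (madd n i)); have := eps_mono_add n n; rewrite -/(dbl n) ltr_norml.
move: (V L n) (V L _) (eps _) (eps _) (eps _) => a b c d e h1 h2 h3 h4.
by apply/andP; split; lra.
Qed.

Lemma L_01 : is01 L.
Proof.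
have add0 n : n = madd (czero M) n by rewrite mn_addC mn_add0.
split=> [|n|n]; first exact: L_real.
  have := L_mono (czero M) n; rewrite -add0 VL0 => h; have := eps_gt0 n.
  by move: (V L n) (eps n) h => a b; lra.
have := R_mono (czero M) n; rewrite -add0 !VR VL0 /dbl !mn_add0 eps0 => h.
have := eps_gt0 n; have := eps_gt0 (madd n n).
by move: (V L n) (eps n) (eps _) h => a b c; lra.
Qed.

(** Let [n] be the index of the interval and [e = 4^-n]. Step [n] keeps the quarter of the current
    interval at the end away from the centre, at distance at least [e / 4]. The radius costs [e / 8]
    and the approximation of the centre [e / 16], so [e / 16] is left. The step may use another
    centre [j] of the same index, which is the same real by [I_inj]. *)
Lemma L_avoids i : mle i k -> exists n0,
  (forall n, mle n0 n -> V (app C i) n + rad (app I i) - V L n <= 2 * eps n) \/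
  (forall n, mle n0 n -> V L n - (V (app C i) n - rad (app I i)) <= 2 * eps n).
Proof.
move=> ik; set n := app I i.
set n1 := madd n (cone M).
pose n2 := madd (madd (madd (madd (dbl n) (cone M)) (cone M)) (cone M)) (cone M).
exists (madd n1 n2).
have lt : mlt i (madd k (cone M)) by apply: mn_le_lt_trans ik (mn_ltS _).
have nz := pick_all (erefl : app I i = n) lt.
have [e0|[jk ej]] := pick_some n (madd k (cone M)); first by case: (nz e0).
set j := app (predE M) _ in jk ej.
have {}jk : mle j k by apply: mn_ltS_le.
have [rj _ _] := C_01 jk.
have near m : mle (madd n1 n2) m -> `|V (app C i) m - centre n| <= 2 * eps m + eps (dbl n) / 16.
  move=> le; have le2 : mle n2 m.
    by apply: mn_le_trans le; apply/iota_le; rewrite iotaD; have := iota_ge0 n1; lra.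
  have h1 := real_near rj le2.
  have /eq_real_norm/(_ m) h2 : eq_real (app C i) (app C j) by apply: I_inj.
  (* [nest_step] reads the centre at index [2n + 4], which produces the error [e / 16]. *)
  have e2 : eps n2 = eps (dbl n) / 16 by rewrite /n2 !epsS; field.
  have ec : centre n = V (app C j) n2 by [].
  move: h1 h2; rewrite ec -e2.
  move: (V _ _) (V _ _) (V _ _) (eps _) (eps _) => a b c d e.
  by rewrite ltr_norml !ler_norml; lra.
have er : rad n = eps (dbl n) / 8 by [].
have mono m : mle (madd n1 n2) m -> V L n1 <= V L m /\ V L m <= V R n1.
  move=> le; have le1 : mle n1 m.
    by apply: mn_le_trans le; apply/iota_le; rewrite iotaD; have := iota_ge0 n2; lra.
  have <- := mn_subK le1; split; first exact: L_mono.
  apply: le_trans (R_mono n1 (app (app (subE M) m) n1)); rewrite VR.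
  by rewrite lerDl; apply/ltW/eps_gt0.
have e1 : V R n1 = V L n1 + eps (dbl n) / 4 by rewrite VR eps_dblS.
case: (VLS n) => [[e0 _]|[_ [h1 h2]]|[_ [h1 h2]]]; first by case: (nz e0).
  left=> m le; have [h3 _] := mono m le; have := near m le; rewrite er.
  rewrite -/n1 in h2; move: h1 h2 h3; move: (eps_gt0 (dbl n)).
  move: (V L n) (V L n1) (V L m) (V _ _) (centre n) (eps (dbl n)) (eps m) => a b c d e f g.
  by rewrite ler_norml; lra.
right=> m le; have [_ h3] := mono m le; have := near m le; rewrite er.
rewrite -/n1 in h2; rewrite e1 in h3; move: h1 h2 h3; move: (eps_gt0 (dbl n)).
move: (V L n) (V L n1) (V L m) (V _ _) (centre n) (eps (dbl n)) (eps m) => a b c d e f g.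
by rewrite ler_norml; lra.
Qed.
End Nest.

(** * [HBC1] and [NBI] read in a model *)

Section Shallow.
Local Open Scope ring_scope.
Variable M : rca_model.
Notation N := (M tN).
Local Notation sat := (sat eq (@mlt M)).
Local Opaque real leR eqR in01.

Lemma sat_HBC1 : sat enil HBC1 ->
  forall F : M tR2,
  (forall x y x' y' : M t1, is_real x -> is_real y -> is_real x' -> is_real y' ->
     eq_real x x' -> eq_real y y' -> app (app F x) y = app (app F x') y') ->
  (forall x y, app (app F x) y = czero M \/ app (app F x) y = cone M) ->
  forall mem : M t1 -> M t1 -> Prop,
  (forall a b, mem a b <-> is_real a /\ is_real b /\ app (app F a) b = cone M) ->
  forall Z : M tR2,
  (forall x y x' y' : M t1, is_real x -> is_real y -> is_real x' -> is_real y' ->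
     eq_real x x' -> eq_real y y' -> app (app Z x) y = app (app Z x') y') ->
  (forall a b a' b', mem a b -> mem a' b' -> app (app Z a) b = app (app Z a') b' ->
     eq_real a a' /\ eq_real b b') ->
  (forall n, exists a b, mem a b /\ app (app Z a) b = n) ->
  (forall x, is01 x -> exists a b, mem a b /\ (~ le_real x a /\ ~ le_real b x)) ->
  exists k (A B : M (tN ⟶ t1)),
    (forall i, mle i k -> mem (app A i) (app B i)) /\
    (forall x, is01 x -> exists i, mle i k /\
       (~ le_real x (app A i) /\ ~ le_real (app B i) x)).
Proof.
move=> h F hF hF01 mem hmem Z hZ hZi hZs hc.
have pF : sat (econs F enil) (subsetR2 v0).
  split; last by intros y x _; apply: hF01.
  (* [Alls] and [Exs] bind the head of their list innermost, so variables and witnesses come in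
     reverse order, here and below. *)
  intros y' x' y x [rx [ry [rx' ry']]] [e1 e2].
  move/sat_real: rx => rx; move/sat_real: ry => ry; move/sat_real: rx' => rx'; move/sat_real: ry' => ry'.
  move/sat_eqR: e1 => e1; move/sat_eqR: e2 => e2.
  exact (hF x y x' y' rx ry rx' ry' e1 e2).
have memP G (r : env M G) f a b : eval r f = F -> sat r (memR2 f a b) <-> mem (eval r a) (eval r b).
  move=> e; rewrite hmem -e; split.
    by move=> [/sat_real ra [/sat_real rb eq]].
  by move=> [ra [rb eq]]; split; [apply/sat_real|split; [apply/sat_real|]].
have pZ : sat (econs F enil) (strongly_countableR2 v0).
  exists Z; split; last split.
  - intros y' x' y x [rx [ry [rx' ry']]] [e1 e2].
    move/sat_real: rx => rx; move/sat_real: ry => ry; move/sat_real: rx' => rx'; move/sat_real: ry' => ry'.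
    move/sat_eqR: e1 => e1; move/sat_eqR: e2 => e2.
    exact (hZ x y x' y' rx ry rx' ry' e1 e2).
  - intros b' a' b a [h1 h2] e; move/memP: h1 => h1; move/memP: h2 => h2.
    have [e1 e2] := hZi a b a' b' (h1 erefl) (h2 erefl) e.
    by split; apply/sat_eqR.
  - move=> n; have [a [b [h1 h2]]] := hZs n; exists b, a; split=> //.
    exact/memP.
have pc : sat (econs F enil) (All01 (Exs [:: t1; t1]
         (let a := v0 in let b := v1 in let x := v2 in let F := v3 in
          memR2 F a b ⊓ in_interval a b x))).
  move=> x /sat_in01 hx; have [a [b [h1 [h2 h3]]]] := hc x hx; exists b, a; split; first exact/memP.
  by split; apply/sat_ltR.
have [k [B [A [h1 h2]]]] := h F (conj pF (conj pZ pc)).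
exists k, A, B; split=> [i le|x hx].
  exact (proj1 (memP _ (econs i (econs A (econs B (econs k (econs F enil)))))
    v4 (v1 · v0) (v2 · v0) erefl) (h1 i le)).
have [|i [ik [/sat_ltR l1 /sat_ltR l2]]] := h2 x; first exact/sat_in01.
by exists i; split.
Qed.

Lemma sat_NBI : (forall Y : M t2,
  (forall x y : M t1, is01 x -> is01 y -> eq_real x y -> app Y x = app Y y) ->
  (forall x y : M t1, is01 x -> is01 y -> app Y x = app Y y -> eq_real x y) ->
  (forall n : N, exists2 x : M t1, is01 x & app Y x = n) -> False) ->
  sat enil NBI.
Proof.
move=> h Y hY; apply: NNPP => nh; apply: (h Y).
- move=> x y hx hy e; apply: (hY x) => //; first exact/sat_in01.
    exact/sat_in01.
  exact/sat_eqR.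
- move=> x y hx hy e; apply: NNPP => ne; apply: nh; left; exists x; split; first exact/sat_in01.
  exists y; split; first exact/sat_in01.
  by split=> // /sat_eqR.
move=> n; apply: NNPP => nx; apply: nh; right; exists n => x /sat_in01 hx e.
by apply: nx; exists x.
Qed.
End Shallow.

Section BoundedIndex.
Local Open Scope ring_scope.
Local Opaque lam midT V rad eps mid F Z L.
(** The limit of the nested intervals, run on the midpoints of the finite subcover, is a point of
    the unit interval. By [L_avoids] it is outside each of these intervals. *)
Lemma HBC1_NBI_model (M : rca_model) : sat eq (@mlt M) enil HBC1 -> sat eq (@mlt M) enil NBI.
Proof.
move=> /sat_HBC1 h; apply: sat_NBI => Y Yf Yi Ys.
have [k [A [B [h1 h2]]]] := h (F Y) (F_fun Yf) (F01 Y) (mem Y) (fun a b => conj id id)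
  (Z Y) (Z_fun Yf) (Z_inj Yi) (Z_surj Yf Ys) (F_cover Yf).
pose mE : M (t1 ⟶ t1 ⟶ t1) := eval (econs Y enil) (lam (lam (midT v1 v0))).
pose C : M (tN ⟶ t1) := eval (econs mE (econs A (econs B enil)))
  (lam (v1 · (v2 · v0) · (v3 · v0))).
pose I : M t1 := eval (econs Y (econs C enil)) (lam (v1 · (v2 · v0))).
have eC i : app C i = mid Y (app A i) (app B i).
  have -> : app C i = app (app mE (app A i)) (app B i) by rewrite /C lamE.
  by rewrite /mE !lamE.
have eI i : app I i = app Y (app C i) by rewrite /I lamE.
have C01 i : mle i k -> is01 (app C i).
  by move=> /h1[ra [rb _]]; rewrite eC; apply: mid_is01.
have Iinj i j : mle i k -> mle j k -> app I i = app I j -> eq_real (app C i) (app C j).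
  by move=> hi hj; rewrite !eI; apply: Yi; apply: C01.
have L01 := L_01 C I k; have [rL _ _] := L01.
have [i [ik [n1 n2]]] := h2 _ L01.
have hm := h1 i ik; have [rA [rB _]] := hm.
have [n0 av] := L_avoids C01 Iinj ik.
pose n3 := madd n0 (madd (cone M) (cone M)).
have le3 m : mle n3 m -> mle n0 m /\ mle (madd (cone M) (cone M)) m.
  move=> le; split; apply: mn_le_trans le; apply/iota_le; rewrite /n3 !iotaE.
    by move: (iota n0) => u; lra.
  by have := iota_ge0 n0; lra.
(* The constant is 2 from [L_avoids] plus 4 from [mem_near], which relates the true endpoint to
   midpoint and radius. *)
case: av => av; [apply: n2|apply: n1]; apply: (le_realP (C := 6) (n0 := n3)) => // m /le3[l0 l2].
  have [_] := mem_near Yi hm l2; have := av m l0; rewrite eI eC.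
  move: (V _ _) (V _ _) (V _ _) (rad _) (eps m) => a b c d e.
  by rewrite ler_norml; lra.
have [+ _] := mem_near Yi hm l2; have := av m l0; rewrite eI eC.
move: (V _ _) (V _ _) (V _ _) (rad _) (eps m) => a b c d e.
by rewrite ler_norml; lra.
Qed.

End BoundedIndex.

Theorem RCA0w_HBC1_NBI : proves RCA0w (HBC1 ⊃ NBI).
Proof.
apply: completeness => [|G s t f x y|M lt ext val].
- exact: RCA0w_sub.
- exact: ax_ext.
exact: (@HBC1_NBI_model (RcaModel ext val)).
Qed.

(** * The Heine-Borel theorem in the ground model *)

Lemma std_ext : extensional std.
Proof. by move=> s t f g h; apply: funext. Qed.

Lemma std_eq t (x y : std t) : ext_eq eq x y -> x = y.
Proof. by elim: t x y => //= s _ t IH x y h; apply: funext => z; apply: IH. Qed.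

Lemma std_valid : is_model eq std_lt RCA0w.
Proof.
move=> G A r H; case: H r => {G A}.
- by move=> G x y z r /=; rewrite addnA.
- by move=> G x y r /=; rewrite addnC.
- by move=> G x r /=; rewrite addn0.
- by move=> G x y z r /=; rewrite mulnA.
- by move=> G x y r /=; rewrite mulnC.
- by move=> G x r /=; rewrite muln1.
- by move=> G x r /=; rewrite muln0.
- by move=> G x y z r /=; rewrite mulnDr.
- by move=> G x r /=; rewrite /std_lt ltnn.
- by move=> G x y z r /=; apply: ltn_trans.
- by move=> G x y r /=; rewrite /std_lt; case: (ltngtP (eval r x) (eval r y)); auto.
- by [].
- by move=> G x y z r /=; rewrite /std_lt ltn_add2r.
- by move=> G x y z r /= h; rewrite /std_lt ltn_pmul2r.
- by move=> G s t x y r; apply/sat_eqt; apply: ext_refl.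
- by move=> G a s t x y z r; apply/sat_eqt; apply: ext_refl.
- by [].
- by move=> G f m n r /=; rewrite addn1.
- move=> G s t f x y r /= /sat_eqt h; apply/sat_eqt.
  by rewrite [eval r (f · x)]/= (std_eq h); apply: ext_refl.
- move=> G A _ r /= [h0 hS]; elim=> [|n IH]; first by rewrite sat_inst in h0.
  have := hS n IH; rewrite /at_succ sat_fsub eval_scons /= addn1.
  by congr sat.
- move=> G A _ r /= h.
  exists (fun x : fn t1 => proj1_sig (cid (h x))) => x.
  rewrite /at_choice sat_fsub.
  set r1 := econs _ r; have := proj2_sig (cid (h x)).
  by congr sat; apply: subP => //; apply: varP.
Qed.

Definition Mstd : rca_model := RcaModel std_ext std_valid.

Section HeineBorel.
Local Open Scope ring_scope.
Notation K := (K Mstd).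
Notation real_ := (fn t1).
Implicit Types x y : Mstd t1.
Implicit Types i j k n m : nat.
Local Notation Eps := (@eps Mstd).
Local Notation Val := (@V Mstd).

Lemma mleP n m : @mle Mstd n m <-> (n <= m)%N.
Proof.
split=> [[h|->]|]; [exact: ltnW|exact: leqnn|].
by rewrite leq_eqVlt => /orP[/eqP ->|h]; [right|left].
Qed.

Lemma EpsS n : Eps n.+1 = Eps n / 2.
Proof. by rewrite -epsS /madd /= addn1. Qed.

Lemma code_ex (u : K) : exists q : nat, @val Mstd q = u.
Proof. by have [p [m [d ->]]] := KP u; exists (@cp Mstd (@cp Mstd p m) d); rewrite val_code fracE. Qed.

Lemma not_le_gap x y : is_real x -> is_real y -> ~ le_real x y ->
  exists2 g : K, 0 < g & exists m, forall j, (m <= j)%N -> g <= Val x j - Val y j.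
Proof.
move=> rx ry /(not_all_ex_not _ _)[m hm].
exists (Val x m - Val y m - 2 * Eps m).
  have : 2 * Eps m < Val x m - Val y m by rewrite ltNge; apply/negP.
  by move: (Val x m) (Val y m) (Eps m) => u v e; lra.
exists m => j /mleP le; have := real_near rx le; have := real_near ry le.
move: (Val x m) (Val y m) (Val x j) (Val y j) (Eps m) => a b c d e.
by rewrite !ltr_norml => /andP[h1 h2] /andP[h3 h4]; lra.
Qed.

Section Bisect.
Variables a b : nat -> Mstd t1.
Hypothesis ra : forall n, is_real (a n).
Hypothesis rb : forall n, is_real (b n).
Let covers i x := ~ le_real x (a i) /\ ~ le_real (b i) x.
Hypothesis cov : forall x, is01 x -> exists i, covers i x.

(** The tolerance is that of the order of reals, so the rational interval is closed and overlapping
    halves need no decision at their common end. *)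
Let within (l u : K) x := forall m, l - 2 * Eps m <= Val x m /\ Val x m <= u + 2 * Eps m.
Let bad (l : K) n := forall k, exists x, [/\ is01 x, within l (l + Eps n) x &
  forall i, (i <= k)%N -> ~ covers i x].

Let bad_split l n : bad l n -> bad l n.+1 \/ bad (l + Eps n.+1) n.+1.
Proof.
move=> hb; apply: NNPP => /not_or_and[/(not_all_ex_not _ _)[k1 h1] /(not_all_ex_not _ _)[k2 h2]].
have [x [x01 xin xk]] := hb (maxn k1 k2); have [rx _ _] := x01.
have e2 : Eps n = 2 * Eps n.+1 by rewrite EpsS; field.
case: (classic (within l (l + Eps n.+1) x)) => hx.
  apply: h1; exists x; split=> // i ik; apply: xk; exact: leq_trans ik (leq_maxl _ _).
apply: h2; exists x; split=> // [m|i ik]; last by apply: xk; apply: leq_trans ik (leq_maxr _ _).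
have [xm1 xm2] := xin m; split; last by move: xm2; rewrite e2; lra.
(* If one approximation of [x] is clearly left of the middle, then by the modulus of [x] none is
   clearly right of it, so [x] would lie in the left half. *)
rewrite leNgt; apply/negP => lt; apply: hx => j; have [xj1 xj2] := xin j; split=> //.
rewrite leNgt; apply/negP => lt'.
have near : `|Val x m - Val x j| < Num.max (Eps m) (Eps j).
  case: (leqP m j) => h.
    by apply: lt_le_trans (real_near rx ((mleP m j).2 h)) _; rewrite le_max lexx.
  rewrite distrC; apply: lt_le_trans (real_near rx ((mleP j m).2 (ltnW h))) _.
  by rewrite le_max lexx orbT.
have := eps_gt0 (M := Mstd) m; have := eps_gt0 (M := Mstd) j; move: near lt lt'.
move: (Val x m) (Val x j) (Eps m) (Eps j) (Eps n.+1) => u v em ej en.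
by rewrite lt_max !ltr_norml => /orP[] /andP[h1' h2'] *; lra.
Qed.

Let nest n := {l : K | bad l n}.
Let nest_next n (s : nest n) : {l : K | bad l n.+1 /\ (l = sval s \/ l = sval s + Eps n.+1)}.
Proof.
apply: cid; case: s => l /= /bad_split[h|h].
  by exists l; split=> //; left.
by exists (l + Eps n.+1); split=> //; right.
Qed.
Hypothesis bad0 : bad 0 0%N.
Let seq := fix seq n : nest n := match n with
  | 0 => exist (fun l => bad l 0%N) 0 bad0
  | n.+1 => exist (fun l => bad l n.+1) (sval (nest_next (seq n))) (proj2_sig (nest_next (seq n))).1
  end.
Let l n := sval (seq n).
Let l_bad n : bad (l n) n. Proof. exact: proj2_sig (seq n). Qed.
Let l0 : l 0 = 0. Proof. by []. Qed.
Let l_step n : l n <= l n.+1 /\ l n.+1 + Eps n.+1 <= l n + Eps n.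
Proof.
have e2 : Eps n = 2 * Eps n.+1 by rewrite EpsS; field.
have := eps_gt0 (M := Mstd) n.+1.
have [_ [e|e]] := proj2_sig (nest_next (seq n)); rewrite -/(l n) in e;
  rewrite [l n.+1](e : l n.+1 = _) e2; move: (l n) (Eps n.+1) => u v; lra.
Qed.
Let l_mono n i : l n <= l (n + i)%N /\ l (n + i)%N + Eps (n + i)%N <= l n + Eps n.
Proof.
elim: i => [|i [h1 h2]]; first by rewrite addn0; split.
have [h3 h4] := l_step (n + i)%N; rewrite addnS; split; [exact: le_trans h1 h3|exact: le_trans h4 h2].
Qed.

Let pt : Mstd t1 := fun n => proj1_sig (cid (code_ex (l n))).
Let Vpt n : Val pt n = l n.
Proof. by rewrite /V /pt /=; case: cid. Qed.

Let pt_01 : is01 pt.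
Proof.
have ep n : 0 < Eps n := eps_gt0 (M := Mstd) n.
split=> [n i|n|n]; rewrite !Vpt.
- have [h1 h2] := l_mono n i; have := ep (n + i)%N; rewrite -[madd n i]/(n + i)%N.
  move: (l n) (l _) (Eps n) (Eps _) h1 h2 => u v e e' h1 h2 h3.
  by rewrite ltr_norml; apply/andP; split; lra.
- have [h1 _] := l_mono 0 n; rewrite add0n l0 in h1; have := ep n.
  by move: (l n) (Eps n) h1 => u v; lra.
- have [_ h1] := l_mono 0 n; rewrite add0n l0 eps0 in h1; have := ep n.
  by move: (l n) (Eps n) h1 => u v; lra.
Qed.

Lemma bisect_absurd : False.
Proof.
have ep n : 0 < Eps n := eps_gt0 (M := Mstd) n.
have [rp _ _] := pt_01; have [i [ha hb]] := cov pt_01.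
have [g1 g10 [m1 h1]] := not_le_gap rp (ra i) ha.
have [g2 g20 [m2 h2]] := not_le_gap (rb i) rp hb.
pose g := Num.min g1 g2; have g0 : 0 < g by rewrite lt_min g10.
have g1' : g <= g1 by rewrite ge_min lexx.
have g2' : g <= g2 by rewrite ge_min lexx orbT.
(* At a late index [j] the tolerances add up to at most [Eps n + 4 * Eps j], hence to at most 5
   times [Eps n]; a tenth of the margin [g] is ample. *)
have [n hn] := eps_arch (divr_gt0 g0 (ltr0n K 10)).
have [x [x01 xin xk]] := l_bad n i; have [rx _ _] := x01.
pose j := maxn n (maxn m1 m2).
have nj : (n <= j)%N by apply: leq_maxl.
have mj : (m1 <= j)%N /\ (m2 <= j)%N by rewrite /j !leq_max !leqnn !orbT.
have ej : Eps j <= Eps n by apply: eps_mono; apply/mleP.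
have [lj1 lj2] : l n <= l j /\ l j + Eps j <= l n + Eps n by rewrite -(subnKC nj); apply: l_mono.
have := h1 j mj.1; have := h2 j mj.2; rewrite !Vpt => hb' ha'.
have [xj1 xj2] := xin j; have := ep j => ej0.
case: (classic (le_real x (a i))) => [/(_ j) h|h].
  move: h ha' xj1 xj2 lj1 lj2 ej hn g1' ej0.
  move: (l n) (l j) (Eps n) (Eps j) (Val x j) (Val (a i) j) => *; lra.
case: (classic (le_real (b i) x)) => [/(_ j) h'|h'].
  move: h' hb' xj1 xj2 lj1 lj2 ej hn g2' ej0.
  move: (l n) (l j) (Eps n) (Eps j) (Val x j) (Val (b i) j) => *; lra.
exact: (xk i (leqnn i)).
Qed.
End Bisect.

Lemma heine_borel (a b : nat -> Mstd t1) :
  (forall n, is_real (a n)) -> (forall n, is_real (b n)) ->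
  (forall x, is01 x -> exists i, ~ le_real x (a i) /\ ~ le_real (b i) x) ->
  exists k, forall x, is01 x -> exists2 i, (i <= k)%N & ~ le_real x (a i) /\ ~ le_real (b i) x.
Proof.
move=> ra rb cov; apply: NNPP => no; apply: (bisect_absurd ra rb cov) => k.
have [x hx] := not_all_ex_not _ _ (not_ex_all_not _ _ no k).
have [x01 xk] := imply_to_and _ _ hx; exists x; split=> //.
  have [_ h1 h2] := x01; move=> m; have := h1 m; have := h2 m; rewrite eps0.
  by move: (Val x m) (Eps m) => u e; lra.
by move=> i ik hc; apply: xk; exists i.
Qed.
End HeineBorel.

(** * HBC1 holds in the extension *)

Section ForcedReals.
Variable key : Type.
Local Notation name := (name key).
Local Notation names := (names key).
Local Notation cond := (cond key).
Implicit Types c d e : cond.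
Local Notation perN := (@per key tN).
Local Notation per1 := (@per key t1).

Definition two_sub G (x y : tm G t1) : sub [:: t1; t1] G :=
  scons x (scons y (fun t v => False_rect _ (var_nil v))).

(** Absoluteness for a formula in a fixed two-variable context, then instantiated at arbitrary terms
    whose names are ground at [c]. Formulas such as [eqR x y] are instances of it by computation. *)
Lemma frc_arith2 (A : fm [:: t1; t1]) c G (r : env names G) (x y : tm G t1) (f g : fn t1) : arith A ->
  per1 c (eval r x) (hat f) -> per1 c (eval r y) (hat g) ->
  frc c r (fsub (two_sub x y) A) <->
  std_sat (gcons1 f (gcons1 g enil)) A.
Proof.
move=> qA hx hy.
pose r' : env names _ := ncons1 (hat f) (ncons1 (hat g) enil).
have ab : frc c r' A <-> std_sat (gcons1 f (gcons1 g enil)) A.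
  apply: absolute => //.
    by apply: varP => [|t v]; [apply: ground_hat|move: t v; apply: varP => [|t v]; [apply: ground_hat|case: (var_nil v)]].
  move=> d; apply: perenv_cons; first exact: per_hat.
  by apply: perenv_cons => [|t v]; [apply: per_hat|case: (var_nil v)].
have p : perenv c (fun t v => eval r (two_sub x y v)) r'.
  by apply: varP => [|t v]; [|move: t v; apply: varP => [|t v]; [|case: (var_nil v)]].
rewrite -ab frc_fsub; split; apply: frc_per => // t v; exact: per_sym (p t v).
Qed.

Section Terms.
Variables (c : cond) (G : ctx) (r : env names G) (x y : tm G t1) (f g : Mstd t1).
Hypothesis hx : per1 c (eval r x) (hat f).
Hypothesis hy : per1 c (eval r y) (hat g).

Lemma frc_real : frc c r (real x) <-> is_real f.
Proof.
have := frc_arith2 (isT : arith (real (v0 : tm [:: t1; t1] t1))) hx hx.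
have := sat_real (M := Mstd) (gcons1 f (gcons1 f enil)) v0.
by move=> -> h; exact: h.
Qed.
Lemma frc_in01 : frc c r (in01 x) <-> is01 f.
Proof.
have := frc_arith2 (isT : arith (in01 (v0 : tm [:: t1; t1] t1))) hx hx.
have := sat_in01 (M := Mstd) (gcons1 f (gcons1 f enil)) v0.
by move=> -> h; exact: h.
Qed.
Lemma frc_eqR : frc c r (eqR x y) <-> eq_real f g.
Proof.
have := frc_arith2 (isT : arith (eqR (v0 : tm [:: t1; t1] t1) v1)) hx hy.
have := sat_eqR (M := Mstd) (gcons1 f (gcons1 g enil)) v0 v1.
by move=> -> h; exact: h.
Qed.
Lemma frc_ltR : frc c r (ltR x y) <-> ~ le_real g f.
Proof.
have := frc_arith2 (isT : arith (ltR (v0 : tm [:: t1; t1] t1) v1)) hx hy.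
have := sat_ltR (M := Mstd) (gcons1 f (gcons1 g enil)) v0 v1.
by move=> -> h; exact: h.
Qed.
End Terms.

Lemma frc_All G c (r : env names G) t (A : fm (t :: G)) (x : names t) :
  frc c r (All t A) -> per c x x -> frc c (econs x r) A.
Proof. move=> h hx. exact (h c x (cond_refl c) hx). Qed.
Lemma frc_Imp G c (r : env names G) A B : frc c r (A ⊃ B) -> frc c r A -> frc c r B.
Proof. by move=> h; apply: h (cond_refl c). Qed.
Lemma frc_Ex G c (r : env names G) t (A : fm (t :: G)) (x : names t) :
  per c x x -> frc c (econs x r) A -> frc c r (Ex t A).
Proof.
by move=> hx hA; apply: dense_all => d hd; exists x; [apply: per_mono hx|apply: frc_mono hA].
Qed.
Lemma frc_ExE G c (r : env names G) t (A : fm (t :: G)) : frc c r (Ex t A) ->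
  exists2 e, ext e c & exists2 x : names t, per e x x & frc e (econs x r) A.
Proof. exact: dense_here. Qed.
Lemma frc_AllI G c (r : env names G) t (A : fm (t :: G)) :
  (forall d (x : names t), ext d c -> per d x x -> frc d (econs x r) A) -> frc c r (All t A).
Proof. by []. Qed.
Lemma frc_ImpI G c (r : env names G) A B :
  (forall d, ext d c -> frc d r A -> frc d r B) -> frc c r (A ⊃ B).
Proof. by []. Qed.
Lemma frc_And G c (r : env names G) A B : frc c r (A ⊓ B) -> frc c r A /\ frc c r B.
Proof. by []. Qed.
Lemma fcmp_det c (x : name tN) n : fcmp eq c x (fun _ => n) ->
  exists2 e, ext e c & det (part e) x n.
Proof.
move=> /dense_here[e he [a [b [h1 h2 ab]]]]; exists e => //.
by have := h2 _ (@wle_refl _ _) => /= ->; rewrite -ab.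
Qed.
Lemma fcmp_uniq c (x y : name tN) n m : fcmp eq c x y -> det (part c) x n -> det (part c) y m -> n = m.
Proof.
move=> /dense_here[e he [a [b [h1 h2 ab]]]] hx hy.
by rewrite (det_uniq (det_upward he hx) h1) (det_uniq (det_upward he hy) h2).
Qed.
Lemma det_fcmp c (x y : name tN) n : det (part c) x n -> det (part c) y n -> fcmp eq c x y.
Proof.
by move=> hx hy; apply: dense_all => d hd; exists n, n; split=> //; apply: det_upward hd _.
Qed.
End ForcedReals.

Section ForcedHBC.
Variable key : Type.
Local Notation name := (name key).
Local Notation names := (names key).
Local Notation cond := (cond key).
Implicit Types c d e : cond.
Local Notation perN := (@per key tN).
Local Notation per1 := (@per key t1).
Local Notation per2 := (@per key tR2).
Local Opaque real eqR ltR in01.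

Definition env1 (F : name tR2) : env names [:: tR2] := econs (M := names) (s := tR2) F enil.

Definition memF (c : cond) (F : name tR2) (f g : Mstd t1) :=
  [/\ is_real f, is_real g & det (part c) (F (hat f) (hat g)) 1].

Lemma memF_frc c G (r : env names G) (t : tm G tR2) (x y : tm G t1) (F : name tR2) (f g : Mstd t1) :
  memF c F f g -> per1 c (eval r x) (hat f) -> per1 c (eval r y) (hat g) ->
  eval r t = F -> per2 c F F -> frc c r (memR2 t x y).
Proof.
move=> [rf rg hd] hx hy e hF; split; first exact/(frc_real hx).
split; first exact/(frc_real hy).
apply: (@per_trans _ tN _ _ (F (hat f) (hat g))); last exact: per_det.
rewrite /= e; exact: (hF c _ _ (cond_refl c) hx c _ _ (cond_refl c) hy).
Qed.

Lemma frc_memF c G (r : env names G) (t : tm G tR2) (x y : tm G t1) (F : name tR2) (f g : Mstd t1) :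
  frc c r (memR2 t x y) -> per1 c (eval r x) (hat f) -> per1 c (eval r y) (hat g) ->
  eval r t = F -> per2 c F F -> exists2 e, ext e c & memF e F f g.
Proof.
move=> + hx hy e hF; move=> [/(frc_real hx) rf [/(frc_real hy) rg h]].
have h1 : perN c (F (hat f) (hat g)) (fun _ => 1).
  apply: (@per_trans _ tN _ _ _ _ _ h); rewrite /= e.
  exact: (perN_sym (hF c _ _ (cond_refl c) hx c _ _ (cond_refl c) hy)).
by have [d hd h2] := fcmp_det h1; exists d.
Qed.

Lemma memF_mono c d F f g : ext d c -> memF c F f g -> memF d F f g.
Proof. by move=> h [h1 h2 h3]; split=> //; apply: det_upward h h3. Qed.

Definition covers01 : fm [:: tR2] :=
  All01 (Exs [:: t1; t1] (memR2 v3 v0 v1 ⊓ in_interval v0 v1 v2)).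
Definition finite_subcover : fm [:: tR2] :=
  Exs [:: tN ⟶ t1; tN ⟶ t1; tN]
    (All tN (v0 ⪯ v3 ⊃ memR2 v4 (v1 · v0) (v2 · v0))
     ⊓ All01 (Ex tN (v0 ⪯ v4 ⊓ in_interval (v2 · v0) (v3 · v0) v1))).

(** The index is onto, so fusion finds one condition that determines for every [n] a ground pair of
    index [n]. Injectivity of the index shows that these pairs exhaust the set up to equality of
    reals; they therefore cover the ground unit interval, to which all reals of the extension
    belong. *)
Lemma frc_finite_subcover c1 F : per2 c1 F F -> frc c1 (env1 F) (strongly_countableR2 v0) ->
  frc c1 (env1 F) covers01 -> frc c1 (env1 F) finite_subcover.
Proof.
move=> hF1 hZ hC; apply: frc_dense => c2 hc2.
have hF2 := perR2_mono hc2 hF1.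
have [c3 hc3 [Z hZ3 /frc_And[_ /frc_And[Zinj Zsurj]]]] := frc_ExE (frc_mono hc2 hZ).
have {}hC := frc_mono (cond_trans hc3 hc2) hC.
have hF3 := perR2_mono hc3 hF2.
have hat2 d f g (X : name tR2) : per2 d X X -> perN d (X (hat f) (hat g)) (X (hat f) (hat g)).
  by move=> h; apply: (h d _ _ (cond_refl d) (@per_hat _ d f) d _ _ (cond_refl d) (@per_hat _ d g)).
(* Pairs are required to be ground and all values determined, so that the requirement depends on the
   part of [d] only. *)
pose E n d := exists f g, memF d F f g /\ det (part d) (Z (hat f) (hat g)) n.
have [c4 hc4 hE] : exists2 c4, ext c4 c3 & forall n, E n c4.
  apply: fusion => [n d e hde [f [g [[h1 h2 h3] h4]]]|n d hd].
    by exists f, g; split; [split=> //|]; apply: det_mono hde _.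
  have hs := frc_All (x := (fun _ => n) : names tN) (frc_mono hd Zsurj) (@per_const _ d n).
  have [d1 hd1 [b hb {}hs]] := frc_ExE hs; have [d2 hd2 [a ha /frc_And[hm hz]]] := frc_ExE hs.
  have [d3 hd3 [f hf]] := dense_here (ground_per ha).
  have [d4 hd4 [g hg]] := dense_here (ground_per (per1_mono (cond_trans hd3 hd2) hb)).
  have h40 := cond_trans hd4 (cond_trans hd3 (cond_trans hd2 (cond_trans hd1 hd))).
  have hF4 := perR2_mono h40 hF3; have hZ4 := perR2_mono h40 hZ3.
  have hf4 := per1_mono hd4 hf.
  have hm4 := frc_mono (cond_trans hd4 hd3) hm.
  have [d5 hd5 m5] : exists2 e, ext e d4 & memF e F f g := frc_memF hm4 hf4 hg erefl hF4.
  have hz4 : perN d4 (Z (hat f) (hat g)) (fun _ => n).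
    apply: (@per_trans _ tN _ _ (Z a b)); last exact: (perN_mono (cond_trans hd4 hd3) hz).
    exact: (perN_sym (hZ4 d4 _ _ (cond_refl d4) hf4 d4 _ _ (cond_refl d4) hg)).
  have [d6 hd6 z6] := fcmp_det (perN_mono hd5 hz4).
  exists d6; last by exists f, g; split=> //; apply: memF_mono m5.
  exact: cond_trans hd6 (cond_trans hd5 (cond_trans hd4 (cond_trans hd3 (cond_trans hd2 hd1)))).
have /choice[A /choice[B hB]] := hE.
have rA n : is_real (A n) by case: (hB n) => -[].
have rB n : is_real (B n) by case: (hB n) => -[].
have hF4 := perR2_mono hc4 hF3; have hZ4 := perR2_mono hc4 hZ3.
have [k hk] : exists k, forall x : Mstd t1, is01 x ->
    exists2 i, (i <= k)%N & ~ le_real x (A i) /\ ~ le_real (B i) x.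
  (* This covering statement is about the ground model, so it may be checked below any extension: an
     interval containing [x] is found there, its index [n] is determined, and injectivity identifies
     it with the pair [A n], [B n]. *)
  apply: heine_borel => // x hx.
  have hi : frc c4 (ncons1 (hat x) (env1 F)) (in01 v0).
    by apply/(frc_in01 (f := x)) => //; apply: per_hat.
  have hs := frc_Imp (frc_All (x := hat x : names t1) (frc_mono hc4 hC) (@per_hat _ c4 x)) hi.
  have [d1 hd1 [b hb {}hs]] := frc_ExE hs; have [d2 hd2 [a ha /frc_And[hm /frc_And[hl hr]]]] := frc_ExE hs.
  have [d3 hd3 [f hf]] := dense_here (ground_per ha).
  have [d4 hd4 [g hg]] := dense_here (ground_per (per1_mono (cond_trans hd3 hd2) hb)).
  have h40 := cond_trans hd4 (cond_trans hd3 (cond_trans hd2 hd1)).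
  have hF5 := perR2_mono h40 hF4; have hZ5 := perR2_mono h40 hZ4.
  have hf4 := per1_mono hd4 hf.
  have h42 := cond_trans hd4 hd3.
  have [d5 hd5 m5] : exists2 e, ext e d4 & memF e F f g := frc_memF (frc_mono h42 hm) hf4 hg erefl hF5.
  have lf : ~ le_real x f.
    by move: (frc_mono h42 hl); apply: (proj1 (frc_ltR _ _)) => //; apply: per_hat.
  have gl : ~ le_real (g : Mstd t1) x.
    by move: (frc_mono h42 hr); apply: (proj1 (frc_ltR _ _)) => //; apply: per_hat.
  have [d6 hd6 [n [z6 _]]] := dense_here (total_det (hat2 d5 f g Z (perR2_mono hd5 hZ5))).
  have h64 := cond_trans hd6 (cond_trans hd5 h40).
  have [mn zn] := hB n.
  have inj := frc_mono (cond_trans h64 hc4) Zinj.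
  have {}inj := frc_All (x := hat (B n) : names t1) inj (@per_hat _ d6 (B n)).
  have {}inj := frc_All (x := hat (A n) : names t1) inj (@per_hat _ d6 (A n)).
  have {}inj := frc_All (x := hat g : names t1) inj (@per_hat _ d6 g).
  have {}inj := frc_All (x := hat f : names t1) inj (@per_hat _ d6 f).
  have hF6 := perR2_mono h64 hF4.
  move: (frc_Imp inj); set P := frc _ _ _ => {}inj; have {}inj : P -> _ := inj.
  have p : P.
    split.
      by apply: (memF_frc (memF_mono hd6 m5) _ _ _ hF6) => //; apply: per_hat.
    by apply: (memF_frc (memF_mono h64 mn) _ _ _ hF6) => //; apply: per_hat.
  have /frc_And[h1 h2] := frc_Imp (inj p) (det_fcmp z6 (det_upward h64 zn)).
  have [e1 e2] : @eq_real Mstd f (A n).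
    by move: h1; apply: (proj1 (frc_eqR _ _)); apply: per_hat.
  have [e3 e4] : @eq_real Mstd g (B n).
    by move: h2; apply: (proj1 (frc_eqR _ _)); apply: per_hat.
  have [rf rg _] := m5; have [rx _ _] := hx.
  exists n; split=> h; first by apply: lf; apply: le_real_trans h e2.
  by apply: gl; apply: le_real_trans e3 h.
exists c4; first exact: cond_trans hc4 hc3.
(* The canonical name of a ground sequence of reals; the two enumerations themselves are the
   witnesses, and only [k] comes from compactness. *)
pose seq_name (X : nat -> nat -> nat) : names (tN ⟶ t1) := fun i n q => X (i q) (n q).
have per_seq X d : per d (seq_name X) (seq_name X).
  by move=> d1 i i' hd hi d2 n n' hd2 hn; apply: per_op hn; apply: (@per_mono _ tN) hd2 hi.
apply: (frc_Ex (x := (fun _ => k) : names tN)); first exact: per_const.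
apply: (frc_Ex (x := seq_name B)); first exact: per_seq.
apply: (frc_Ex (x := seq_name A)); first exact: per_seq.
split; apply: frc_AllI => d.
  move=> i hd hi; apply: frc_ImpI => e he _.
  apply: frc_dense; apply: dense_imp (total_det (perN_mono he hi)) => e1 he1 [n [hn _]].
  have h14 := cond_trans he1 (cond_trans he hd); have [mn _] := hB n.
  have p X : per1 e1 (seq_name X i) (hat (X n)).
    exact: (per_seq X e1 e1 i (fun _ => n) (cond_refl e1) (per_det hn)).
  by apply: (memF_frc (memF_mono h14 mn) _ _ _ (perR2_mono h14 hF4)) => //; apply: p.
move=> x hd hx; apply: frc_ImpI => e he h01.
apply: frc_dense; apply: dense_imp (ground_per (per1_mono he hx)) => e1 he1 [f hf].
have f01 : @is01 Mstd f by move: (frc_mono he1 h01); apply: (proj1 (frc_in01 _)).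
have [i ik [la lb]] := hk f f01.
apply: (frc_Ex (x := (fun _ => i) : names tN)); first exact: per_const.
split; last split.
- apply: dense_all => e2 _; move: ik; rewrite leq_eqVlt => /orP[/eqP ->|ik]; [right|left].
    by apply: (@det_fcmp _ _ _ _ k) => q _.
  by apply: dense_all => e3 _; exists i, k.
- by apply/(frc_ltR (f := A i) (g := f)) => //; apply: per_hat.
- by apply/(frc_ltR (f := f) (g := B i)) => //; apply: per_hat.
Qed.

Lemma frc_HBC1 c : frc c (enil : env names [::]) HBC1.
Proof.
apply: frc_AllI => c0 F _ hF0; apply: frc_ImpI => c1 hc1 /frc_And[_ /frc_And[hZ hC]].
exact: (frc_finite_subcover (perR2_mono hc1 hF0) hZ hC).
Qed.
End ForcedHBC.

(** * The generic injection *)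

Section Generic.
Definition rclass := (nat -> nat) -> Prop.
(** Keys are classes of equal reals rather than representatives, so that the generic functional
    respects equality of reals and its injectivity speaks of distinct reals. *)
Definition class_of (f : Mstd t1) : rclass := fun g => is_real (g : Mstd t1) /\ eq_real f g.
Local Notation names := (names rclass).
Local Notation cond := (cond rclass).
Implicit Types c d e : cond.
Local Opaque eqR in01.

Lemma class_ofP (f g : Mstd t1) : is_real f -> is_real g ->
  class_of f = class_of g <-> eq_real f g.
Proof.
move=> rf rg; split=> [e|fg].
  by have [] : class_of f g by rewrite e; split=> //; apply: eq_real_refl.
apply: funext => h; apply: propext; split=> -[rh e]; split=> //.
  exact: eq_real_trans rg rh (eq_real_sym fg) e.
exact: eq_real_trans rf rh fg e.
Qed.

Definition is_value c (x : name rclass t1) n := exists f : Mstd t1,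
  (forall m, det (part c) (x (fun _ => m)) (f m)) /\ part c (class_of f) = Some n.

(** The value is read from the world at the class of the ground real that [x] is determined to be.
    It is 0 by default while [x] or that value is undetermined; determined values never meet the
    default. *)
Definition generic : name rclass t2 := fun x q =>
  match pselect
    (exists f : Mstd t1, forall m, det q (x (fun _ => m)) (f m)) with
  | left h => odflt 0 (q (class_of (proj1_sig (cid h))))
  | right _ => 0
  end.

Lemma generic_det c x n : is_value c x n -> det (part c) (generic x) n.
Proof.
move=> [f [hf hn]] q hq; rewrite /generic; case: pselect => [h|[]].
  move: (proj2_sig (cid h)); set g := sval _ => hg.
  have -> : g = f by apply: funext => m; apply: det_uniq (hg m) _; apply: det_mono (hf m).
  by rewrite (hq _ _ hn).
by exists f => m; apply: det_mono (hf m).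
Qed.

Lemma is_value_mono c d x n : ext d c -> is_value c x n -> is_value d x n.
Proof.
move=> h [f [hf hn]]; exists f; split=> [m|]; first by apply: det_upward h (hf m).
exact: (ext_wle h).
Qed.

Lemma decide_key c k : exists2 d, ext d c & exists n, part d k = Some n.
Proof.
case e : (part c k) => [n|]; first by exists c; [exact: cond_refl|exists n].
have [n _ hn] := free_inf c 0.
pose p : world rclass := fun k' => if pselect (k' = k) then Some n else part c k'.
have pE k' m : p k' = Some m -> k' = k /\ m = n \/ part c k' = Some m /\ m <> n.
  rewrite /p; case: pselect => /= [k'k [<-]|_ h]; first by left.
  by right; split=> // mn; apply: (free_part h); rewrite mn.
have p_inj k1 k2 m : p k1 = Some m -> p k2 = Some m -> k1 = k2.
  move=> /pE[[-> ->]|[h1 n1]] /pE[[-> e2]|[h2 n2]] //.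
  exact: part_inj h1 h2.
(* Asking for a free value beyond [n.+1] as well makes it different from [n], the value just
   spent. *)
have p_inf m : exists2 j, m <= j & free c j /\ j <> n.
  by have [j hj fj] := free_inf c (maxn m n.+1); exists j; [exact: leq_trans (leq_maxl _ _) hj|
    split=> // jn; move: (leq_trans (leq_maxr m n.+1) hj); rewrite jn ltnn].
have p_free k' m : p k' = Some m -> ~ (free c m /\ m <> n).
  by move=> /pE[[_ ->]|[h _]] [fm] //; case: (free_part h fm).
exists (Cond p_inj p_inf p_free); last by exists n; rewrite /= /p; case: pselect.
split=> /= [k' m h|k' m /pE[[_ ->]|[h _]]|m []] //; [|by right|by left].
by rewrite /p; case: pselect => //= e'; rewrite e' e in h.
Qed.

Lemma is_value_dense c x : per (t := t1) c x x -> dense (fun d => exists n, is_value d x n) c.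
Proof.
move=> hx d hd; have [e he [f hf]] := dense_here (dense_mono hd (ground_dense hx)).
have [e1 he1 [n hn]] := decide_key e (class_of f); exists e1; first exact: cond_trans he1 he.
by exists n, f; split=> // m; apply: det_upward he1 (hf m).
Qed.

Lemma generic_per c : per (t := t2) c generic generic.
Proof.
move=> d x y hd hxy; have hx := per1_refl hxy.
have hy := per1_refl (per1_sym hxy).
have u z : upward (fun e => exists n, is_value e z n).
  by move=> e e' he [n hn]; exists n; apply: is_value_mono hn.
apply: dense_imp (dense_and (@u x) (is_value_dense hx) (is_value_dense hy)) => e he.
move=> [[n hn] [m hm]]; exists n, m; split; [exact: generic_det|exact: generic_det|].
move: hn hm => [f [hf ef]] [g [hg eg]]; have fg : f = g.
  apply: funext => i; have [e' he' [j [h1 h2]]] := dense_here (total_det (hxy e _ _ he (@per_const _ e i))).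
  by rewrite (det_uniq (det_upward he' (hf i)) h1) (det_uniq (det_upward he' (hg i)) h2).
by move: ef; rewrite fg eg => -[].
Qed.

Lemma is_value_ground c x n : per (t := t1) c x x -> is_value c x n ->
  exists2 f : Mstd t1, per (t := t1) c x (hat f) & part c (class_of f) = Some n.
Proof. by move=> hx [f [hf hn]]; exists f => //; apply: det_hat. Qed.

Lemma generic_fun01N c : frc c (econs (M := names) (s := t2) generic enil) (fun01N v0).
Proof.
apply: frc_AllI => c1 x _ hx; apply: frc_ImpI => c2 h2 x01.
apply: frc_AllI => c3 y h3 hy; apply: frc_ImpI => c4 h4 y01; apply: frc_ImpI => c5 h5 xy.
have {}hx := per1_mono (cond_trans h5 (cond_trans h4 (cond_trans h3 h2))) hx.
have {}hy := per1_mono (cond_trans h5 h4) hy.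
have {}x01 := frc_mono (cond_trans h5 (cond_trans h4 h3)) x01; have {}y01 := frc_mono h5 y01.
apply: frc_dense => d hd.
have [d1 hd1 [n xn]] := is_value_dense hx hd.
have [d2 hd2 [m ym]] := is_value_dense hy (cond_trans hd1 hd).
have h25 := cond_trans hd2 (cond_trans hd1 hd); have {}xn := is_value_mono hd2 xn.
have [f hf ef] := is_value_ground (per1_mono h25 hx) xn.
have [g hg eg] := is_value_ground (per1_mono h25 hy) ym.
have [rf _ _] : is01 f by move: (frc_mono h25 x01); apply: (proj1 (frc_in01 _)).
have [rg _ _] : is01 g by move: (frc_mono h25 y01); apply: (proj1 (frc_in01 _)).
have fg : eq_real f g by move: (frc_mono h25 xy); apply: (proj1 (frc_eqR _ _)).
exists d2; first exact: cond_trans hd2 hd1.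
have e : class_of f = class_of g by apply/(class_ofP rf rg).
apply: (@det_fcmp _ _ _ _ n); first exact: generic_det.
by move: (generic_det ym); move: ef; rewrite e eg => -[->].
Qed.

(** Below some extension both arguments are ground reals with determined values. Equal values give
    equal classes, because the part of a condition is injective, and this contradicts that the reals
    are forced to differ. *)
Lemma generic_collision c : ~ frc c (econs (M := names) (s := t2) generic enil) (collision v0).
Proof.
move=> /frc_ExE[c1 _ [x hx1 /frc_And[x01 /frc_ExE[c2 h2 [y hy /frc_And[y01 /frc_And[xy xyv]]]]]]].
have hx := per1_mono h2 hx1.
have [d1 hd1 [n xn]] := dense_here (is_value_dense hx).
have [d2 hd2 [m ym]] := is_value_dense hy hd1.
have h12 := cond_trans hd2 hd1; have {}xn := is_value_mono hd2 xn.
have [f hf ef] := is_value_ground (per1_mono h12 hx) xn.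
have [g hg eg] := is_value_ground (per1_mono h12 hy) ym.
have [rf _ _] : is01 f by move: (frc_mono (cond_trans h12 h2) x01); apply: (proj1 (frc_in01 _)).
have [rg _ _] : is01 g by move: (frc_mono h12 y01); apply: (proj1 (frc_in01 _)).
have nm : n = m := fcmp_uniq (frc_mono h12 xyv) (generic_det xn) (generic_det ym).
rewrite nm in ef; have fg : eq_real f g by apply/(class_ofP rf rg); apply: part_inj ef eg.
apply: (frc_Imp (frc_mono h12 xy)); by apply/(frc_eqR (f := f) (g := g)).
Qed.

Definition start : cond := @Cond rclass (fun _ => None) (fun _ => True)
  (fun k k' m h _ => match h with end) (fun n => ex_intro2 _ _ n (leqnn n) I)
  (fun k m h _ => match h with end).

Lemma Z2w_HBC1_not_NIN : ~ proves (add_axiom Z2w HBC1) NIN.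
Proof.
move=> h; have hT : @forces_theory rclass (add_axiom Z2w HBC1).
  move=> G A c r hr [/forces_Z2w|->]; first exact.
  by rewrite frc_lift; apply: frc_HBC1.
have /frc_All hN := frc_sound hT h (c := start) (r := enil) (fun t v => match var_nil v with end) (fun B b => match b with end).
have hg := hN (generic : names t2) (generic_per (c := start)).
exact (generic_collision (frc_Imp hg (@generic_fun01N start))).
Qed.
End Generic.

Theorem theorem3p33 :
  proves RCA0w (HBC1 ⊃ NBI) /\ ~ proves (add_axiom Z2w HBC1) NIN.
Proof. exact (conj RCA0w_HBC1_NBI Z2w_HBC1_not_NIN). Qed.
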